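(* Let $p\in(0,1)$ and $(s,t)\in(0,\infty)^2$. Define $$I_{s,t}(r)=\begin{cases}J_{s,t}(r), & r\in[g_{pp}(s,t),s],\\ \infty, & \text{otherwise.}\end{cases}$$ Then the distributions of $N^{-1}G_{\lfloor Ns\rfloor,\lfloor Nt\rfloor}$ satisfy a large deviation principle with normalisation $N$ and rate function $I_{s,t}$. Precisely, for any closed set $F$ and any open set $H$ in $[0,s]$, $$\limsup_{N\to\infty}N^{-1}\log\mathbb P\{N^{-1}G_{\lfloor Ns\rfloor,\lfloor Nt\rfloor}\in F\}\le-\inf_{r\in F}I_{s,t}(r),$$ $$\liminf_{N\to\infty}N^{-1}\log\mathbb P\{N^{-1}G_{\lfloor Ns\rfloor,\lfloor Nt\rfloor}\in H\}\ge-\inf_{r\in H}I_{s,t}(r).$$ Moreover, on $[g_{pp}(s,t),s]$ the function $I_{s,t}$ is finite, strictly increasing, continuous and convex, and the unique zero of $I_{s,t}$ is at $r=g_{pp}(s,t)$.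
   Context: Let $\{\omega_v\}_{v\in\mathbb Z_+^2}$ be i.i.d. Bernoulli($p$) random variables with values in $\{0,1\}$ and $\mathbb P\{\omega_v=1\}=p$, where $\mathbb Z_+=\{0,1,2,\dots\}$. An admissible path from $v$ to $w$ is a sequence $v=v_0,v_1,\dots,v_k=w$ in $\mathbb Z_+^2$ with $v_{i+1}-v_i\in\{e_1,e_2\}$. The last passage time is $$G_{v,w}=\max_{\pi}\sum_{i}\omega_{v_{i+1}}\mathbf 1\{v_{i+1}-v_i=e_1\},$$ the maximum over admissible paths from $v$ to $w$ (weights are collected only through horizontal steps; $G_{v,v}=0$), and $G_{m,n}=G_{(0,0),(m,n)}$. The law of large numbers limit of $N^{-1}G_{\lfloor Ns\rfloor,\lfloor Nt\rfloor}$ is $g_{pp}(s,t)=\big(\sqrt{ps}+\sqrt{(1-p)t}\big)^2-t$ if $t<s\frac{1-p}{p}$ and $g_{pp}(s,t)=s$ if $t\ge s\frac{1-p}{p}$. The right-tail rate function is $J_{s,t}(r)=-\lim_{N\to\infty}N^{-1}\log\mathbb P\{G_{\lfloor Ns\rfloor,\lfloor Nt\rfloor}\ge Nr\}$ for $0\le r<s$ (the limit exists), and at $r=s$ it is defined by continuous extension, $J_{s,t}(s)=\lim_{r\nearrow s}J_{s,t}(r)$. *)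

(* Defs.v *)
From mathcomp Require Import all_boot all_order all_algebra.
From mathcomp Require Import all_classical all_reals all_analysis.
Import Order.TTheory GRing.Theory Num.Theory.
Import numFieldNormedType.Exports.

Set Implicit Arguments.
Unset Strict Implicit.
Unset Printing Implicit Defensive.

Local Open Scope classical_set_scope.
Local Open Scope ring_scope.

Definition site := (nat * nat)%type.

Definition right_of (v : site) : site := (v.1.+1, v.2).
Definition above (v : site) : site := (v.1, v.2.+1).

(* A path v = v_0, v_1, ..., v_k is given by v and pi = [:: v_1; ...; v_k]. *)
Definition admissible (v w : site) (pi : seq site) : Prop :=
  path (fun a b => (b == right_of a) || (b == above a)) v pi /\ last v pi = w.

Definition path_weight (om : site -> bool) (v : site) (pi : seq site) : nat :=
  sumn (pairmap (fun a b => if b == right_of a then om b : nat else 0%N) v pi).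

(* The maximum ranges over a finite set of paths, see finite_admissible; it is
   0 when w cannot be reached from v. *)
Definition last_passage (om : site -> bool) (v w : site) : nat :=
  \big[maxn/0%N]_(pi \in [set pi | admissible v w pi]) path_weight om v pi.

Lemma finite_admissible (v w : site) : finite_set [set pi | admissible v w pi].
Proof.
pose e (a b : site) := (b == right_of a) || (b == above a).
have fin k u : finite_set [set pi | path e u pi /\ size pi = k].
  elim: k u => [|k IH] u.
    by apply: (sub_finite_set _ (finite_set1 [::])) => -[|? ?] [].
  apply: (@sub_finite_set _ _ (cons (right_of u) @`
      [set pi | path e (right_of u) pi /\ size pi = k] `|` cons (above u) @`
      [set pi | path e (above u) pi /\ size pi = k])); last first.
    by rewrite finite_setU; split; apply: finite_image.
  move=> [|b pi] [] //= /andP[/orP[]/eqP -> pib] [spi].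
    by left; exists pi.
  by right; exists pi.
have szE pi u : path e u pi ->
    (size pi + (u.1 + u.2) = (last u pi).1 + (last u pi).2)%N.
  elim: pi u => //= b pi IH u /andP[ub /IH <-].
  by case/orP: ub => /eqP -> /=; rewrite ?addSn ?addnS.
apply: (sub_finite_set _ (fin (w.1 + w.2 - (v.1 + v.2))%N v)) => pi [pv wE].
by split=> //; rewrite -wE -(szE _ _ pv) addnK.
Qed.

Lemma path_weight_le_last_passage (om : site -> bool) (v w : site) pi :
  admissible v w pi -> (path_weight om v pi <= last_passage om v w)%N.
Proof.
move=> vw; rewrite /last_passage.
have [->//|n0] := eqVneq (path_weight om v pi) 0%N.
apply: leq_bigmax_seq => //.
rewrite in_finite_support ?inE; first by split=> //=; apply/eqP.
by apply: sub_finite_set (finite_admissible v w); apply: subIsetl.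
Qed.

Lemma last_passage_attained (om : site -> bool) (v w : site) :
  (exists pi, admissible v w pi) ->
  exists2 pi, admissible v w pi & path_weight om v pi = last_passage om v w.
Proof.
move=> [pi0 pi0P]; rewrite /last_passage.
set s := finite_support _ _ _.
have sP pi : pi \in s -> admissible v w pi.
  rewrite in_finite_support ?inE; first by case.
  by apply: sub_finite_set (finite_admissible v w); apply: subIsetl.
have [/eqP s0|s0] := boolP (\big[maxn/0%N]_(pi <- s) path_weight om v pi == 0%N).
  have := path_weight_le_last_passage om pi0P.
  by rewrite /last_passage -/s s0 leqn0 => /eqP; exists pi0.
suff: \big[maxn/0%N]_(pi <- s) path_weight om v pi = 0%N \/
    exists2 pi, pi \in s & path_weight om v pi =
      \big[maxn/0%N]_(pi <- s) path_weight om v pi.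
  case=> [|[pi /sP piP <-]]; [by move/eqP; rewrite (negbTE s0) | by exists pi].
move: s {sP s0}; elim=> [|a s IH]; first by left; rewrite big_nil.
rewrite big_cons.
have [le|lt] := leqP (path_weight om v a) (\big[maxn/0%N]_(pi <- s) path_weight om v pi).
  case: IH => [|[pi pis piE]]; first by left.
  by right; exists pi => //; rewrite inE pis orbT.
by right; exists a => //; rewrite inE eqxx.
Qed.

(* i.i.d. Bernoulli(p), the value 1 being encoded by true; mutual independence
   is the product rule over every finite family of distinct sites. *)
Definition iid_bernoulli (d : measure_display) (T : measurableType d)
    (R : realType) (P : probability T R) (p : R)
    (omega : site -> {RV P >-> bool}) : Prop :=
  (forall (v : site) (B : set bool),
     distribution P (omega v) B = bernoulli_prob p B) /\
  (forall (vs : seq site) (B : site -> set bool), uniq vs ->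
     P (\bigcap_(v in [set` vs]) (omega v @^-1` B v)) =
     (\prod_(v <- vs) P (omega v @^-1` B v))%E).

(* G_{floor(N s), floor(N t)} at the outcome x *)
Definition G_floor (d : measure_display) (T : measurableType d)
    (R : realType) (P : probability T R) (omega : site -> {RV P >-> bool})
    (s t : R) (N : nat) (x : T) : nat :=
  last_passage (fun v => omega v x) (0%N, 0%N)
    (Num.truncn (N%:R * s), Num.truncn (N%:R * t)).

(* N^{-1} log P(A) in the extended reals, with log 0 = -oo *)
Definition log_prob (d : measure_display) (T : measurableType d)
    (R : realType) (P : probability T R) (N : nat) (A : set T) : \bar R :=
  ((N%:R^-1)%:E * lne (P A))%E.

Definition g_pp (R : realType) (p s t : R) : R :=
  if t < s * ((1 - p) / p)
  then (Num.sqrt (p * s) + Num.sqrt ((1 - p) * t)) ^+ 2 - t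
  else s.

Definition right_tail (d : measure_display) (T : measurableType d)
    (R : realType) (P : probability T R) (omega : site -> {RV P >-> bool})
    (s t r : R) : \bar R :=
  (- limn (fun N : nat =>
       log_prob P N [set x | (N%:R * r <= (G_floor omega s t N x)%:R)%R]))%E.

(* Only meaningful for 0 <= r <= s. *)
Definition J_rate (d : measure_display) (T : measurableType d)
    (R : realType) (P : probability T R) (omega : site -> {RV P >-> bool})
    (s t r : R) : \bar R :=
  if r < s then right_tail omega s t r
  else lim (right_tail omega s t r' @[r' --> s^'-]).

Definition I_rate (d : measure_display) (T : measurableType d)
    (R : realType) (P : probability T R) (omega : site -> {RV P >-> bool})
    (p s t r : R) : \bar R :=
  if g_pp p s t <= r <= s then J_rate omega s t r else +oo%E.

Definition closed_in (X : topologicalType) (A F : set X) : Prop :=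
  exists2 C : set X, closed C & F = A `&` C.

Definition open_in (X : topologicalType) (A H : set X) : Prop :=
  exists2 U : set X, open U & H = A `&` U.

(* Main.v *)
Require Import Defs.
From mathcomp Require Import all_boot all_order all_algebra.
From mathcomp Require Import all_classical all_reals all_analysis.
From mathcomp Require Import zify ring lra.
Import Order.TTheory GRing.Theory Num.Theory.
Import numFieldNormedType.Exports.
Set Implicit Arguments.
Unset Strict Implicit.
Unset Printing Implicit Defensive.
Local Open Scope classical_set_scope.
Local Open Scope ring_scope.

(** Let g = g_pp(s,t), and let J be the right-tail rate. The large deviation
principle reduces to three facts about the tails of G = G_{Ns,Nt} (floors are
omitted here): the right-tail rate exists and is convex, it is positive exactly
beyond g, and P(G <= N r) decays faster than any exponential when r < g.

Existence and convexity come from superadditivity. Two paths that use disjoint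
columns are concatenated, so P(G_N >= N r) is supermultiplicative in N and in
the threshold. Fekete's argument gives [q_le_J] and [q_ge_J], which sandwich the
tail between exponentials of rate J; convexity [J_convex] follows by mixing two
thresholds, and convexity yields continuity and strict growth after the last
zero. The value at r = s is the supremum of J, which makes the extended function
[Jbar] continuous on the line and convex up to s.

The value of g comes from a stationary version of the model. Put independent
Bernoulli(u) increments on the horizontal axis and independent geometric
increments on the vertical one, with p < u < 1 and the ratio [rho_of]. Then
every row again carries independent Bernoulli(u) increments ([burke_rows]), so
the stationary passage time to (m,n) is a sum of n geometric plus a sum of m
Bernoulli variables, whose mean is m u + n v(u), with v(u) = p(1-u)/(u-p).
Minimizing s u + t v(u) over u gives g. Boundary values only increase passage
times, so Chernoff bounds for these sums give the upper tail
([lpp_upper_tail]), hence J > 0 beyond g.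

For the lower bound, a maximal path of the stationary model either leaves the
axes close to the origin, and then the model without boundary is almost as good,
or it follows an axis over a macroscopic distance. In the second case the rest
of the path lives in a smaller rectangle, where it is dominated by a stationary
model with another parameter: u larger for a long horizontal piece, u smaller
for a long vertical one. Since u is a critical point of the mean, the change of
parameter costs only a second-order amount while the shorter side saves a
first-order one, so these paths are too short ([far_horizontal], [far_vertical],
[lpp_lower_tail], [lln_lower]). Hence J vanishes up to g.

For the left tail, the rectangle is cut into disjoint cells, and arbitrarily
many parallel diagonal corridors of cells all have to be slow; each one has
exponentially small probability by the law of large numbers inside one cell
([corridors], [left_tail]).

All probabilities are computed on finite laws: lists of weighted outcomes, with
expectations that are finite sums. The geometric variables are truncated at a
level L, the statements being uniform in L so that L can be sent to infinity
once the boundary variables have disappeared. [family_law] transports the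
events of the probability space to these finite laws. *)

(** * Finitely supported laws and Chernoff bounds *)

Section FiniteLaws.
Context {R : realType}.
Implicit Types (A B : Type).

(** Weighted lists rather than finite types: independent families are then
built by recursion, and unnormalized weights are allowed. *)
Definition law A := seq (R * A).

Definition Ex A (mu : law A) (f : A -> R) : R := \sum_(x <- mu) x.1 * f x.2.

Definition nneg_law A (mu : law A) := all (fun x => 0 <= x.1) mu.

Definition prob_law A (mu : law A) := nneg_law mu /\ Ex mu (fun=> 1) = 1.

Fixpoint lpow A (mu : law A) n : law (seq A) :=
  if n is n'.+1 then
    [seq (x.1 * y.1, x.2 :: y.2) | x <- mu, y <- lpow mu n']
  else [:: (1, [::])].

Lemma Ex_le A (mu : law A) f g : nneg_law mu -> (forall x, f x <= g x) ->
  Ex mu f <= Ex mu g.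
Proof.
rewrite /Ex => + fg; elim: mu => [|x mu IH] /=; first by rewrite !big_nil.
by move=> /andP[x0 /IH ?]; rewrite !big_cons lerD// ler_wpM2l.
Qed.

Lemma eq_Ex A (mu : law A) f g : f =1 g -> Ex mu f = Ex mu g.
Proof. by move=> fg; apply: eq_bigr => x _; rewrite fg. Qed.

Lemma ExD A (mu : law A) f g : Ex mu (fun x => f x + g x) = Ex mu f + Ex mu g.
Proof. by rewrite /Ex -big_split; apply: eq_bigr => x _; rewrite mulrDr. Qed.

Lemma ExZ A (mu : law A) c f : Ex mu (fun x => c * f x) = c * Ex mu f.
Proof. by rewrite /Ex big_distrr; apply: eq_bigr => x _; rewrite mulrCA. Qed.

Lemma ExZr A (mu : law A) c f : Ex mu (fun x => f x * c) = Ex mu f * c.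
Proof. by rewrite mulrC -ExZ; apply: eq_Ex => x; rewrite mulrC. Qed.

Lemma Ex_ge0 A (mu : law A) f : nneg_law mu -> (forall x, 0 <= f x) -> 0 <= Ex mu f.
Proof.
move=> mu0 f0; rewrite -(mul0r (Ex mu f)) -ExZ; apply: Ex_le => // x.
by rewrite mul0r.
Qed.

Lemma Ex_cst A (mu : law A) c : prob_law mu -> Ex mu (fun=> c) = c.
Proof.
by move=> [_ mu1]; rewrite -[RHS]mulr1 -mu1 -ExZ; apply: eq_Ex => x; rewrite mulr1.
Qed.

Lemma Ex_affine A (mu : law A) a c f : prob_law mu ->
  Ex mu (fun x => a + c * f x) = a + c * Ex mu f.
Proof. by move=> mup; rewrite ExD ExZ Ex_cst. Qed.

Lemma Ex_le_cst A (mu : law A) f c : prob_law mu -> (forall x, f x <= c) -> Ex mu f <= c.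
Proof. by move=> mup fc; rewrite -[leRHS](Ex_cst c mup); apply: Ex_le => //; case: mup. Qed.

Lemma Ex_swap A B (mu : law A) (nu : law B) f :
  Ex mu (fun a => Ex nu (f a)) = Ex nu (fun b => Ex mu (f^~ b)).
Proof.
rewrite /Ex; under eq_bigr => x _ do rewrite big_distrr.
rewrite exchange_big; apply: eq_bigr => y _; rewrite big_distrr.
by apply: eq_bigr => x _ /=; rewrite mulrCA.
Qed.

Lemma Ex_lpow0 A (mu : law A) F : Ex (lpow mu 0) F = F [::].
Proof. by rewrite /Ex /= big_seq1 mul1r. Qed.

Lemma Ex_lpowS A (mu : law A) n F :
  Ex (lpow mu n.+1) F = Ex mu (fun a => Ex (lpow mu n) (fun l => F (a :: l))).
Proof.
rewrite /Ex /= big_allpairs_dep; apply: eq_bigr => x _; rewrite big_distrr.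
by apply: eq_bigr => y _ /=; rewrite mulrA.
Qed.

(** The weights carry no information on the outcomes; a predicate that holds on
the whole support is what allows sizes and bounds to be used pointwise. *)
Lemma Ex_le_supp A (P : pred A) (mu : law A) f g : nneg_law mu ->
  all (fun x => P x.2) mu -> (forall x, P x -> f x <= g x) -> Ex mu f <= Ex mu g.
Proof.
rewrite /Ex => + + fg; elim: mu => [|x mu IH] /=; first by rewrite !big_nil.
move=> /andP[x0 /IH {}IH] /andP[Px /IH ?].
by rewrite !big_cons lerD// ler_wpM2l// fg.
Qed.

Lemma all_lpow A (P : pred A) (mu : law A) n : all (fun x => P x.2) mu ->
  all (fun x => (size x.2 == n) && all P x.2) (lpow mu n).
Proof.
move=> muP; elim: n => [|n IH] //=.
elim: mu muP (lpow mu n) IH => [|x mu IHmu] //= /andP[Px muP] nu nuP.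
rewrite all_cat IHmu// andbT all_map; apply: sub_all nuP => y /= /andP[/eqP-> ->].
by rewrite eqxx Px.
Qed.

Lemma nneg_lpow A (mu : law A) n : nneg_law mu -> nneg_law (lpow mu n).
Proof.
rewrite /nneg_law => mu0; elim: n => [|n IH] /=; first by rewrite ler01.
elim: mu mu0 (lpow mu n) IH => [|x mu IHmu] //= /andP[x0 mu0] nu nu0.
rewrite all_cat IHmu// andbT all_map; apply: sub_all nu0 => y /= y0.
exact: mulr_ge0.
Qed.

Lemma prob_lpow A (mu : law A) n : prob_law mu -> prob_law (lpow mu n).
Proof.
move=> muP; split; first by apply: nneg_lpow; case: muP.
elim: n => [|n IH]; first by rewrite Ex_lpow0.
by rewrite Ex_lpowS IH; case: muP.
Qed.

Lemma Ex_lpow_prod A (mu : law A) n (f : A -> R) :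
  Ex (lpow mu n) (fun l => \prod_(a <- l) f a) = Ex mu f ^+ n.
Proof.
elim: n => [|n IH]; first by rewrite Ex_lpow0 big_nil.
rewrite Ex_lpowS exprS -IH -ExZr; apply: eq_Ex => a.
by rewrite -ExZ; apply: eq_Ex => l; rewrite big_cons.
Qed.

Lemma Ex_lpow_cat A (mu : law A) m n (F : seq A -> R) :
  Ex (lpow mu (m + n)) F =
  Ex (lpow mu m) (fun k => Ex (lpow mu n) (fun l => F (k ++ l))).
Proof.
elim: m F => [|m IH] F; first by rewrite Ex_lpow0.
by rewrite addSn !Ex_lpowS; apply: eq_Ex => a; rewrite IH.
Qed.

Lemma Ex_lpow_size A (mu : law A) n (F : seq A -> R) G : nneg_law mu ->
  (forall l, size l = n -> F l <= G l) -> Ex (lpow mu n) F <= Ex (lpow mu n) G.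
Proof.
move=> mu0 FG; apply: (@Ex_le_supp _ (fun l => size l == n)).
- exact: nneg_lpow.
- have := @all_lpow _ predT mu n.
  by rewrite all_predT => /(_ isT); apply: sub_all => x /andP[].
- by move=> l /eqP; exact: FG.
Qed.

Lemma eq_Ex_lpow A (mu : law A) n (F : seq A -> R) G : nneg_law mu ->
  (forall l, size l = n -> F l = G l) -> Ex (lpow mu n) F = Ex (lpow mu n) G.
Proof.
by move=> mu0 FG; apply/eqP; rewrite eq_le !Ex_lpow_size// => l /FG ->.
Qed.

(** A block of q * c independent variables is a family of q independent blocks
of length c; cells and rows of sites are extracted in this way. *)
Lemma Ex_lpow_reshape A (mu : law A) c q (F : seq (seq A) -> R) : nneg_law mu ->
  Ex (lpow mu (q * c)) (fun l => F (reshape (nseq q c) l)) =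
  Ex (lpow (lpow mu c) q) F.
Proof.
move=> mu0; elim: q F => [|q IH] F; first by rewrite mul0n !Ex_lpow0.
rewrite mulSn Ex_lpow_cat Ex_lpowS; apply: eq_Ex_lpow => // k ks.
by rewrite -(IH (fun l => F (k :: l))); apply: eq_Ex => l /=;
  rewrite take_size_cat// drop_size_cat.
Qed.

(** Exponential Markov inequality. Left tails are obtained by applying it to the
opposite of f. *)
Lemma chernoff A (mu : law A) n (f : A -> R) (lam c a : R) :
  nneg_law mu -> 0 < lam -> Ex mu (fun x => expR (lam * f x)) <= expR (lam * c) ->
  Ex (lpow mu n) (fun l => (a <= \sum_(x <- l) f x)%R%:R)
    <= expR (- (lam * (a - n%:R * c))).
Proof.
move=> mu0 lam0 muc.
have E l : (a <= \sum_(x <- l) f x)%R%:R <=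
    expR (- (lam * a)) * \prod_(x <- l) expR (lam * f x).
  have ->: \prod_(x <- l) expR (lam * f x) = expR (lam * \sum_(x <- l) f x).
    by rewrite big_distrr/= expR_sum.
  case: (leP a) => h; last by rewrite mulr_ge0 ?expR_ge0.
  by rewrite -expRD -expR0 ler_expR addrC subr_ge0 ler_pM2l.
apply: le_trans (Ex_le (nneg_lpow n mu0) E) _.
have -> : - (lam * (a - n%:R * c)) = - (lam * a) + n%:R * (lam * c) by ring.
rewrite ExZ Ex_lpow_prod expRD ler_wpM2l ?expR_ge0// expRM_natl.
by apply: lerXn2r muc; rewrite nnegrE ?expR_ge0// Ex_ge0// => x; rewrite expR_ge0.
Qed.

(** The range 1/3 is what the crude bound 1 / (1 - y/2)^2 on the exponential of
a nonnegative y tolerates. *)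
Lemma expR_quad (y : R) : `|y| <= 1 / 3 -> expR y <= 1 + y + y ^+ 2.
Proof.
rewrite ler_norml => /andP[yl yu].
have h (x : R) : x < 1 -> expR x <= (1 - x)^-1.
  move=> x1; rewrite -[leLHS]invrK lef_pV2 ?posrE ?invr_gt0 ?expR_gt0 ?subr_gt0//.
  by rewrite -expRN expR_ge1Dx.
have [y0|y0] := leP y 0.
  apply: (le_trans (h y _)); first lra.
  rewrite -[leLHS]mul1r ler_pdivrMr; last lra.
  by rewrite expr2; nra.
have -> : expR y = expR (y / 2) ^+ 2 by rewrite -expRM_natl; congr expR; lra.
apply: (@le_trans _ _ ((1 - y / 2)^-1 ^+ 2)).
  by apply: lerXn2r; rewrite ?nnegrE ?expR_ge0 ?invr_ge0 ?h//; lra.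
rewrite exprVn -[leLHS]mul1r ler_pdivrMr ?exprn_gt0//; last lra.
rewrite !expr2.
have : 0 <= y * y * (1 - 3 * y + y * y) by rewrite !mulr_ge0//; nra.
by move=> ?; nra.
Qed.

(** To first order in lam a bounded variable behaves like its mean, which is all
that the law of large numbers needs from Chernoff's method. *)
Lemma mgf_bounded A (mu : law A) (f : A -> R) (B m lam : R) :
  prob_law mu -> 0 < B -> (forall x, `|f x| <= B) -> Ex mu f <= m ->
  0 < lam -> lam * B <= 1 / 3 ->
  Ex mu (fun x => expR (lam * f x)) <= expR (lam * (m + lam * B ^+ 2)).
Proof.
move=> mup B0 fB fm lam0 lamB.
apply: le_trans (expR_ge1Dx _).
apply: (@le_trans _ _ (Ex mu (fun x => (1 + (lam * B) ^+ 2) + lam * f x))).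
  apply: Ex_le => [|x]; first by case: mup.
  have h : `|lam * f x| <= lam * B by rewrite normrM gtr0_norm// ler_pM2l.
  apply: le_trans (expR_quad (le_trans h lamB)) _.
  have : (lam * f x) ^+ 2 <= (lam * B) ^+ 2.
    by rewrite -real_normK ?num_real// lerXn2r// nnegrE// mulr_ge0// ltW.
  by move=> ?; lra.
rewrite ExD Ex_cst// ExZ.
have : lam * Ex mu f <= lam * m by rewrite ler_pM2l.
rewrite !expr2; nra.
Qed.

End FiniteLaws.

(** * Bernoulli and truncated geometric laws *)

Section BernoulliGeometric.
Context {R : realType}.

Definition ber (u : R) : law (R:=R) bool := [:: (1 - u, false); (u, true)].

(** The same law as [ber], on nat: the boundary increments are handled as
numbers, the site weights as booleans. *)
Definition bern (u : R) : law (R:=R) nat := [:: (1 - u, 0%N); (u, 1%N)].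

(** The law of min(G, L) for G geometric of ratio rho on {0, 1, 2, ...}; the
recursion conditions on the first failure. *)
Fixpoint geo (rho : R) L : law (R:=R) nat :=
  if L is L'.+1 then
    (1 - rho, 0%N) :: [seq (rho * x.1, x.2.+1) | x <- geo rho L']
  else [:: (1, 0%N)].

(** The restriction of the same geometric law to {0, ..., L-1}, left
unnormalized: the Burke property holds for it as an inequality between
measures, without any boundary term. *)
Fixpoint subgeo (rho : R) L : law (R:=R) nat :=
  if L is L'.+1 then
    (1 - rho, 0%N) :: [seq (rho * x.1, x.2.+1) | x <- subgeo rho L']
  else [::].

Lemma Ex_ber u f : Ex (ber u) f = (1 - u) * f false + u * f true.
Proof. by rewrite /Ex !big_cons big_nil addr0. Qed.

Lemma Ex_bern u f : Ex (bern u) f = (1 - u) * f 0%N + u * f 1%N.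
Proof. by rewrite /Ex !big_cons big_nil addr0. Qed.

Lemma prob_ber u : 0 <= u <= 1 -> prob_law (ber u).
Proof.
move=> /andP[u0 u1]; split; last by rewrite Ex_ber; lra.
by rewrite /nneg_law /= u0 subr_ge0 u1.
Qed.

Lemma prob_bern u : 0 <= u <= 1 -> prob_law (bern u).
Proof.
move=> /andP[u0 u1]; split; last by rewrite Ex_bern; lra.
by rewrite /nneg_law /= u0 subr_ge0 u1.
Qed.

Lemma Ex_geo0 rho f : Ex (geo rho 0) f = f 0%N.
Proof. by rewrite /Ex big_seq1 mul1r. Qed.

Lemma Ex_geoS rho L f :
  Ex (geo rho L.+1) f = (1 - rho) * f 0%N + rho * Ex (geo rho L) (f \o S).
Proof.
rewrite /Ex /= big_cons big_map big_distrr; congr (_ + _).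
by apply: eq_bigr => x _; rewrite /= mulrA.
Qed.

Lemma Ex_subgeo0 rho f : Ex (subgeo rho 0) f = 0.
Proof. by rewrite /Ex big_nil. Qed.

Lemma Ex_subgeoS rho L f :
  Ex (subgeo rho L.+1) f = (1 - rho) * f 0%N + rho * Ex (subgeo rho L) (f \o S).
Proof.
rewrite /Ex /= big_cons big_map big_distrr; congr (_ + _).
by apply: eq_bigr => x _; rewrite /= mulrA.
Qed.

Lemma Ex_geo_subgeo rho L f :
  Ex (geo rho L) f = Ex (subgeo rho L) f + rho ^+ L * f L.
Proof.
elim: L f => [|L IH] f; first by rewrite Ex_geo0 Ex_subgeo0 add0r mul1r.
by rewrite Ex_geoS Ex_subgeoS IH exprS /=; ring.
Qed.

Section rho.
Variables (rho : R) (rho01 : 0 <= rho < 1).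

Let rho_ge0 : 0 <= rho. Proof. by case/andP: rho01. Qed.
Let rhoC_ge0 : 0 <= 1 - rho. Proof. by case/andP: rho01; lra. Qed.

Lemma nneg_subgeo L : nneg_law (subgeo rho L).
Proof.
elim: L => // L IH; rewrite /nneg_law /= rhoC_ge0 all_map.
by apply: sub_all IH => x /= x0; exact: mulr_ge0.
Qed.

Lemma prob_geo L : prob_law (geo rho L).
Proof.
split.
  elim: L => [|L IH]; first by rewrite /nneg_law /= ler01.
  rewrite /nneg_law /= rhoC_ge0 all_map.
  by apply: sub_all IH => x /= x0; exact: mulr_ge0.
elim: L => [|L IH]; first by rewrite Ex_geo0.
by rewrite Ex_geoS /comp IH; lra.
Qed.

Lemma subgeo_mass L : Ex (subgeo rho L) (fun=> 1) <= 1.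
Proof.
have [_ geo1] := prob_geo L.
by rewrite -[leRHS]geo1 Ex_geo_subgeo lerDl mulr1 exprn_ge0.
Qed.

Lemma Ex_subgeo_le L f : (forall j, 0 <= f j) ->
  Ex (subgeo rho L) f <= Ex (subgeo rho L.+1) f.
Proof.
elim: L f => [|L IH] f f0.
  by rewrite Ex_subgeo0; apply: Ex_ge0 => //; exact: nneg_subgeo.
by rewrite Ex_subgeoS [leRHS]Ex_subgeoS lerD2l ler_wpM2l// IH// => j; exact: f0.
Qed.

(** The bound phi is the generating function of the untruncated geometric law,
the fixed point of the recursion that defines [geo]. *)
Lemma geo_mgf_le L lam (phi : R) : 0 <= lam -> 1 <= phi ->
  phi * (1 - expR lam * rho) = 1 - rho ->
  Ex (geo rho L) (fun j => expR (lam * j%:R)) <= phi.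
Proof.
move=> lam0 phi1 phiE; elim: L => [|L IH].
  by rewrite Ex_geo0 mulr0 expR0.
rewrite Ex_geoS mulr0 expR0 /comp.
under eq_Ex => j do rewrite -natr1 mulrDr mulr1 expRD.
rewrite ExZr.
have := ler_wpM2l (mulr_ge0 rho_ge0 (expR_ge0 lam)) IH.
by move=> h; lra.
Qed.

Let v := rho / (1 - rho).

Let rhoC_gt0 : 0 < 1 - rho. Proof. by case/andP: rho01; lra. Qed.
Let vE : v * (1 - rho) = rho. Proof. by rewrite divfK// gt_eqF. Qed.
Let v_ge0 : 0 <= v. Proof. exact: divr_ge0. Qed.

(** Uniform in the truncation level L, so that L may tend to infinity later. *)
Lemma geo_mgf_upper (eps : R) : 0 < eps -> exists2 lam0, 0 < lam0 &
  forall lam L, 0 < lam <= lam0 ->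
    Ex (geo rho L) (fun j => expR (lam * j%:R)) <= expR (lam * (v + eps)).
Proof.
move=> eps0; have r0 := rho_ge0; have rC := rhoC_gt0; have v0 := v_ge0.
pose K := rho + 2 * rho * (v + eps) + 1.
have rv0 : 0 <= rho * (v + eps) by rewrite mulr_ge0// addr_ge0// ltW.
have K0 : 0 < K by rewrite /K; move: rv0 rho_ge0; lra.
exists (Num.min (1 / 3) (Num.min (eps * (1 - rho) / K) ((1 - rho) / 3))).
  by rewrite !lt_min !divr_gt0 ?mulr_gt0//; lra.
move=> lam L /andP[lam0]; rewrite !le_min => /and3P[l3 lK lr].
have {}lK : lam * K <= eps * (1 - rho) by rewrite -ler_pdivlMr.
have e1 := expR_ge1Dx lam.
have e2 : expR lam <= 1 + lam + lam ^+ 2 by apply: expR_quad; rewrite gtr0_norm.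
have {}e2 : expR lam <= 1 + 2 * lam by rewrite expr2 in e2; nra.
have e3 : expR lam <= 1 + lam + lam * lam.
  by rewrite -expr2; apply: expR_quad; rewrite gtr0_norm.
have D0 : 0 < 1 - expR lam * rho.
  case/andP: rho01 => _ r1.
  have : expR lam * rho <= (1 + 2 * lam) * rho by rewrite ler_wpM2r.
  have : lam * rho <= lam by nra.
  by nra.
pose phi := (1 - rho) / (1 - expR lam * rho).
have phiE : phi * (1 - expR lam * rho) = 1 - rho by rewrite /phi divfK// gt_eqF.
have phi1 : 1 <= phi by rewrite /phi ler_pdivlMr// mul1r lerD2l lerN2 ler_peMl//; lra.
apply: le_trans (geo_mgf_le L (ltW lam0) phi1 phiE) _.
apply: le_trans (expR_ge1Dx _).
rewrite /phi ler_pdivrMr//.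
set c := v + eps.
have vc : c * (1 - rho) = rho + eps * (1 - rho) by rewrite /c mulrDl vE.
have c0 : 0 <= c by rewrite addr_ge0// ltW.
set D := 1 - expR lam * rho.
have DE : D >= 1 - rho - 2 * lam * rho.
  by rewrite /D; have := ler_wpM2r r0 e2; lra.
have DE2 : expR lam * rho <= (1 + lam + lam * lam) * rho by rewrite ler_wpM2r.
have h1 : lam * (c * D) >= lam * (c * (1 - rho - 2 * lam * rho)).
  by rewrite ler_pM2l// ler_wpM2l.
have h2 : lam * (lam * K) <= lam * (eps * (1 - rho)) by rewrite ler_pM2l.
rewrite /K -/c in h2.
have h3 : lam * (c * (1 - rho)) = lam * rho + lam * (eps * (1 - rho)).
  by rewrite vc mulrDr.
have h4 : 0 <= lam * lam by rewrite mulr_ge0// ltW.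
rewrite mulrDl mul1r -mulrA.
by move: h1 h2 h3 h4 DE2; rewrite /D; lra.
Qed.

Lemma geo_min_mean B L : (B <= L)%N ->
  Ex (geo rho L) (fun j => (minn j B)%:R) = v * (1 - rho ^+ B).
Proof.
elim: B L => [|B IH] [|L] // BL.
- by rewrite Ex_geo0 minnn expr0 subrr mulr0.
- under eq_Ex => j do rewrite minn0.
  by rewrite Ex_cst ?expr0 ?subrr ?mulr0//; exact: prob_geo.
rewrite Ex_geoS min0n mulr0 add0r /comp.
under eq_Ex => j do rewrite minnSS -natr1.
rewrite ExD IH// Ex_cst; last exact: prob_geo.
have h : v = rho * v + rho by move: vE; move: (v) => w; lra.
by rewrite exprS; move: h (rho ^+ B); move: (v) => w h x; lra.
Qed.

(** The variable is replaced by its minimum with a constant B, which is bounded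
and whose mean is close to v = rho / (1 - rho), uniformly in L >= B. *)
Lemma geo_mgf_lower (eps : R) : 0 < eps -> exists2 lam0, 0 < lam0 &
  exists B, forall lam L, 0 < lam <= lam0 -> (B <= L)%N ->
    Ex (geo rho L) (fun j => expR (lam * - j%:R)) <= expR (lam * - (v - eps)).
Proof.
move=> eps0.
have [B0 B0P] : exists B, v * rho ^+ B <= eps / 2.
  have : (fun n => v * rho ^+ n) @ \oo --> v * 0.
    apply: cvgMr; apply: cvg_expr.
    by case/andP: rho01 => *; rewrite ger0_norm.
  rewrite mulr0 => /cvgrPdist_le/(_ (eps / 2)); case; first lra.
  move=> N _ /(_ N (leqnn N)); rewrite /= sub0r normrN ger0_norm; first by exists N.
  by rewrite mulr_ge0// exprn_ge0.
pose B := B0.+1.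
have BP : v * rho ^+ B <= eps / 2.
  apply: le_trans B0P; rewrite ler_wpM2l// /B exprS.
  by rewrite ler_piMl ?exprn_ge0// ltW//; case/andP: rho01.
exists (Num.min (1 / 3 / B%:R) (eps / 2 / B%:R ^+ 2)).
  by rewrite lt_min !divr_gt0// ?exprn_gt0//; lra.
exists B => lam L /andP[lam0]; rewrite le_min => /andP[l1 l2] BL.
have B0' : 0 < B%:R :> R by [].
rewrite ler_pdivlMr// in l1.
rewrite ler_pdivlMr ?exprn_gt0// in l2.
apply: (@le_trans _ _ (Ex (geo rho L) (fun j => expR (lam * - (minn j B)%:R)))).
  apply: Ex_le => [|j]; first by case: (prob_geo L).
  by rewrite ler_expR ler_pM2l// lerN2 ler_nat geq_minl.
have := @mgf_bounded R nat (geo rho L) (fun j => - (minn j B)%:R) B%:R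
  (- (v - eps / 2)) lam (prob_geo L) B0'.
move=> /(_ _ _ lam0 l1) h; apply: le_trans (h _ _) _.
- by move=> j; rewrite normrN ger0_norm// ler_nat geq_minr.
- under eq_Ex => j do rewrite -mulN1r.
  by rewrite ExZ geo_min_mean//; lra.
- by rewrite ler_expR ler_pM2l//; lra.
Qed.

End rho.

Lemma bern_mgf (u eps : R) : 0 <= u <= 1 -> 0 < eps -> exists2 lam0, 0 < lam0 &
  forall lam, 0 < lam <= lam0 ->
    Ex (bern u) (fun j => expR (lam * j%:R)) <= expR (lam * (u + eps)) /\
    Ex (bern u) (fun j => expR (lam * - j%:R)) <= expR (lam * - (u - eps)).
Proof.
move=> u01 eps0; have up := prob_bern u01.
exists (Num.min (1 / 3) eps); first by rewrite lt_min eps0 andbT; lra.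
move=> lam /andP[lam0]; rewrite le_min => /andP[l1 l2].
have E (f : nat -> R) : Ex (bern u) (fun j => expR (lam * f j)) =
  Ex (bern u) (fun j => expR (lam * f (minn j 1))) by rewrite !Ex_bern.
split.
- rewrite (E (fun j => j%:R)).
  have := @mgf_bounded R nat (bern u) (fun j => (minn j 1)%:R) 1 u lam up ltr01.
  rewrite mulr1 => /(_ _ _ lam0 l1) h; apply: le_trans (h _ _) _.
  + by move=> j; rewrite ger0_norm// -[leRHS]/(1%:R) ler_nat geq_minr.
  + by rewrite Ex_bern min0n minnn; lra.
  + by rewrite ler_expR ler_pM2l// expr1n mulr1; lra.
- rewrite (E (fun j => - j%:R)).
  have := @mgf_bounded R nat (bern u) (fun j => - (minn j 1)%:R) 1 (- u) lam up ltr01.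
  rewrite mulr1 => /(_ _ _ lam0 l1) h; apply: le_trans (h _ _) _.
  + by move=> j; rewrite normrN ger0_norm// -[leRHS]/(1%:R) ler_nat geq_minr.
  + by rewrite Ex_bern min0n minnn; lra.
  + by rewrite ler_expR ler_pM2l// expr1n mulr1; lra.
Qed.

Definition dominated (mu nu : law (R:=R) nat) := forall f : nat -> R,
  (forall i j, (i <= j)%N -> f i <= f j) -> Ex mu f <= Ex nu f.

Lemma dominated_bern u u' : u <= u' -> dominated (bern u) (bern u').
Proof. by move=> uu' f /(_ 0 1 isT)%N f01; rewrite !Ex_bern; nra. Qed.

(** By induction on L: raising rho moves mass from the value f 0 to the larger
conditional expectation of the shifted function. *)
Lemma dominated_geo rho rho' L : 0 <= rho -> rho <= rho' -> rho' < 1 ->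
  dominated (geo rho L) (geo rho' L).
Proof.
move=> r0 rr' r1; elim: L => [|L IH] f fm; first by rewrite !Ex_geo0.
have fSm i j : (i <= j)%N -> (f \o S) i <= (f \o S) j by move=> ij; exact: fm.
have {IH} h := IH _ fSm.
have h0 : f 0%N <= Ex (geo rho L) (f \o S).
  have gp : prob_law (geo rho L) by apply: prob_geo; rewrite r0; lra.
  rewrite -[leLHS](Ex_cst _ gp); apply: Ex_le => [|j]; first by case: gp.
  exact: fm.
rewrite !Ex_geoS; nra.
Qed.

Lemma dominated_lpow (mu nu : law (R:=R) nat) n (F : seq nat -> R) :
  nneg_law mu -> nneg_law nu -> dominated mu nu ->
  (forall l l', all2 leq l l' -> F l <= F l') ->
  Ex (lpow mu n) F <= Ex (lpow nu n) F.
Proof.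
move=> mu0 nu0 mn; elim: n F => [|n IH] F FP; first by rewrite !Ex_lpow0.
rewrite !Ex_lpowS.
apply: (@le_trans _ _ (Ex mu (fun a => Ex (lpow nu n) (fun l => F (a :: l))))).
  by apply: Ex_le => // a; apply: IH => l l' ll'; apply: FP; rewrite /= leqnn.
apply: mn => i j ij; apply: Ex_le => [|l]; first exact: nneg_lpow.
apply: FP; rewrite /= ij /=.
by elim: l => //= x l ->; rewrite leqnn.
Qed.

End BernoulliGeometric.

(** * Last passage times with boundary values *)

Section LastPassage.

(** Column i and row j are reached by a horizontal step into the site (i, j-1),
so row 0 is the axis below the first row of sites; a and b are the values
imposed on the two axes, b being read at positive heights only. *)
Fixpoint lpp (a b : nat -> nat) (om : site -> bool) (i j : nat) {struct j} : nat :=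
  if j is j'.+1 then
    (fix row i := if i is i'.+1
      then maxn (row i' + om (i'.+1, j'))%N (lpp a b om i'.+1 j')
      else b j'.+1) i
  else a i.

(** No boundary: the passage time of m columns and n rows of sites. *)
Definition pure := lpp (fun=> 0%N) (fun=> 0%N).

Definition shift (m n : nat) (om : site -> bool) : site -> bool :=
  fun v => om ((m + v.1)%N, (n + v.2)%N).

Lemma shiftE m n om i j : shift m n om (i, j) = om ((m + i)%N, (n + j)%N).
Proof. by []. Qed.

Lemma lppi0 a b om i : lpp a b om i 0 = a i. Proof. by []. Qed.

Lemma lpp0S a b om j : lpp a b om 0 j.+1 = b j.+1. Proof. by []. Qed.

Lemma lppSS a b om i j :
  lpp a b om i.+1 j.+1 = maxn (lpp a b om i j.+1 + om (i.+1, j)) (lpp a b om i.+1 j).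
Proof. by []. Qed.

Lemma lpp_ind (Q : nat -> nat -> Prop) :
  (forall i, Q i 0%N) -> (forall j, Q 0%N j.+1) ->
  (forall i j, Q i j.+1 -> Q i.+1 j -> Q i.+1 j.+1) ->
  forall i j, Q i j.
Proof.
move=> Qi Qj QS i j; elim: j i => [//|j IHj]; elim=> [//|i IHi].
exact: QS.
Qed.

Lemma lpp_mono a a' b b' om i j : (forall x, a x <= a' x)%N ->
  (forall y, b y <= b' y)%N -> (lpp a b om i j <= lpp a' b' om i j)%N.
Proof.
move=> aa' bb'; move: i j; apply: lpp_ind => [//|j|i j h1 h2].
  by rewrite !lpp0S.
by rewrite !lppSS; lia.
Qed.

Lemma eq_lpp a a' b b' om om' m n :
  (forall x, (x <= m)%N -> a x = a' x) -> (forall y, (y <= n)%N -> b y = b' y) ->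
  (forall i j, (i < m)%N -> (j < n)%N -> om (i.+1, j) = om' (i.+1, j)) ->
  lpp a b om m n = lpp a' b' om' m n.
Proof.
move=> aa' bb' oo'.
suff : forall i j, (i <= m)%N -> (j <= n)%N -> lpp a b om i j = lpp a' b' om' i j by exact.
apply: lpp_ind => [i im _|j _ jn|i j h1 h2 im jn]; rewrite ?lppi0 ?lpp0S ?aa' ?bb'//.
by rewrite !lppSS h1 ?h2 ?oo'//; exact: ltnW.
Qed.

Lemma pureS om i j :
  pure om i.+1 j.+1 = maxn (pure om i j.+1 + om (i.+1, j)) (pure om i.+1 j).
Proof. by []. Qed.

Lemma pure0 om j : pure om 0 j = 0%N. Proof. by case: j. Qed.

Lemma pure_le_lpp a b om i j : (pure om i j <= lpp a b om i j)%N.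
Proof. exact: lpp_mono. Qed.

Lemma pure_leSl om i j : (pure om i j <= pure om i.+1 j)%N.
Proof. by case: j => // j; rewrite pureS; lia. Qed.

Lemma pure_leSr om i j : (pure om i j <= pure om i j.+1)%N.
Proof. by case: i => [|i]; [rewrite !pure0|rewrite pureS; lia]. Qed.

Lemma pure_mono om i i' j j' : (i <= i')%N -> (j <= j')%N ->
  (pure om i j <= pure om i' j')%N.
Proof.
move=> /subnK <- /subnK <-; apply: (@leq_trans (pure om (i' - i + i) j)).
  by elim: (i' - i)%N => // k h; rewrite addSn (leq_trans h)// pure_leSl.
by elim: (j' - j)%N => // k h; rewrite addSn (leq_trans h)// pure_leSr.
Qed.

Lemma pure_le om i j : (pure om i j <= i)%N.
Proof.
move: i j; apply: lpp_ind => // i j h1 h2; rewrite pureS geq_max h2 andbT.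
by case: (om _); rewrite ?addn0 ?addn1 ?ltnS// ltnW.
Qed.

(** The two rectangles share the row n: the second one starts at the height where
the first one ends, and only their columns are disjoint. *)
Lemma pure_superadd om m n i j :
  (pure om m n.+1 + pure (shift m n om) i j.+1 <= pure om (m + i) (n + j.+1))%N.
Proof.
elim: j i => [|j IHj]; elim=> [|i IHi].
- by rewrite pure0 !addn0 addn1.
- rewrite addn1 in IHi *; rewrite addnS [in X in (_ + X)%N]pureS [leqRHS]pureS.
  have := @pure_mono om m (m + i).+1 n.+1 n.+1.
  have -> : pure (shift m n om) i.+1 0 = 0%N by [].
  have h := leq_addr i m; have : (m <= (m + i).+1)%N by lia.
  rewrite shiftE addn0 addnS.
  have := @pure_mono om m (m + i) n.+1 n.+1 h (leqnn _); lia.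
- by rewrite pure0 !addn0 pure_mono//; lia.
- rewrite !addnS in IHi IHj *; rewrite [in X in (_ + X)%N]pureS [leqRHS]pureS.
  have := IHj i.+1; rewrite addnS.
  rewrite shiftE !addnS.
  lia.
Qed.

(** Here the two rectangles of sites are disjoint in rows as well. *)
Lemma pure_superadd_cells om m n i j :
  (pure om m n + pure (shift m n om) i j <= pure om (m + i) (n + j))%N.
Proof.
case: j => [|j]; first by rewrite !addn0 pure_mono// leq_addr.
apply: leq_trans (pure_superadd _ _ _ _ _); rewrite leq_add2r; exact: pure_leSr.
Qed.

(** Sorts the maximal paths by the place where they leave the axes: before k on
the horizontal axis and before l on the vertical one, or later, in which case
the path first collects a k (resp. b l) and continues in the shifted quadrant.
No path is mentioned: the three alternatives are stable under the recursion.
The strict inequality l < j is needed because leaving the vertical axis at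
height l uses the weights of the row below. *)
Lemma lpp_exit a b om k l i j :
  {homo a : x y / (x <= y)%N} -> {homo b : x y / (x <= y)%N} ->
  [\/ (lpp a b om i j <= a k + b l + pure om i j)%N,
      (k <= i)%N /\ (lpp a b om i j <=
        a k + lpp (fun x => a (k + x) - a k)%N (fun=> 0%N) (shift k 0 om) (i - k) j)%N |
      (l < j)%N /\ (lpp a b om i j <=
        b l + lpp (fun=> 0%N) (fun y => b (l + y) - b l)%N (shift 0 l om) i (j - l))%N].
Proof.
move=> am bm.
have {}am x y : (x <= y)%N -> (a x <= a y)%N by exact: am.
have {}bm x y : (x <= y)%N -> (b x <= b y)%N by exact: bm.
move: i j; apply: lpp_ind => [i|j|i j].
- rewrite lppi0; have [ik|ki] := leqP i k.
    by apply: Or31; have := am _ _ ik; lia.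
  apply: Or32; split; first exact: ltnW.
  have E : (k + (i - k) = i)%N by lia.
  by rewrite lppi0 E; have := am _ _ (ltnW ki); lia.
- rewrite lpp0S; have [ik|ki] := leqP j.+1 l.
    by apply: Or31; have := bm _ _ ik; lia.
  apply: Or33; split=> //.
  have E : (l + (j - l).+1 = j.+1)%N by lia.
  by rewrite subSn// lpp0S E; have := bm _ _ (ltnW ki); lia.
- rewrite lppSS.
  set X := lpp a b om i j.+1; set Y := lpp a b om i.+1 j.
  move=> hX hY; have [XY|/ltnW XY] := leqP (X + om (i.+1, j)) Y.
  + case: hY => [h|[ki h]|[lj h]].
    * by apply: Or31; apply: leq_trans h _; rewrite leq_add2l pure_leSr.
    * apply: Or32; split=> //; apply: leq_trans h _; rewrite leq_add2l.
      case: (i.+1 - k)%N => [|x]; last by rewrite lppSS leq_maxr.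
      by case: (j) => [|?]; rewrite ?lppi0 lpp0S ?addn0 ?subnn.
    * apply: Or33; split; first exact: ltnW.
      by apply: leq_trans h _; rewrite leq_add2l subSn ?(ltnW lj)// lppSS leq_maxr.
  + case: hX => [h|[ki h]|[lj h]].
    * apply: Or31; rewrite pureS; lia.
    * apply: Or32; split; first exact: leqW.
      rewrite subSn// lppSS shiftE.
      rewrite add0n addnS subnKC//; lia.
    * apply: Or33; split=> //; rewrite ltnS in lj.
      rewrite subSn// lppSS shiftE.
      rewrite subSn// in h.
      rewrite add0n subnKC//; lia.
Qed.

(** One more row in [pure], since a path to height n visits the rows 0, ..., n. *)
Lemma last_passageE om m n : last_passage om (0%N, 0%N) (m, n) = pure om m n.+1.
Proof.
pose e (a b : site) := (b == right_of a) || (b == above a).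
have wrcons v pi b : path_weight om v (rcons pi b) =
    (path_weight om v pi + (if b == right_of (last v pi) then om b else false))%N.
  rewrite /path_weight -cats1 pairmap_cat sumn_cat /= addn0.
  by case: ifP.
have arcons v pi b : admissible v (last v pi) pi -> e (last v pi) b ->
    admissible v b (rcons pi b).
  by move=> [h _] h'; split; rewrite ?last_rcons// rcons_path h.
have le1 pi w : admissible (0%N, 0%N) w pi ->
    (path_weight om (0%N, 0%N) pi <= pure om w.1 w.2.+1)%N.
  elim/last_ind: pi w => [|pi b IH] w.
    by move=> [_ <-]; rewrite /path_weight.
  move=> [+ wE]; rewrite last_rcons in wE; rewrite -wE rcons_path => /andP[pp eb].
  have /IH := conj pp (erefl (last (0%N, 0%N) pi)).
  rewrite wrcons; move: eb; set u := last _ _ => /orP[/eqP->|/eqP->].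
    by rewrite eqxx /right_of /= pureS; lia.
  case: eqP => [[]|_]; first by lia.
  by rewrite /above /= addn0 => h; apply: leq_trans h (pure_leSr _ _ _).
have ex k l : exists2 pi, admissible (0%N, 0%N) (k, l) pi &
    path_weight om (0%N, 0%N) pi = pure om k l.+1.
  elim: l k => [|l IHl]; elim=> [|k IHk].
  - by exists [::].
  - have [pi [pp pl] pw] := IHk.
    exists (rcons pi (k.+1, 0%N)); first by apply: arcons; rewrite ?pl// /e eqxx.
    by rewrite wrcons pl eqxx pw pureS /pure lppi0 maxn0.
  - have [pi [pp pl] pw] := IHl 0%N.
    exists (rcons pi (0%N, l.+1)); first by apply: arcons; rewrite ?pl// /e eqxx orbT.
    by rewrite wrcons pl pw !pure0.
  - have [lt|le] := leqP (pure om k l.+2 + om (k.+1, l.+1))%N (pure om k.+1 l.+1).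
      have [pi [pp pl] pw] := IHl k.+1.
      exists (rcons pi (k.+1, l.+1)); first by apply: arcons; rewrite ?pl// /e eqxx orbT.
      rewrite wrcons pl pw [RHS]pureS (maxn_idPr lt) /right_of /=.
      by case: eqP => [[]|_]; [lia|rewrite addn0].
    have [pi [pp pl] pw] := IHk.
    exists (rcons pi (k.+1, l.+1)); first by apply: arcons; rewrite ?pl// /e eqxx.
    by rewrite wrcons pl eqxx pw [RHS]pureS (maxn_idPl (ltnW le)).
apply/eqP; rewrite eqn_leq; apply/andP; split.
  have [pi /le1/= + <-] : exists2 pi, admissible (0%N, 0%N) (m, n) pi &
    path_weight om (0%N, 0%N) pi = last_passage om (0%N, 0%N) (m, n).
    by apply: last_passage_attained; have [pi ?] := ex m n; exists pi.
  by [].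
by have [pi piP <-] := ex m n; apply: path_weight_le_last_passage.
Qed.

End LastPassage.

(** * The stationary model and its Burke property *)

(** One row of the recursion in terms of increments. From the increments I of a
row, the vertical increment J at its left end and the weights w, it computes
the increments of the next row; J is updated along the row. *)
Fixpoint rowstep (J : nat) (I : seq nat) (w : seq bool) : seq nat :=
  match I, w with
  | i :: I', x :: w' => maxn x (i - J) :: rowstep (J + x - i) I' w'
  | _, _ => [::]
  end.

Fixpoint frow (I Js : seq nat) (Ws : seq (seq bool)) : seq nat :=
  match Js, Ws with
  | J :: Js', W :: Ws' => frow (rowstep J I W) Js' Ws'
  | _, _ => I
  end.

Definition psum (l : seq nat) (i : nat) := sumn (take i l).

(** Row j of Ws holds the weights of the sites (1, j), (2, j), ...; the default
values of nth are never read inside the rectangle. *)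
Definition cfg (Ws : seq (seq bool)) : site -> bool :=
  fun v => nth false (nth [::] Ws v.2) v.1.-1.

Definition stat_lpp (I Js : seq nat) (Ws : seq (seq bool)) : nat :=
  lpp (psum I) (psum Js) (cfg Ws) (size I) (size Js).

Lemma size_rowstep J I W : size W = size I -> size (rowstep J I W) = size I.
Proof. by elim: I W J => [|i I IH] [|w W] J //= [] /IH ->. Qed.

(** A row of heights is determined by its leftmost value and by the increments
that [rowstep] produces; the conservation law is i + J' = J + i'. *)
Lemma rowstep_psum (r : nat -> nat) c J I W : size W = size I -> r 0%N = (c + J)%N ->
  (forall i, (i < size I)%N ->
     r i.+1 = maxn (r i + nth false W i) (c + psum I i.+1)) ->
  forall i, (i <= size I)%N -> r i = (c + J + psum (rowstep J I W) i)%N.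
Proof.
elim: I W J c r => [|x I IH] [|w W] J c r //=.
  by move=> _ r0 _ i; rewrite leqn0 => /eqP ->; rewrite r0 /psum /= addn0.
move=> [] sW r0 rS [_|i iI]; first by rewrite r0 /psum /= addn0.
have r1 : r 1%N = (c + x + (J + w - x))%N.
  by rewrite rS// r0 /psum /= take0 /=; lia.
rewrite (IH W (J + w - x)%N (c + x)%N (fun i => r i.+1))//.
  by rewrite /psum /=; lia.
by move=> k kI; rewrite rS// /psum /= addnA.
Qed.

Lemma lpp_peel a b om a' b' c m i j :
  (forall i, (i <= m)%N -> lpp a b om i 1 = (c + a' i)%N) ->
  (forall y, (0 < y)%N -> b y.+1 = (c + b' y)%N) -> (i <= m)%N ->
  lpp a b om i j.+1 = (c + lpp a' b' (shift 0 1 om) i j)%N.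
Proof.
move=> h1 hb; move: i j; apply: lpp_ind => [i im|j _|i j IH1 IH2 im].
- by rewrite h1.
- by rewrite !lpp0S hb.
- by rewrite lppSS IH1 ?(ltnW im)// IH2// lppSS shiftE add0n add1n; lia.
Qed.

(** Following the left side and then the last row computes the same height. *)
Lemma stat_frow I Js Ws : size Ws = size Js ->
  all (fun W => size W == size I) Ws ->
  stat_lpp I Js Ws = (sumn Js + sumn (frow I Js Ws))%N.
Proof.
rewrite /stat_lpp; elim: Js Ws I => [|J Js IH] [|W Ws] I // sWs.
  by move=> _; rewrite /= /psum take_size.
rewrite [all _ _]/= => /andP[/eqP sW aWs]; move: sWs => [] sWs.
rewrite [size (J :: Js)]/= [frow _ _ _]/= [sumn (J :: Js)]/=.
have sr := size_rowstep J sW.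
rewrite (@lpp_peel _ _ _ (psum (rowstep J I W)) (psum Js) J (size I))//.
- have -> : lpp (psum (rowstep J I W)) (psum Js) (shift 0 1 (cfg (W :: Ws)))
      (size I) (size Js) =
      lpp (psum (rowstep J I W)) (psum Js) (cfg Ws) (size (rowstep J I W)) (size Js).
    by rewrite sr; apply: eq_lpp.
  by rewrite (IH Ws (rowstep J I W)) ?sr//; lia.
- move=> i iI.
  have h := @rowstep_psum (fun i => lpp (psum I) (psum (J :: Js)) (cfg (W :: Ws)) i 1)
    0 J I W sW _ _ i iI.
  by rewrite h// ?lpp0S// /psum /= take0 /= addn0.
Qed.

Lemma ind_le2 (R : realType) (a b c : bool) :
  (a -> b || c) -> a%:R <= b%:R + c%:R :> R.
Proof.
case: a => [/(_ isT)|_]; last by rewrite addr_ge0.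
by case: b => [_|/= ->]; rewrite ?lerDl ?lerDr.
Qed.

Lemma ind_bounds (R : realType) (b : bool) : 0 <= (b%:R : R) <= 1.
Proof. by case: b; rewrite ?lexx ler01. Qed.

Section Burke.
Context {R : realType}.
Variables (p u : R) (p01 : 0 < p < 1) (pu : p < u) (u1 : u < 1).

(** The ratio that balances the reflected random walk J -> max(J + w - i, 0)
with steps w ~ Bernoulli(p) and i ~ Bernoulli(u). *)
Definition rho_of (p u : R) := p * (1 - u) / ((1 - p) * u).
Let rho := rho_of p u.

Lemma rho_in : 0 < rho < 1.
Proof.
have u1' := u1; have pu' := pu.
case/andP: p01 => p0 p1; have u0 : 0 < u by lra.
have D0 : 0 < (1 - p) * u by rewrite mulr_gt0//; lra.
rewrite /rho /rho_of divr_gt0//; last by rewrite mulr_gt0//; lra.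
rewrite /=.
by rewrite ltr_pdivrMr// mul1r; lra.
Qed.

Lemma rho_balance : u * (1 - p) * rho = (1 - u) * p.
Proof.
have u1' := u1; have pu' := pu.
case/andP: p01 => p0 p1; rewrite /rho /rho_of; field.
by apply/andP; split; rewrite gt_eqF//; lra.
Qed.

Let rho01 : 0 <= rho < 1. Proof. by have /andP[/ltW -> ->] := rho_in. Qed.

(** For the full geometric law the images of i and J are again independent with
the same laws: by [rho_balance], the mass coming from (i, w) = (0, 1) and
(1, 0) compensates exactly. Truncation only loses mass, and J can grow by one
unit, so the image is at most the product law with the level L raised by one. *)
Lemma burke_site L (f : nat -> nat -> R) : (forall i j, 0 <= f i j) ->
  Ex (bern u) (fun i => Ex (subgeo rho L) (fun j => Ex (ber p) (fun w : bool =>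
     f (maxn w (i - j)) (j + w - i)%N)))
  <= Ex (bern u) (fun i => Ex (subgeo rho L.+1) (fun j => f i j)).
Proof.
move=> f0; have bal := rho_balance; have u1' := u1; have pu' := pu.
have [p0 p1] := andP p01; have [r0 r1] := andP rho_in.
rewrite !Ex_bern.
have -> : Ex (subgeo rho L) (fun j => Ex (ber p) (fun w : bool =>
    f (maxn w (0 - j)) (j + w - 0)%N)) =
    (1 - p) * Ex (subgeo rho L) (f 0%N) + p * Ex (subgeo rho L) (f 1%N \o S).
  rewrite -!ExZ -ExD; apply: eq_Ex => j.
  by rewrite Ex_ber sub0n !maxn0 !subn0 addn0 addn1.
have -> : Ex (subgeo rho L) (fun j => Ex (ber p) (fun w : bool =>
    f (maxn w (1 - j)) (j + w - 1)%N)) =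
    (1 - p) * Ex (subgeo rho L) (fun j => f (1 - j)%N j.-1) +
     p * Ex (subgeo rho L) (f 1%N).
  rewrite -!ExZ -ExD; apply: eq_Ex => j.
  rewrite Ex_ber max0n addn0 addnK subn1; congr (_ + _ * f _ _).
  by case: j => // j; rewrite subSS sub0n.
have m0 L' : Ex (subgeo rho L') (f 0%N) <= Ex (subgeo rho L'.+1) (f 0%N).
  by apply: Ex_subgeo_le => // j; exact: f0.
have m1 : Ex (subgeo rho L) (f 1%N) <= Ex (subgeo rho L.+1) (f 1%N).
  by apply: Ex_subgeo_le => // j; exact: f0.
have e1 := Ex_subgeoS rho L (f 1%N).
move: bal m0 m1 e1.
set A := fun L => Ex (subgeo rho L) (f 0%N).
set B := Ex (subgeo rho L) (f 1%N). set B' := Ex (subgeo rho L.+1) (f 1%N).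
set C := Ex (subgeo rho L) (f 1%N \o S) => bal m0 m1 e1.
rewrite -/(A L) -/(A L.+1).
suff [A' A'le hA'] : exists2 A', A' <= A L &
    Ex (subgeo rho L) (fun j => f (1 - j)%N j.-1) <= (1 - rho) * f 1%N 0%N + rho * A'.
  have h1 : u * (1 - p) * Ex (subgeo rho L) (fun j => f (1 - j)%N j.-1) <=
    u * (1 - p) * ((1 - rho) * f 1%N 0%N + rho * A').
    by rewrite ler_wpM2l// mulr_ge0//; lra.
  have h2 : (1 - u) * p * A' <= (1 - u) * p * A L.+1.
    by rewrite ler_wpM2l ?mulr_ge0//; [lra|lra|exact: le_trans (m0 L)].
  have h3 : (1 - u) * (1 - p) * A L <= (1 - u) * (1 - p) * A L.+1.
    by rewrite ler_wpM2l ?mulr_ge0//; [lra|lra|exact: (m0 L)].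
  have h4 : u * p * B <= u * p * B' by rewrite ler_wpM2l ?mulr_ge0//; lra.
  have h5 : u * (1 - p) * (rho * A') = (1 - u) * p * A' by rewrite mulrA bal.
  have h6 : u * (1 - p) * (rho * C) = (1 - u) * p * C by rewrite mulrA bal.
  have h7 : u * (1 - p) * B' = u * (1 - p) * ((1 - rho) * f 1%N 0%N + rho * C).
    by rewrite e1.
  move: h1 h2 h3 h4 h5 h6 h7; rewrite !(mulrDl, mulrDr, mulrBl, mulrBr) !mulrA.
  by move: r0 r1; lra.
case: L @A {B B' C e1 m1 m0 bal} => [|L] A.
  exists (A 0%N) => //; rewrite /A !Ex_subgeo0 mulr0 addr0 mulr_ge0//.
  by rewrite subr_ge0 ltW.
exists (A L); first by apply: Ex_subgeo_le => // j; exact: f0.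
by rewrite Ex_subgeoS /A.
Qed.

Let bern_p : prob_law (bern u).
Proof. by apply: prob_bern; have [p0 p1] := andP p01; apply/andP; split; apply: ltW => //; exact: lt_trans pu. Qed.

Let ber_p : prob_law (ber p).
Proof. by apply: prob_ber; have [p0 p1] := andP p01; rewrite !ltW. Qed.

(** Each column raises the truncation level; at the end of the row the remaining
geometric mass is at most 1. *)
Lemma burke_row m L (F : seq nat -> R) : (forall l, 0 <= F l) ->
  Ex (lpow (bern u) m) (fun I => Ex (subgeo rho L) (fun J =>
    Ex (lpow (ber p) m) (fun W => F (rowstep J I W))))
  <= Ex (lpow (bern u) m) F.
Proof.
elim: m L F => [|m IH] L F F0.
  rewrite !Ex_lpow0; under eq_Ex => J do rewrite Ex_lpow0 /= -[F _]mul1r.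
  by rewrite ExZr ler_piMl// subgeo_mass.
rewrite !Ex_lpowS.
pose f i j := Ex (lpow (bern u) m) (fun I => Ex (lpow (ber p) m) (fun W =>
  F (i :: rowstep j I W))).
have f0 i j : 0 <= f i j.
  by do 2 (apply: Ex_ge0 => [|?]; first by apply: nneg_lpow; case: bern_p ber_p => ? ? []).
apply: (@le_trans _ _ (Ex (bern u) (fun i => Ex (subgeo rho L) (fun j => Ex (ber p) (fun w : bool =>
     f (maxn w (i - j)) (j + w - i)%N))))).
  rewrite le_eqVlt; apply/orP; left; apply/eqP; apply: eq_Ex => i.
  rewrite Ex_swap; apply: eq_Ex => J.
  under eq_Ex => I do rewrite Ex_lpowS.
  by rewrite Ex_swap.
apply: le_trans (burke_site L f0) _.
apply: Ex_le => [|i]; first by case: bern_p.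
by rewrite Ex_swap; apply: IH => l; exact: F0.
Qed.

Lemma burke_row_geo m L (F : seq nat -> R) : (forall l, 0 <= F l <= 1) ->
  Ex (lpow (bern u) m) (fun I => Ex (geo rho L) (fun J =>
    Ex (lpow (ber p) m) (fun W => F (rowstep J I W))))
  <= Ex (lpow (bern u) m) F + rho ^+ L.
Proof.
move=> F01; under eq_Ex => I do rewrite Ex_geo_subgeo.
rewrite ExD; apply: lerD; first by apply: burke_row => l; case/andP: (F01 l).
apply: Ex_le_cst => [|I]; first exact: prob_lpow.
rewrite ler_piMr ?exprn_ge0//; first by case/andP: rho01.
by apply: Ex_le_cst => [|W]; [exact: prob_lpow|case/andP: (F01 (rowstep L I W))].
Qed.

(** Expectation in the stationary model: bottom increments, left increments,
rows of weights. *)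
Definition Estat m n L (H : seq nat -> seq nat -> seq (seq bool) -> R) :=
  Ex (lpow (bern u) m) (fun I => Ex (lpow (geo rho L) n) (fun Js =>
    Ex (lpow (lpow (ber p) m) n) (fun Ws => H I Js Ws))).

(** The error n * rho ^ L is the probability that one of the left increments
reaches the truncation level. *)
Lemma burke_rows m n L (F : seq nat -> R) : (forall l, 0 <= F l <= 1) ->
  Estat m n L (fun I Js Ws => F (frow I Js Ws)) <=
  Ex (lpow (bern u) m) F + n%:R * rho ^+ L.
Proof.
have geo_p := prob_geo rho01 L.
rewrite /Estat => F01; elim: n => [|n IH].
  by under eq_Ex => I do rewrite !Ex_lpow0; rewrite mul0r addr0.
pose G I := Ex (lpow (geo rho L) n) (fun Js =>
    Ex (lpow (lpow (ber p) m) n) (fun Ws => F (frow I Js Ws))).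
have G01 I : 0 <= G I <= 1.
  apply/andP; split.
    apply: Ex_ge0 => [|Js]; first by apply: nneg_lpow; case: geo_p.
    apply: Ex_ge0 => [|Ws]; last by case/andP: (F01 (frow I Js Ws)).
    by do 2 apply: nneg_lpow; case: ber_p.
  apply: Ex_le_cst => [|Js]; first exact: prob_lpow.
  apply: Ex_le_cst => [|Ws]; first by do 2 apply: prob_lpow.
  by case/andP: (F01 (frow I Js Ws)).
apply: (@le_trans _ _ (Ex (lpow (bern u) m) (fun I => Ex (geo rho L) (fun J =>
    Ex (lpow (ber p) m) (fun W => G (rowstep J I W)))))).
  rewrite le_eqVlt; apply/orP; left; apply/eqP; apply: eq_Ex => I.
  rewrite Ex_lpowS; apply: eq_Ex => J.
  by under eq_Ex => Js do rewrite Ex_lpowS; rewrite Ex_swap.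
apply: le_trans (burke_row_geo _ _ G01) _.
by rewrite -natr1 mulrDl mul1r addrA lerD2r; exact: IH.
Qed.

Lemma Estat_le m n L H H' :
  (forall I Js Ws, size I = m -> all (fun i => (i <= 1)%N) I -> size Js = n -> size Ws = n ->
     all (fun W => size W == m) Ws -> H I Js Ws <= H' I Js Ws) ->
  Estat m n L H <= Estat m n L H'.
Proof.
move=> HH'; have geo_p := prob_geo rho01 L.
apply: (@Ex_le_supp _ _ (fun I => (size I == m) && all (fun i => (i <= 1)%N) I)) => [||I].
- by apply: nneg_lpow; case: bern_p.
- exact: all_lpow.
move=> /andP[/eqP sI aI]; apply: Ex_lpow_size => [|Js sJ]; first by case: geo_p.
apply: (@Ex_le_supp _ _ (fun Ws => (size Ws == n) && all (fun W => size W == m) Ws)) => [||Ws].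
- by do 2 apply: nneg_lpow; case: ber_p.
- apply: all_lpow; have := @all_lpow _ _ predT (ber p) m.
  by rewrite all_predT => /(_ isT); apply: sub_all => x /andP[].
by move=> /andP[/eqP sW aW]; exact: HH'.
Qed.

Lemma EstatD m n L H H' :
  Estat m n L (fun I Js Ws => H I Js Ws + H' I Js Ws) = Estat m n L H + Estat m n L H'.
Proof.
rewrite /Estat -ExD; apply: eq_Ex => I; rewrite -ExD; apply: eq_Ex => Js.
by rewrite -ExD.
Qed.

Lemma Estat_W m n L H : Estat m n L (fun _ _ Ws => H Ws) = Ex (lpow (lpow (ber p) m) n) H.
Proof.
rewrite /Estat Ex_cst; last exact: prob_lpow.
by rewrite Ex_cst//; apply: prob_lpow; exact: prob_geo.
Qed.

Lemma Estat_J m n L H : Estat m n L (fun _ Js _ => H Js) = Ex (lpow (geo rho L) n) H.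
Proof.
rewrite /Estat Ex_cst; last exact: prob_lpow.
by apply: eq_Ex => Js; rewrite Ex_cst//; do 2 apply: prob_lpow.
Qed.

Lemma Estat_I m n L H : Estat m n L (fun I _ _ => H I) = Ex (lpow (bern u) m) H.
Proof.
rewrite /Estat; apply: eq_Ex => I.
transitivity (Ex (lpow (geo rho L) n) (fun=> H I)).
  by apply: eq_Ex => Js; rewrite Ex_cst//; do 2 apply: prob_lpow.
by rewrite Ex_cst//; apply: prob_lpow; exact: prob_geo.
Qed.

Lemma natr_sumn (l : seq nat) : (sumn l)%:R = \sum_(x <- l) x%:R :> R.
Proof. by elim: l => [|x l IH]; rewrite ?big_nil// big_cons /= natrD IH. Qed.

(** The mean rho / (1 - rho) of the vertical increments, see [v_ofE]. *)
Definition v_of (p u : R) := p * (1 - u) / (u - p).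
Let v := v_of p u.

Lemma v_ofE : v = rho / (1 - rho).
Proof.
have [p0 p1] := andP p01; have u1' := u1; have pu' := pu.
rewrite /v /v_of /rho /rho_of.
by field; apply/and3P; split; rewrite gt_eqF//; lra.
Qed.

(** The passage time is the sum of the left increments and of the last row
[stat_frow], and [burke_rows] gives the law of the last row. The two sums are
not independent, but a union bound is enough. *)
Lemma stat_bounds (eps : R) : 0 < eps -> exists2 lam0, 0 < lam0 &
  exists B, forall lam, 0 < lam <= lam0 -> forall m n L x,
  [/\ Estat m n L (fun I Js Ws =>
        (m%:R * (u + eps) + n%:R * (v + eps) + 2 * x <= (stat_lpp I Js Ws)%:R)%R%:R)
        <= 2 * expR (- (lam * x)) + n%:R * rho ^+ L,
      (B <= L)%N -> Estat m n L (fun I Js Ws =>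
        ((stat_lpp I Js Ws)%:R <= m%:R * (u - eps) + n%:R * (v - eps) - 2 * x)%R%:R)
        <= 2 * expR (- (lam * x)) + n%:R * rho ^+ L,
      Ex (lpow (geo rho L) n) (fun Js => (n%:R * (v + eps) + x <= (sumn Js)%:R)%R%:R)
        <= expR (- (lam * x)) &
      Ex (lpow (bern u) m) (fun I => (m%:R * (u + eps) + x <= (sumn I)%:R)%R%:R)
        <= expR (- (lam * x))].
Proof.
move=> eps0; have [p0 p1] := andP p01; have u1' := u1; have pu' := pu.
have [l1 l10 h1] := geo_mgf_upper rho01 eps0.
have [l2 l20 [B h2]] := geo_mgf_lower rho01 eps0.
have u01 : 0 <= u <= 1 by lra.
have [l3 l30 h3] := bern_mgf u01 eps0.
exists (Num.min l1 (Num.min l2 l3)); first by rewrite !lt_min l10 l20.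
exists B => lam /andP[lam0]; rewrite !le_min => /and3P[ll1 ll2 ll3] m n L x.
have [bu bl] : _ /\ _ := h3 lam ltac:(by rewrite lam0 ll3).
have gu L' := h1 lam L' ltac:(by rewrite lam0 ll1).
have gl L' := h2 lam L' ltac:(by rewrite lam0 ll2).
have geo0 L' : nneg_law (geo rho L') by case: (prob_geo rho01 L').
have bern0 : nneg_law (bern u) by case: bern_p.
have JU : Ex (lpow (geo rho L) n) (fun Js => (n%:R * (v + eps) + x <= (sumn Js)%:R)%R%:R)
        <= expR (- (lam * x)).
  have := @chernoff _ _ (geo rho L) n (fun j => j%:R) lam (v + eps)
    (n%:R * (v + eps) + x) (geo0 L) lam0.
  rewrite {1}v_ofE => /(_ (gu L)); rewrite addrAC subrr add0r.
  by under eq_Ex => Js do rewrite -natr_sumn.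
have IU : Ex (lpow (bern u) m) (fun I => (m%:R * (u + eps) + x <= (sumn I)%:R)%R%:R)
        <= expR (- (lam * x)).
  have := @chernoff _ _ (bern u) m (fun j => j%:R) lam (u + eps)
    (m%:R * (u + eps) + x) bern0 lam0 bu; rewrite addrAC subrr add0r.
  by under eq_Ex => I do rewrite -natr_sumn.
have JL : (B <= L)%N ->
    Ex (lpow (geo rho L) n) (fun Js => ((sumn Js)%:R <= n%:R * (v - eps) - x)%R%:R)
        <= expR (- (lam * x)).
  move=> BL.
  have := @chernoff _ _ (geo rho L) n (fun j => - j%:R) lam (- (v - eps))
    (- (n%:R * (v - eps) - x)) (geo0 L) lam0.
  rewrite {1}v_ofE => /(_ (gl L BL)).
  have -> : - (n%:R * (v - eps) - x) - n%:R * - (v - eps) = x by ring.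
  by under eq_Ex => Js do rewrite sumrN lerN2 -natr_sumn.
have IL : Ex (lpow (bern u) m) (fun I => ((sumn I)%:R <= m%:R * (u - eps) - x)%R%:R)
        <= expR (- (lam * x)).
  have := @chernoff _ _ (bern u) m (fun j => - j%:R) lam (- (u - eps))
    (- (m%:R * (u - eps) - x)) bern0 lam0 bl.
  have -> : - (m%:R * (u - eps) - x) - m%:R * - (u - eps) = x by ring.
  by under eq_Ex => Js do rewrite sumrN lerN2 -natr_sumn.
split => //.
- apply: (@le_trans _ _ (Estat m n L (fun I Js Ws =>
    (m%:R * (u + eps) + x <= (sumn (frow I Js Ws))%:R)%R%:R +
    (n%:R * (v + eps) + x <= (sumn Js)%:R)%R%:R))).
    apply: Estat_le => I Js Ws sI _ sJ sW aW.
    rewrite stat_frow ?sI ?sW// natrD.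
    apply: ind_le2 => h; apply: contraT => /norP[]; rewrite -!ltNge => h' h''.
    by exfalso; move: h h' h''; rewrite leNgt => /negP + h' h''; apply; lra.
  rewrite EstatD Estat_J.
  have := @burke_rows m n L (fun l => (m%:R * (u + eps) + x <= (sumn l)%:R)%R%:R).
  by move=> /(_ (fun l => ind_bounds R _)); lra.
- move=> BL; apply: (@le_trans _ _ (Estat m n L (fun I Js Ws =>
    ((sumn (frow I Js Ws))%:R <= m%:R * (u - eps) - x)%R%:R +
    ((sumn Js)%:R <= n%:R * (v - eps) - x)%R%:R))).
    apply: Estat_le => I Js Ws sI _ sJ sW aW.
    rewrite stat_frow ?sI ?sW// natrD.
    apply: ind_le2 => h; apply: contraT => /norP[]; rewrite -!ltNge => h' h''.
    by exfalso; move: h h' h''; rewrite leNgt => /negP + h' h''; apply; lra.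
  rewrite EstatD Estat_J; have {}JL := JL BL.
  have := @burke_rows m n L (fun l => ((sumn l)%:R <= m%:R * (u - eps) - x)%R%:R).
  by move=> /(_ (fun l => ind_bounds R _)); lra.
Qed.

End Burke.

(** * Tail bounds for the last passage time *)

Section PureLaw.
Context {R : realType}.

Definition Elpp (p : R) m n (f : nat -> R) : R :=
  Ex (lpow (lpow (ber p) m) n) (fun Ws => f (pure (cfg Ws) m n)).

Lemma ind_le (a b : bool) : (a -> b) -> a%:R <= b%:R :> R.
Proof. by case: a => [/(_ isT) ->|_]. Qed.

Lemma ind_le4 (a b c d e : bool) : (a -> [|| b, c, d | e]) ->
  a%:R <= b%:R + (c%:R + (d%:R + e%:R)) :> R.
Proof.
move=> h; apply: le_trans (ind_le2 R h) _; rewrite lerD2l.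
apply: (le_trans (@ind_le2 R _ c (d || e) (fun x => x))); rewrite lerD2l.
exact: ind_le2.
Qed.

Lemma Ex_lpow_map A B (mu : law A) (nu : law B) (g : A -> B) n F :
  (forall f : B -> R, Ex mu (fun a => f (g a)) = Ex nu f) ->
  Ex (lpow mu n) (fun l => F (map g l)) = Ex (lpow nu n) F.
Proof.
move=> h; elim: n F => [|n IH] F; first by rewrite !Ex_lpow0.
rewrite !Ex_lpowS -h; apply: eq_Ex => a /=.
by rewrite -(IH (fun l => F (g a :: l))).
Qed.

Lemma Ex_lpow_drop A (mu : law A) k n (F : seq A -> R) : prob_law mu ->
  Ex (lpow mu (k + n)) (fun l => F (drop k l)) = Ex (lpow mu n) F.
Proof.
move=> mup; rewrite Ex_lpow_cat.
transitivity (Ex (lpow mu k) (fun=> Ex (lpow mu n) F)).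
  by apply: eq_Ex_lpow => [|l <-]; [case: mup|apply: eq_Ex => l'; rewrite drop_size_cat].
by rewrite Ex_cst//; exact: prob_lpow.
Qed.

(** The geometric variables are truncated at L; this sends L to infinity in the
resulting bounds. *)
Lemma geo_limit (rho a b : R) (B n : nat) : 0 <= rho < 1 ->
  (forall L, (B <= L)%N -> a <= b + n%:R * rho ^+ L) -> a <= b.
Proof.
move=> /andP[r0 r1] h.
have : (fun L => b + n%:R * rho ^+ L) @ \oo --> b + n%:R * 0.
  by apply: cvgD; [exact: cvg_cst|apply: cvgMr; apply: cvg_expr; rewrite ger0_norm].
rewrite mulr0 addr0 => cv; rewrite -(cvg_lim _ cv)//.
apply: limr_ge; first by apply/cvg_ex; exists b.
by near=> L; apply: h; near: L; exact: nbhs_infty_ge.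
Unshelve. all: by end_near. Qed.

Lemma psumD l k i : psum l (k + i) = (psum l k + psum (drop k l) i)%N.
Proof. by rewrite /psum takeD sumn_cat. Qed.

Lemma psum_le l i j : (i <= j)%N -> (psum l i <= psum l j)%N.
Proof.
move=> /subnKC <-; move: (j - i)%N => d; elim: i l => [|i IH] [|x l]; rewrite ?/psum//= ?take0//.
by rewrite leq_add2l; exact: IH.
Qed.

Lemma psum_leq_all2 l l' i : all2 leq l l' -> (psum l i <= psum l' i)%N.
Proof.
elim: l l' i => [|x l IH] [|x' l'] [|i] //= /andP[xx' /IH h].
by rewrite /psum /= leq_add//; exact: h.
Qed.

Variables (p : R) (p01 : 0 < p < 1).

Let ber_p : prob_law (ber p).
Proof. by apply: prob_ber; have [p0 p1] := andP p01; rewrite !ltW. Qed.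

(** Boundary values can only increase the passage time. *)
Theorem lpp_upper_tail (u eps : R) : p < u -> u < 1 -> 0 < eps ->
  exists2 lam, 0 < lam & forall m n x,
    Elpp p m n (fun k => (m%:R * (u + eps) + n%:R * (v_of p u + eps) + 2 * x <= k%:R)%R%:R)
    <= 2 * expR (- (lam * x)).
Proof.
move=> pu u1 eps0.
have [lam lam0 [B h]] := stat_bounds p01 pu u1 eps0.
exists lam => // m n x.
have r01 : 0 <= rho_of p u < 1 by have /andP[/ltW -> ->] := rho_in p01 pu u1.
apply: (@geo_limit (rho_of p u) _ _ 0 n) => // L _.
have [h1 _ _ _] := h lam ltac:(by rewrite lam0 lexx) m n L x.
apply: le_trans h1.
rewrite /Elpp -(Estat_W p01 pu u1 m n L).
apply: Estat_le => // I Js Ws sI _ sJ sW aW.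
by apply: ind_le => h1; apply: le_trans h1 _; rewrite ler_nat /stat_lpp sI sJ pure_le_lpp.
Qed.

Section exits.
Variables (u : R) (pu : p < u) (u1 : u < 1).

Let bern_p : prob_law (bern u).
Proof. by apply: prob_bern; have [p0 p1] := andP p01; apply/andP; split; apply: ltW => //; exact: lt_trans pu. Qed.

Let rho_lt u' : p < u' -> u' < 1 -> 0 <= rho_of p u' < 1.
Proof. by move=> pu' u1'; have /andP[/ltW -> ->] := rho_in p01 pu' u1'. Qed.

(** The path collects the first k bottom increments and then continues in the
quadrant at distance k, without left boundary. Raising the remaining bottom
increments to parameter u2 and adding left increments turns that quadrant into
a stationary model of parameter u2. *)
Lemma far_horizontal (u2 A b1 : R) k m n L : u <= u2 -> u2 < 1 ->
  Estat p u (k + m) n L (fun I Js Ws => (A <= (psum I k +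
    lpp (fun x => psum I (k + x) - psum I k)%N (fun=> 0%N) (shift k 0 (cfg Ws)) m n)%:R)%R%:R)
  <= Ex (lpow (bern u) k) (fun I => (b1 <= (sumn I)%:R)%R%:R) +
     Estat p u2 m n L (fun I Js Ws => (A - b1 <= (stat_lpp I Js Ws)%:R)%R%:R).
Proof.
move=> uu2 u21; have pu2 := lt_le_trans pu uu2.
pose F I Ws := (A - b1 <= (lpp (psum I) (fun=> 0%N) (cfg Ws) m n)%:R)%R%:R : R.
have prob2 : prob_law (bern u2).
  by apply: prob_bern; have [p0 p1] := andP p01; apply/andP; split; lra.
have probJ u' : p < u' -> u' < 1 -> prob_law (geo (rho_of p u') L).
  by move=> *; apply/prob_geo/rho_lt.
apply: (@le_trans _ _ (Estat p u (k + m) n L (fun I Js Ws =>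
    (b1 <= (sumn (take k I))%:R)%R%:R + F (drop k I) (map (drop k) Ws)))).
  apply: Estat_le => // I Js Ws sI _ sJ sW aW.
  apply: ind_le2 => h; apply: contraT => /norP[]; rewrite -!ltNge => h1 h2; exfalso.
  have E : lpp (fun x => psum I (k + x) - psum I k)%N (fun=> 0%N) (shift k 0 (cfg Ws)) m n =
    lpp (psum (drop k I)) (fun=> 0%N) (cfg (map (drop k) Ws)) m n.
    apply: eq_lpp => // [x _|i j im jn]; first by rewrite psumD addKn.
    rewrite shiftE add0n /cfg /= (nth_map [::]) ?sW// nth_drop.
    by rewrite addnS.
  rewrite E natrD in h; rewrite /psum in h.
  by move: h h1 h2; set X := (sumn _)%:R; set Y := (lpp _ _ _ _ _)%:R; lra.
rewrite EstatD; apply: lerD.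
  rewrite Estat_I// Ex_lpow_cat.
  have [mu0 _] := bern_p.
  rewrite le_eqVlt; apply/orP; left; apply/eqP; apply: eq_Ex_lpow => // l sl.
  transitivity (Ex (lpow (bern u) m) (fun=> (b1 <= (sumn l)%:R)%R%:R : R)).
    by apply: eq_Ex => l'; rewrite take_size_cat.
  by rewrite Ex_cst//; exact: prob_lpow.
have F01 I Ws : 0 <= F I Ws by case/andP: (ind_bounds R (A - b1 <= (lpp (psum I) (fun=> 0%N) (cfg Ws) m n)%:R)).
have EW I : Ex (lpow (lpow (ber p) (k + m)) n) (fun Ws => F (drop k I) (map (drop k) Ws)) =
   Ex (lpow (lpow (ber p) m) n) (F (drop k I)).
  by apply: (Ex_lpow_map n (F (drop k I))) => f; exact: Ex_lpow_drop.
apply: (@le_trans _ _ (Ex (lpow (bern u) (k + m)) (fun I =>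
    Ex (lpow (lpow (ber p) m) n) (F (drop k I))))).
  rewrite le_eqVlt; apply/orP; left; apply/eqP; apply: eq_Ex => I.
  by rewrite Ex_cst ?EW//; apply: prob_lpow; exact: probJ.
rewrite (Ex_lpow_drop k m (fun I => Ex (lpow (lpow (ber p) m) n) (F I)))//.
apply: (@le_trans _ _ (Ex (lpow (bern u2) m) (fun I => Ex (lpow (lpow (ber p) m) n) (F I)))).
  apply: dominated_lpow; [by case: bern_p|by case: prob2|exact: dominated_bern|].
  move=> l l' ll'; apply: Ex_le => [|Ws]; first by do 2 apply: nneg_lpow; case: ber_p.
  apply: ind_le => h; apply: le_trans h _; rewrite ler_nat.
  by apply: lpp_mono => // x; exact: psum_leq_all2.
apply: (@le_trans _ _ (Estat p u2 m n L (fun I _ Ws => F I Ws))).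
  rewrite le_eqVlt; apply/orP; left; apply/eqP; apply: eq_Ex => I.
  by rewrite Ex_cst//; apply: prob_lpow; exact: probJ.
apply: Estat_le => // I Js Ws sI _ sJ sW aW.
apply: ind_le => h; apply: le_trans h _; rewrite ler_nat.
by rewrite /stat_lpp sI sJ; apply: lpp_mono.
Qed.

(** The mirror image of [far_horizontal]: the vertical increments become larger
when the parameter decreases, so here u3 <= u. *)
Lemma far_vertical (u3 A b1 : R) k m n L : p < u3 -> u3 <= u ->
  Estat p u m (k + n) L (fun I Js Ws => (A <= (psum Js k +
    lpp (fun=> 0%N) (fun y => psum Js (k + y) - psum Js k)%N (shift 0 k (cfg Ws)) m n)%:R)%R%:R)
  <= Ex (lpow (geo (rho_of p u) L) k) (fun Js => (b1 <= (sumn Js)%:R)%R%:R) +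
     Estat p u3 m n L (fun I Js Ws => (A - b1 <= (stat_lpp I Js Ws)%:R)%R%:R).
Proof.
move=> pu3 u3u; have u31 := le_lt_trans u3u u1.
pose F Js Ws := (A - b1 <= (lpp (fun=> 0%N) (psum Js) (cfg Ws) m n)%:R)%R%:R : R.
have prob3 : prob_law (bern u3).
  by apply: prob_bern; have [p0 p1] := andP p01; apply/andP; split; lra.
have probJ u' : p < u' -> u' < 1 -> prob_law (geo (rho_of p u') L).
  by move=> *; apply/prob_geo/rho_lt.
have probW : prob_law (lpow (ber p) m) by exact: prob_lpow.
have probJu := probJ u pu u1; have probJ3 := probJ u3 pu3 u31.
apply: (@le_trans _ _ (Estat p u m (k + n) L (fun I Js Ws =>
    (b1 <= (sumn (take k Js))%:R)%R%:R + F (drop k Js) (drop k Ws)))).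
  apply: Estat_le => // I Js Ws sI _ sJ sW aW.
  apply: ind_le2 => h; apply: contraT => /norP[]; rewrite -!ltNge => h1 h2; exfalso.
  have E : lpp (fun=> 0%N) (fun x => psum Js (k + x) - psum Js k)%N (shift 0 k (cfg Ws)) m n =
    lpp (fun=> 0%N) (psum (drop k Js)) (cfg (drop k Ws)) m n.
    apply: eq_lpp => // [y _|i j im jn]; first by rewrite psumD addKn.
    by rewrite shiftE add0n /cfg /= nth_drop.
  rewrite E natrD in h; rewrite /psum in h.
  by move: h h1 h2; set X := (sumn _)%:R; set Y := (lpp _ _ _ _ _)%:R; lra.
rewrite EstatD; apply: lerD.
  rewrite Estat_J// Ex_lpow_cat.
  have [mu0 _] := probJu.
  rewrite le_eqVlt; apply/orP; left; apply/eqP; apply: eq_Ex_lpow => // l sl.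
  transitivity (Ex (lpow (geo (rho_of p u) L) n) (fun=> (b1 <= (sumn l)%:R)%R%:R : R)).
    by apply: eq_Ex => l'; rewrite take_size_cat.
  by rewrite Ex_cst//; exact: prob_lpow.
have EW Js : Ex (lpow (lpow (ber p) m) (k + n)) (fun Ws => F (drop k Js) (drop k Ws)) =
   Ex (lpow (lpow (ber p) m) n) (F (drop k Js)).
  exact: Ex_lpow_drop.
apply: (@le_trans _ _ (Ex (lpow (geo (rho_of p u) L) (k + n)) (fun Js =>
    Ex (lpow (lpow (ber p) m) n) (F (drop k Js))))).
  rewrite /Estat Ex_cst; last exact: prob_lpow.
  by rewrite le_eqVlt; apply/orP; left; apply/eqP; apply: eq_Ex => Js.
rewrite (Ex_lpow_drop k n (fun Js => Ex (lpow (lpow (ber p) m) n) (F Js)))//.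
apply: (@le_trans _ _ (Ex (lpow (geo (rho_of p u3) L) n) (fun Js =>
    Ex (lpow (lpow (ber p) m) n) (F Js)))).
  apply: dominated_lpow; [by case: probJu|by case: probJ3| |].
    have /andP[r0 r1] := rho_lt pu u1; have /andP[r30 r31] := rho_lt pu3 u31.
    apply: dominated_geo => //; rewrite /rho_of.
    have [p0 p1] := andP p01; have pu' := pu.
    rewrite ler_pdivrMr ?mulr_gt0//; [|lra|lra].
    rewrite mulrAC ler_pdivlMr ?mulr_gt0//; [|lra|lra].
    have h : 0 <= p * (1 - p) * (u - u3) by rewrite !mulr_ge0//; lra.
    by move: h; lra.
  move=> l l' ll'; apply: Ex_le => [|Ws]; first by do 2 apply: nneg_lpow; case: ber_p.
  apply: ind_le => h; apply: le_trans h _; rewrite ler_nat.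
  by apply: lpp_mono => // x; exact: psum_leq_all2.
apply: (@le_trans _ _ (Estat p u3 m n L (fun _ Js Ws => F Js Ws))).
  by rewrite /Estat [leRHS]Ex_cst//; exact: prob_lpow.
apply: Estat_le => // I Js Ws sI _ sJ sW aW.
apply: ind_le => h; apply: le_trans h _; rewrite ler_nat.
by rewrite /stat_lpp sI sJ; apply: lpp_mono.
Qed.

End exits.

Lemma sumn_le_size (l : seq nat) : all (fun i => (i <= 1)%N) l -> (sumn l <= size l)%N.
Proof. by elim: l => //= i l IH /andP[i1 /IH h]; rewrite -add1n leq_add. Qed.

(** The two inequalities say that the paths which stay on an axis up to distance
k have a mean below the stationary level a. Outside a small event the maximal
path therefore leaves the axes before k, where the boundary contributes at most
k (1 + v + eps) + x. *)
Theorem lpp_lower_tail (u u2 u3 eps : R) : p < u3 -> u3 <= u -> u <= u2 -> u2 < 1 ->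
  0 < eps -> exists2 lam, 0 < lam & forall m n k x, (k <= m)%N -> (k <= n)%N ->
    let a := m%:R * (u - eps) + n%:R * (v_of p u - eps) in
    k%:R * (u + eps) + (m - k)%:R * (u2 + eps) + n%:R * (v_of p u2 + eps) + 5 * x <= a ->
    k%:R * (v_of p u + eps) + (n - k)%:R * (v_of p u3 + eps) + m%:R * (u3 + eps) + 5 * x <= a ->
    Elpp p m n (fun l => (l%:R <= a - k%:R * (1 + v_of p u + eps) - 3 * x)%R%:R)
    <= 9 * expR (- (lam * x)).
Proof.
move=> pu3 u3u uu2 u21 eps0.
have pu := lt_le_trans pu3 u3u; have u1 := le_lt_trans uu2 u21.
have pu2 := lt_le_trans pu uu2; have u31 := le_lt_trans u3u u1.
have r01 u' : p < u' -> u' < 1 -> 0 <= rho_of p u' < 1.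
  by move=> h1 h2; have /andP[/ltW -> ->] := rho_in p01 h1 h2.
have [l1 l10 [B h1]] := stat_bounds p01 pu u1 eps0.
have [l2 l20 [B2 h2]] := stat_bounds p01 pu2 u21 eps0.
have [l3 l30 [B3 h3]] := stat_bounds p01 pu3 u31 eps0.
pose lam := Num.min l1 (Num.min l2 l3).
have lam0 : 0 < lam by rewrite !lt_min l10 l20.
have ll1 : 0 < lam <= l1 by rewrite lam0 ge_min lexx.
have ll2 : 0 < lam <= l2 by rewrite lam0 !ge_min lexx orbT.
have ll3 : 0 < lam <= l3 by rewrite lam0 !ge_min lexx !orbT.
exists lam => // m n k x km kn a.
have [m' mE] : exists m', m = (k + m')%N by exists (m - k)%N; rewrite subnKC.
have [n' nE] : exists n', n = (k + n')%N by exists (n - k)%N; rewrite subnKC.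
have -> : (m - k = m')%N by rewrite mE addKn.
have -> : (n - k = n')%N by rewrite nE addKn.
move=> hB hC.
(* A single ratio for the three truncation errors. *)
pose rho := Num.max (rho_of p u) (Num.max (rho_of p u2) (rho_of p u3)).
have rho01 : 0 <= rho < 1.
  have /andP[a1 b1] := r01 _ pu u1; have /andP[a2 b2] := r01 _ pu2 u21.
  have /andP[a3 b3] := r01 _ pu3 u31.
  by rewrite le_max a1 !gt_max b1 b2 b3.
have rX u' L : p < u' -> u' < 1 -> rho_of p u' <= rho -> rho_of p u' ^+ L <= rho ^+ L.
  move=> pu' u1' h; have /andP[a1 _] := r01 _ pu' u1'.
  by apply: lerXn2r => //; rewrite nnegrE// (le_trans a1).
apply: (@geo_limit rho _ _ B (n + n + n)) => // L BL.
have [_ S1 JU _] := h1 lam ll1 m n L x.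
have {}S1 := S1 BL.
have [_ _ _ IU] := h1 lam ll1 k n L x.
have [_ _ JUk _] := h1 lam ll1 m k L x.
have [S2 _ _ _] := h2 lam ll2 m' n L x.
have [S3 _ _ _] := h3 lam ll3 m n' L x.
(* The stationary passage time exceeds A outside a small event. *)
pose A := a - 2 * x.
rewrite -/a -/A in S1.
have FH := @far_horizontal u pu u1 u2 A (k%:R * (u + eps) + x) k m' n L uu2 u21.
have FV := @far_vertical u pu u1 u3 A (k%:R * (v_of p u + eps) + x) k m n' L pu3 u3u.
have SH : Estat p u2 m' n L (fun I Js Ws => (A - (k%:R * (u + eps) + x) <= (stat_lpp I Js Ws)%:R)%R%:R)
   <= 2 * expR (- (lam * x)) + n%:R * rho_of p u2 ^+ L.
  apply: le_trans S2; apply: Estat_le => // I Js Ws _ _ _ _ _.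
  apply: ind_le => h; apply: le_trans h.
  by move: hB; rewrite /A; lra.
have SV : Estat p u3 m n' L (fun I Js Ws => (A - (k%:R * (v_of p u + eps) + x) <= (stat_lpp I Js Ws)%:R)%R%:R)
   <= 2 * expR (- (lam * x)) + n'%:R * rho_of p u3 ^+ L.
  apply: le_trans S3; apply: Estat_le => // I Js Ws _ _ _ _ _.
  apply: ind_le => h; apply: le_trans h.
  by move: hC; rewrite /A; lra.
rewrite -mE in FH; rewrite -nE in FV.
have JK : Estat p u m n L (fun _ Js _ => (k%:R * (v_of p u + eps) + x <= (sumn (take k Js))%:R)%R%:R)
   <= expR (- (lam * x)).
  rewrite Estat_J// nE Ex_lpow_cat.
  have probJ : prob_law (geo (rho_of p u) L) by apply/prob_geo/r01.
  have [mu0 _] := probJ.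
  apply: le_trans JUk.
  rewrite le_eqVlt; apply/orP; left; apply/eqP; apply: eq_Ex_lpow => // l sl.
  transitivity (Ex (lpow (geo (rho_of p u) L) n') (fun=> (k%:R * (v_of p u + eps) + x <= (sumn l)%:R)%R%:R : R)).
    by apply: eq_Ex => l'; rewrite take_size_cat.
  by rewrite Ex_cst//; exact: prob_lpow.
rewrite /Elpp -(Estat_W p01 pu u1 m n L).
apply: (@le_trans _ _ (
  Estat p u m n L (fun I Js Ws => ((stat_lpp I Js Ws)%:R <= A)%R%:R) +
  (Estat p u m n L (fun I Js Ws => (A <= (psum I k +
    lpp (fun x => psum I (k + x) - psum I k)%N (fun=> 0%N) (shift k 0 (cfg Ws)) m' n)%:R)%R%:R) +
  (Estat p u m n L (fun I Js Ws => (A <= (psum Js k +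
    lpp (fun=> 0%N) (fun y => psum Js (k + y) - psum Js k)%N (shift 0 k (cfg Ws)) m n')%:R)%R%:R) +
   Estat p u m n L (fun _ Js _ => (k%:R * (v_of p u + eps) + x <= (sumn (take k Js))%:R)%R%:R))))).
  rewrite -!EstatD; apply: Estat_le => // I Js Ws sI aI sJ sW aW.
  apply: ind_le4 => h; apply: contraT; rewrite !negb_or -!ltNge => /and4P[g1 g2 g3 g4].
  have aI' : (psum I k <= k)%N.
    have : all (fun i => (i <= 1)%N) (take k I).
      by apply/allP => i /mem_take; move/allP: aI => /(_ i).
    move=> /sumn_le_size /leq_trans; apply.
    by rewrite size_take; case: ltnP.
  have [] := @lpp_exit (psum I) (psum Js) (cfg Ws) k k m n.
  - exact: psum_le.
  - exact: psum_le.
  - move=> e; exfalso.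
    have e' : (stat_lpp I Js Ws)%:R <= k%:R + (psum Js k)%:R + (pure (cfg Ws) m n)%:R :> R.
      rewrite -!natrD ler_nat /stat_lpp sI sJ; apply: leq_trans e _.
      by rewrite !leq_add2r.
    move: e' h g1 g4; rewrite /A /psum.
    set X1 := (stat_lpp _ _ _)%:R; set X2 := (pure _ _ _)%:R; set X3 := (sumn _)%:R.
    set vv := v_of p u; clearbody X1 X2 X3 vv.
    by move=> *; lra.
  - have -> : (m - k = m')%N by rewrite mE addKn.
    move=> [_ e]; exfalso; move: g1 g2; rewrite /stat_lpp sI sJ.
    have : (lpp (psum I) (psum Js) (cfg Ws) m n)%:R <= (psum I k + lpp (fun x => psum I (k + x) - psum I k)%N (fun=> 0%N) (shift k 0 (cfg Ws)) m' n)%:R :> R.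
      by rewrite ler_nat.
    by move=> e1 e2 e3; have := lt_trans e3 e2; rewrite ltNge e1.
  - have -> : (n - k = n')%N by rewrite nE addKn.
    move=> [_ e]; exfalso; move: g1 g3; rewrite /stat_lpp sI sJ.
    have : (lpp (psum I) (psum Js) (cfg Ws) m n)%:R <= (psum Js k + lpp (fun=> 0%N) (fun x => psum Js (k + x) - psum Js k)%N (shift 0 k (cfg Ws)) m n')%:R :> R.
      by rewrite ler_nat.
    by move=> e1 e2 e3; have := lt_trans e3 e2; rewrite ltNge e1.
have R1 : n%:R * rho_of p u ^+ L <= n%:R * rho ^+ L.
  by rewrite ler_wpM2l// rX// le_max lexx.
have R2 : n%:R * rho_of p u2 ^+ L <= n%:R * rho ^+ L.
  by rewrite ler_wpM2l// rX// !le_max lexx orbT.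
have R3 : n'%:R * rho_of p u3 ^+ L <= n%:R * rho ^+ L.
  apply: ler_pM => //; last by rewrite rX// !le_max lexx !orbT.
    by rewrite exprn_ge0//; case/andP: (r01 _ pu3 u31).
  by rewrite ler_nat nE leq_addl.
move: S1 FH FV SH SV IU JUk JK R1 R2 R3; rewrite !natrD !mulrDl.
lra.
Qed.

End PureLaw.

(** * The law of large numbers from below *)

Section LLN.
Context {R : realType}.
Variables (p : R) (p01 : 0 < p < 1).

Lemma truncn_bounds (x : R) : 0 <= x ->
  (Num.truncn x)%:R <= x /\ x - 1 <= (Num.truncn x)%:R.
Proof.
move=> x0; have /andP[h1 h2] := truncn_itv x0; split => //.
by rewrite -natr1 in h2; lra.
Qed.

(** The exact increment of v replaces a Taylor expansion. *)
Lemma v_of_shift u d : p < u -> p < u + d ->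
  v_of p (u + d) = v_of p u - p * (1 - p) * d / ((u - p) * (u - p + d)).
Proof.
move=> pu pd; rewrite /v_of; field.
by apply/andP; split; rewrite gt_eqF//; lra.
Qed.

(** The value of s makes u the minimizer of s u + t v(u). With cut eta and shift
del of the parameter, the long horizontal exits lose eta * del from the shorter
side and gain at most s * del^2 / w, where w = u - p; the choice del <= eta w /
(2 s) keeps half of the loss. The vertical exits are similar with t. *)
Lemma lln_lower (u t eps al : R) : p < u -> u < 1 -> 0 < t -> 0 < eps -> 0 < al ->
  let s := t * (p * (1 - p)) / (u - p) ^+ 2 in
  exists K : R, forall N, K <= N%:R ->
    Elpp p (Num.truncn (N%:R * s)) (Num.truncn (N%:R * t))
      (fun l => (l%:R <= N%:R * (s * u + t * v_of p u - eps))%R%:R) <= al.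
Proof.
move=> pu u1 t0 eps0 al0 s; have /andP[p0 p1] := p01.
pose w := u - p; have w0 : 0 < w by rewrite /w; lra.
pose c := p * (1 - p); have c0 : 0 < c by rewrite /c mulr_gt0//; lra.
have sE : s = t * c / w ^+ 2 by [].
have wE : w = u - p by [].
have cE : c = p * (1 - p) by [].
have s0 : 0 < s by rewrite sE divr_gt0//; [exact: mulr_gt0|exact: exprn_gt0].
pose v := v_of p u.
have v0 : 0 <= v by rewrite /v /v_of divr_ge0 ?mulr_ge0//; lra.
rewrite -/v; have vE : v = v_of p u by [].
clearbody s v c w.
(* eta : relative length of the axes where an exit counts as near. *)
pose eta := Num.min (Num.min s t) (eps / (4 * (2 + v))).
have D0 : 0 < 4 * (2 + v) by lra.
have eta0 : 0 < eta by rewrite !lt_min s0 t0 divr_gt0.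
have etas : eta <= s by rewrite !ge_min lexx.
have etat : eta <= t by rewrite !ge_min lexx orbT.
have etae : eta * (4 * (2 + v)) <= eps by rewrite -ler_pdivlMr// /eta ge_min lexx orbT.
(* del : shift of the parameter; the last two terms make its square negligible
   against eta * del. *)
pose del := Num.min (Num.min (w / 2) ((1 - u) / 2))
  (Num.min (eta * w / (2 * s)) (eta * w / (2 * t))).
have del0 : 0 < del by rewrite !lt_min !divr_gt0 ?mulr_gt0//; lra.
have delw : del <= w / 2 by rewrite !ge_min lexx.
have delu : del <= (1 - u) / 2 by rewrite !ge_min lexx !orbT.
have dels : del * (2 * s) <= eta * w.
  by rewrite -ler_pdivlMr ?mulr_gt0// !ge_min lexx !orbT.
have delt : del * (2 * t) <= eta * w.
  by rewrite -ler_pdivlMr ?mulr_gt0// !ge_min lexx !orbT.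
pose u2 := u + del; pose u3 := u - del.
pose d2 := c * del / (w * (w + del)).
pose d3 := c * del / (w * (w - del)).
have wd0 : 0 < w - del by lra.
have wd0' : 0 < w + del by lra.
have d20 : 0 < d2 by rewrite divr_gt0 ?mulr_gt0.
have d30 : 0 < d3 by rewrite divr_gt0 ?mulr_gt0.
have v2E : v_of p u2 = v - d2.
  rewrite /u2 v_of_shift//; last by lra.
  by rewrite -wE -cE -vE.
have v3E : v_of p u3 = v + d3.
  rewrite /u3 v_of_shift//; last by lra.
  by rewrite -wE -cE -vE mulrN mulNr opprK.
have F2 : s * del - t * d2 <= eta * del / 2.
  have -> : s * del - t * d2 = s * del * (del / (w + del)).
    by rewrite sE /d2; field; rewrite !gt_eqF.
  have -> : eta * del / 2 = s * del * (eta / (2 * s)).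
    by field; rewrite gt_eqF.
  rewrite ler_pM2l ?mulr_gt0// ler_pdivrMr// mulrAC ler_pdivlMr ?mulr_gt0//.
  by nra.
have F3 : t * d3 - s * del <= eta * d3 / 2.
  have -> : t * d3 - s * del = d3 * (t * del / w).
    by rewrite sE /d3; field; rewrite !gt_eqF.
  have -> : eta * d3 / 2 = d3 * (eta / 2) by ring.
  by rewrite ler_pM2l// ler_pdivrMr//; lra.
(* gam : the loss per unit of N of the far exits of both kinds. *)
pose gam := Num.min (eta * del / 2) (eta * d3 / 2).
have gam0 : 0 < gam.
  by rewrite lt_min; apply/andP; split; apply: divr_gt0 => //; exact: mulr_gt0.
have gam2 : gam <= eta * del / 2 by rewrite ge_min lexx.
have gam3 : gam <= eta * d3 / 2 by rewrite ge_min lexx orbT.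
have st0 : 0 < 8 * (s + t) by lra.
(* e and xi : the fluctuations allowed in the Chernoff bounds, small against gam
   and against eps. *)
pose e := Num.min 1 (Num.min (gam / (8 * (s + t))) (eps / (8 * (s + t)))).
have e0 : 0 < e by rewrite !lt_min ltr01 !divr_gt0.
have e1 : e <= 1 by rewrite ge_min lexx.
have eg : e * (8 * (s + t)) <= gam by rewrite -ler_pdivlMr// !ge_min lexx !orbT.
have ee : e * (8 * (s + t)) <= eps by rewrite -ler_pdivlMr// !ge_min lexx !orbT.
pose xi := Num.min (gam / 20) (eps / 24).
have xi0 : 0 < xi by rewrite lt_min !divr_gt0.
have xig : xi <= gam / 20 by rewrite ge_min lexx.
have xie : xi <= eps / 24 by rewrite ge_min lexx orbT.
have [lam lam0 H] := @lpp_lower_tail R p p01 u u2 u3 e ltac:(rewrite /u3; lra)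
  ltac:(rewrite /u3; lra) ltac:(rewrite /u2; lra) ltac:(rewrite /u2; lra) e0.
pose K := Num.max (Num.max ((del + d2) * 2 / gam) ((del + d3) * 2 / gam))
  (Num.max ((u + v) * 2 / eps) (9 / (lam * xi * al))).
exists K => N; rewrite !ge_max => /andP[/andP[K1 K2] /andP[K3 K4]].
rewrite ler_pdivrMr// in K1; rewrite ler_pdivrMr// in K2.
rewrite ler_pdivrMr// in K3; rewrite ler_pdivrMr ?mulr_gt0// in K4.
set m := Num.truncn _; set n := Num.truncn _.
pose k := Num.truncn (N%:R * eta).
have N0 : 0 <= N%:R :> R by [].
have [m1 m2] : m%:R <= N%:R * s /\ N%:R * s - 1 <= m%:R by apply: truncn_bounds; rewrite mulr_ge0// ltW.
have [n1 n2] : n%:R <= N%:R * t /\ N%:R * t - 1 <= n%:R by apply: truncn_bounds; rewrite mulr_ge0// ltW.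
have [k1 k2] : k%:R <= N%:R * eta /\ N%:R * eta - 1 <= k%:R by apply: truncn_bounds; rewrite mulr_ge0// ltW.
have km : (k <= m)%N by apply: le_truncn; rewrite ler_wpM2l.
have kn : (k <= n)%N by apply: le_truncn; rewrite ler_wpM2l.
have {}H := H m n k (xi * N%:R) km kn.
rewrite v2E v3E -vE !natrB//= in H.
have mn : e * (m%:R + n%:R) <= N%:R * gam / 8.
  have h1 : e * (m%:R + n%:R) <= e * (N%:R * (s + t)).
    by rewrite ler_pM2l// mulrDr lerD.
  have h2 : N%:R * (e * (8 * (s + t))) <= N%:R * gam by rewrite ler_wpM2l.
  lra.
have mn' : e * (m%:R + n%:R) <= N%:R * eps / 8.
  have h1 : e * (m%:R + n%:R) <= e * (N%:R * (s + t)).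
    by rewrite ler_pM2l// mulrDr lerD.
  have h2 : N%:R * (e * (8 * (s + t))) <= N%:R * eps by rewrite ler_wpM2l.
  lra.
have x1 : N%:R * xi <= N%:R * (gam / 20) by rewrite ler_wpM2l.
have x2 : N%:R * xi <= N%:R * (eps / 24) by rewrite ler_wpM2l.
have cB : k%:R * (u + e) + (m%:R - k%:R) * (u2 + e) + n%:R * (v - d2 + e) + 5 * (xi * N%:R)
    <= m%:R * (u - e) + n%:R * (v - e).
  have f2 : N%:R * (s * del - t * d2) <= N%:R * (eta * del / 2) by rewrite ler_wpM2l.
  have fm : m%:R * del <= N%:R * s * del by rewrite ler_wpM2r// ltW.
  have fn : (N%:R * t - 1) * d2 <= n%:R * d2 by rewrite ler_wpM2r// ltW.
  have fk : (N%:R * eta - 1) * del <= k%:R * del by rewrite ler_wpM2r// ltW.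
  have fg : N%:R * gam <= N%:R * (eta * del / 2) by rewrite ler_wpM2l.
  rewrite /u2; lra.
have cC : k%:R * (v + e) + (n%:R - k%:R) * (v + d3 + e) + m%:R * (u3 + e) + 5 * (xi * N%:R)
    <= m%:R * (u - e) + n%:R * (v - e).
  have f3 : N%:R * (t * d3 - s * del) <= N%:R * (eta * d3 / 2) by rewrite ler_wpM2l.
  have fm : (N%:R * s - 1) * del <= m%:R * del by rewrite ler_wpM2r// ltW.
  have fn : n%:R * d3 <= N%:R * t * d3 by rewrite ler_wpM2r// ltW.
  have fk : (N%:R * eta - 1) * d3 <= k%:R * d3 by rewrite ler_wpM2r// ltW.
  have fg : N%:R * gam <= N%:R * (eta * d3 / 2) by rewrite ler_wpM2l.
  rewrite /u3; lra.
apply: le_trans (le_trans _ (H cB cC)) _.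
  apply: Ex_le => [|Ws].
    by do 2 apply: nneg_lpow; rewrite /nneg_law /= !subr_ge0 !ltW.
  apply: ind_le => h; apply: le_trans h _.
  have fm : (N%:R * s - 1) * u <= m%:R * u.
    by rewrite ler_wpM2r// ltW// (lt_trans p0).
  have fn : (N%:R * t - 1) * v <= n%:R * v by rewrite ler_wpM2r.
  have fk : k%:R * (1 + v + e) <= N%:R * eta * (2 + v).
    apply: ler_pM => //; last by move: e1; clear; lra.
    by rewrite !addr_ge0// ltW.
  have fe : N%:R * (eta * (4 * (2 + v))) <= N%:R * eps by rewrite ler_wpM2l.
  lra.
rewrite expRN ler_pdivrMr ?expR_gt0//; apply: le_trans K4 _.
have -> : N%:R * (lam * xi * al) = al * (lam * (xi * N%:R)) by ring.
by rewrite ler_pM2l//; apply: le_trans (expR_ge1Dx _); rewrite lerDr.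
Qed.

End LLN.

(** * From the probability space to finite laws *)

Lemma shape_map2 A B (f : A -> B) (ss : seq (seq A)) :
  shape (map (map f) ss) = shape ss.
Proof. by rewrite /shape -map_comp; apply: eq_map => l /=; rewrite size_map. Qed.

Lemma shape_nseq A (ss : seq (seq A)) c :
  all (fun s => size s == c) ss -> shape ss = nseq (size ss) c.
Proof. by elim: ss => //= s ss IH /andP[/eqP -> /IH <-]. Qed.

Definition rect (a b m n : nat) : seq (seq site) :=
  [seq [seq ((a + i.+1)%N, (b + j)%N) | i <- iota 0 m] | j <- iota 0 n].

Definition box a b m n : seq site := flatten (rect a b m n).

Lemma mem_box a b m n v :
  (v \in box a b m n) = [&& (a < v.1)%N, (v.1 <= a + m)%N, (b <= v.2)%N & (v.2 < b + n)%N].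
Proof.
case: v => x y /=.
apply/allpairsPdep/and4P => [[j [i [jn im [-> ->]]]]|[h1 h2 h3 h4]].
  by move: jn im; rewrite !mem_iota /= !add0n => jn im; split; lia.
exists (y - b)%N, (x - a.+1)%N; rewrite !mem_iota /= !add0n.
by split; [lia|lia|congr pair; lia].
Qed.

Lemma uniq_box a b m n : uniq (box a b m n).
Proof.
apply: allpairs_uniq; rewrite ?iota_uniq// => -[j i] [j' i'] _ _ /= [].
by move=> h1 h2; congr pair; lia.
Qed.

Lemma size_rect a b m n : all (fun vs => size vs == m) (rect a b m n).
Proof. by apply/allP => l /mapP[j _ ->]; rewrite size_map size_iota. Qed.

Lemma size_box a b m n : size (box a b m n) = (n * m)%N.
Proof. by rewrite /box size_allpairs !size_iota. Qed.

Lemma pure_rect om a b m n :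
  pure (shift a b om) m n = pure (cfg (map (map om) (rect a b m n))) m n.
Proof.
apply: eq_lpp => // i j im jn; rewrite shiftE /cfg /=.
rewrite (nth_map [::]) ?size_map ?size_iota// (nth_map 0%N) ?size_iota//.
rewrite (nth_map (0%N, 0%N)) ?size_map ?size_iota// (nth_map 0%N) ?size_iota//.
by rewrite !nth_iota// !add0n.
Qed.

Lemma pure_box om a b m n :
  pure (shift a b om) m n = pure (cfg (reshape (nseq n m) (map om (box a b m n)))) m n.
Proof.
rewrite pure_rect /box map_flatten; congr (pure (cfg _) _ _).
rewrite -[LHS]flattenK; congr (reshape _ _).
by rewrite shape_map2 (shape_nseq (size_rect a b m n)) size_map size_iota.
Qed.

Lemma shift0 om : shift 0 0 om = om.
Proof. by apply/funext => -[i j]; rewrite shiftE !add0n. Qed.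

Section MeasureLink.
Context {R : realType} {d : measure_display} {T : measurableType d}.
Variables (P : probability T R) (p : R) (omega : site -> {RV P >-> bool}).
Hypotheses (p01 : 0 < p < 1) (iid : iid_bernoulli p omega).

Definition env (x : T) : site -> bool := fun v => omega v x.

Definition pmfb (b : bool) : R := if b then p else 1 - p.

Lemma measurable_site v B : measurable (omega v @^-1` B).
Proof. by rewrite -[X in measurable X]setTI; exact: measurable_funP. Qed.

Lemma prob_site v b : P (omega v @^-1` [set b]) = (pmfb b)%:E.
Proof.
have [h _] := iid; have := h v [set b]; rewrite /distribution /pushforward /= => ->.
have /andP[p0 p1] := p01.
have e b1 : (b1 \in [set b]) = (b1 == b).
  by apply/idP/eqP => [/set_mem//|->]; exact/mem_set.
rewrite bernoulli_probE ?(ltW p0) ?(ltW p1)// !diracE !e.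
by case: b {e}; rewrite /= ?mule1 ?mule0 ?adde0 ?add0e.
Qed.

Lemma cylinder (ws : seq site) (b : site -> bool) : uniq ws ->
  P (\bigcap_(v in [set` ws]) (omega v @^-1` [set b v])) = (\prod_(v <- ws) pmfb (b v))%:E.
Proof.
move=> uw; have [_ h] := iid; rewrite (h ws (fun v => [set b v]) uw).
rewrite -prodEFin; apply: eq_bigr => v _; exact: prob_site.
Qed.

(** Induction on vs: the value at the first site is moved from the event to the
cylinder, which is why a cylinder over other sites is carried along. *)
Lemma family_law_cyl (vs ws : seq site) (f : seq bool -> bool) (b : site -> bool) :
  uniq (vs ++ ws) ->
  let S := [set x | f (map (env x) vs)] `&`
     \bigcap_(v in [set` ws]) (omega v @^-1` [set b v]) in
  measurable S /\
  P S = (Ex (lpow (ber p) (size vs)) (fun l => (f l)%:R) * \prod_(v <- ws) pmfb (b v))%:E.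
Proof.
elim: vs ws f b => [|v vs IH] ws f b.
  rewrite cat0s [size _]/= Ex_lpow0 => uw.
  have mC : measurable (\bigcap_(v in [set` ws]) (omega v @^-1` [set b v])).
    by apply: fin_bigcap_measurable => [|v _]; [exact: finite_seq|exact: measurable_site].
  case: (f [::]).
    rewrite (_ : [set x | _] = setT); last by apply/seteqP; split.
    by cbv zeta; rewrite setTI mul1r cylinder.
  rewrite (_ : [set x | _] = set0); last by apply/seteqP; split.
  by cbv zeta; rewrite set0I measure0 mul0r; split.
move=> uw.
have uw' : uniq (vs ++ v :: ws) by rewrite -cat1s uniq_catCA.
have vw : v \notin ws.
  by move: uw => /=; rewrite mem_cat negb_or => /andP[/andP[_ ->]].
pose S b0 := [set x | f (b0 :: map (env x) vs)] `&`
     \bigcap_(w in [set` v :: ws]) (omega w @^-1` [set if w == v then b0 else b w]).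
have SE b0 : measurable (S b0) /\ P (S b0) =
   (Ex (lpow (ber p) (size vs)) (fun l => (f (b0 :: l))%:R) *
    (pmfb b0 * \prod_(w <- ws) pmfb (b w)))%:E.
  have [mS PS] := IH (v :: ws) (fun l => f (b0 :: l)) (fun w => if w == v then b0 else b w) uw'.
  split=> //; rewrite PS big_cons eqxx; congr ((_ * (_ * _))%:E).
  rewrite big_seq [RHS]big_seq; apply: eq_bigr => w wws.
  by case: eqP => // wv; rewrite wv (negbTE vw) in wws.
have [mt Pt] := SE true; have [mf Pf] := SE false.
have E : [set x | f (map (env x) (v :: vs))] `&`
     \bigcap_(w in [set` ws]) (omega w @^-1` [set b w]) = S true `|` S false.
  apply/seteqP; split => x /=.
    move=> [fx cx].
    have h b0 : omega v x = b0 -> S b0 x.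
      move=> vx; split; first by rewrite /= -vx.
      move=> w /=; rewrite inE; case: eqP => [->//|_] /= wws.
      exact: cx.
    by case e : (omega v x); [left|right]; apply: h.
  have h b0 : S b0 x -> f (env x v :: map (env x) vs) /\
       (\bigcap_(w in [set` ws]) (omega w @^-1` [set b w])) x.
    move=> [/= fx cx]; have := cx v; rewrite /= inE eqxx => /(_ isT) vx; split.
      by rewrite /env vx.
    move=> w /= wws; have := cx w; rewrite /= inE wws orbT => /(_ isT).
    by case: eqP => // wv; rewrite wv (negbTE vw) in wws.
  by case=> /h.
cbv zeta; rewrite E; split; first exact: measurableU.
rewrite measureU//; last first.
  apply/seteqP; split => // x [[_ /= h1] [_ /= h2]].
  have := h1 v; have := h2 v; rewrite /= inE eqxx => /(_ isT) -> /(_ isT).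
  by [].
rewrite [X in (X + _)%E]Pt [X in (_ + X)%E]Pf -EFinD; congr EFin.
by rewrite Ex_lpowS Ex_ber /pmfb; ring.
Qed.

(** The only access to the probability space: an event on finitely many sites
has the probability that the finite product law gives it. *)
Lemma family_law (vs : seq site) (f : seq bool -> bool) : uniq vs ->
  measurable [set x | f (map (env x) vs)] /\
  P [set x | f (map (env x) vs)] =
    (Ex (lpow (ber p) (size vs)) (fun l => (f l)%:R))%:E.
Proof.
move=> uv; have := @family_law_cyl vs [::] f (fun=> true); rewrite cats0 => /(_ uv) /=.
have -> : [set` [::]] = set0 :> set site by apply/seteqP; split.
by rewrite bigcap_set0 setIT big_nil mulr1.
Qed.

Lemma family_indep (vs ws : seq site) (f g : seq bool -> bool) : uniq (vs ++ ws) ->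
  P ([set x | f (map (env x) vs)] `&` [set x | g (map (env x) ws)]) =
  (P [set x | f (map (env x) vs)] * P [set x | g (map (env x) ws)])%E.
Proof.
move=> u; have [uv uw] : uniq vs /\ uniq ws by move: u; rewrite cat_uniq => /and3P[].
rewrite (family_law f uv).2 (family_law g uw).2.
have := (@family_law (vs ++ ws)
   (fun l => f (take (size vs) l) && g (drop (size vs) l)) u).2.
rewrite size_cat Ex_lpow_cat => h.
transitivity (P [set x | f (take (size vs) [seq env x i | i <- vs ++ ws]) &&
                        g (drop (size vs) [seq env x i | i <- vs ++ ws])]).
  congr (P _); apply/seteqP; split => x /=;
   by rewrite map_cat take_size_cat ?drop_size_cat ?size_map// => /andP.
rewrite h -EFinM; congr EFin; rewrite -ExZr.
have p0 : nneg_law (ber p) by case/andP: p01 => p0 p1; rewrite /nneg_law /= subr_ge0 !ltW.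
apply: eq_Ex_lpow => // k sk; rewrite -ExZ; apply: eq_Ex => l.
by rewrite take_size_cat// drop_size_cat// -mulnb natrM.
Qed.

Lemma nested_law (vss : seq (seq site)) c (f : seq (seq bool) -> bool) :
  all (fun vs => size vs == c) vss -> uniq (flatten vss) ->
  measurable [set x | f (map (map (env x)) vss)] /\
  P [set x | f (map (map (env x)) vss)] =
    (Ex (lpow (lpow (ber p) c) (size vss)) (fun l => (f l)%:R))%:E.
Proof.
move=> ac uv.
have [] := @family_law (flatten vss) (fun l => f (reshape (nseq (size vss) c) l)) uv.
have sh := shape_nseq ac.
have -> : [set x | f (reshape (nseq (size vss) c) [seq env x i | i <- flatten vss])] =
          [set x | f (map (map (env x)) vss)].
  by apply/seteqP; split => x /=; rewrite map_flatten -sh -(shape_map2 (env x)) flattenK.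
move=> m ->; split=> //; congr EFin.
rewrite size_flatten sh sumn_nseq mulnC.
apply: (@Ex_lpow_reshape _ _ _ c (size vss) (fun l => (f l)%:R)).
by case/andP: p01 => p0 p1; rewrite /nneg_law /= subr_ge0 !ltW.
Qed.

(** Translation invariance comes for free, as the right-hand side does not
depend on the corner. *)
Lemma law_pure a b m n (f : nat -> bool) :
  measurable [set x | f (pure (shift a b (env x)) m n)] /\
  P [set x | f (pure (shift a b (env x)) m n)] = (Elpp p m n (fun k => (f k)%:R))%:E.
Proof.
have [] := @nested_law (rect a b m n) m (fun Ws => f (pure (cfg Ws) m n))
  (size_rect a b m n) (uniq_box a b m n).
rewrite size_map size_iota.
under eq_set => x do rewrite -pure_rect.
by [].
Qed.

(** The columns are disjoint; the rows may overlap. *)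
Lemma indep_pure a b m n a' b' m' n' (f g : nat -> bool) : (a + m <= a')%N ->
  P ([set x | f (pure (shift a b (env x)) m n)] `&`
     [set x | g (pure (shift a' b' (env x)) m' n')]) =
  (Elpp p m n (fun k => (f k)%:R) * Elpp p m' n' (fun k => (g k)%:R))%:E.
Proof.
move=> am; rewrite EFinM -(law_pure a b m n f).2 -(law_pure a' b' m' n' g).2.
have := @family_indep (box a b m n) (box a' b' m' n')
  (fun l => f (pure (cfg (reshape (nseq n m) l)) m n))
  (fun l => g (pure (cfg (reshape (nseq n' m') l)) m' n')).
have E a1 b1 m1 n1 (h : nat -> bool) :
    [set x | h (pure (cfg (reshape (nseq n1 m1) [seq env x i | i <- box a1 b1 m1 n1])) m1 n1)]
    = [set x | h (pure (shift a1 b1 (env x)) m1 n1)].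
  by apply/seteqP; split => x /=; rewrite pure_box.
rewrite !E; apply.
rewrite cat_uniq !uniq_box andbT /=; apply/hasPn => -[x y]; rewrite !mem_box /=.
by move=> /and4P[h _ _ _]; apply/negP => /and4P[_ h' _ _]; lia.
Qed.

End MeasureLink.

(** * The limiting shape *)

Section Shape.
Context {R : realType}.
Variables (p : R) (p01 : 0 < p < 1).

Let ber0 : nneg_law (ber p).
Proof. by case/andP: p01 => p0 p1; rewrite /nneg_law /= subr_ge0 !ltW. Qed.

Let ber_p : prob_law (ber p).
Proof. by apply: prob_ber; have [p0 p1] := andP p01; rewrite !ltW. Qed.

Lemma Elpp_rows m n n' (a : R) : (n' <= n)%N ->
  Elpp p m n (fun l => (l%:R <= a)%R%:R) <= Elpp p m n' (fun l => (l%:R <= a)%R%:R).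
Proof.
move=> /subnKC <-; set k := (n - n')%N; rewrite /Elpp Ex_lpow_cat.
apply: Ex_lpow_size => [|Ws sW]; first exact: nneg_lpow.
apply: Ex_le_cst => [|Ws']; first by do 2 apply: prob_lpow.
apply: ind_le => h; apply: le_trans h; rewrite ler_nat.
apply: (@leq_trans (pure (cfg (Ws ++ Ws')) m n')).
  have -> // : pure (cfg Ws) m n' = pure (cfg (Ws ++ Ws')) m n'.
  by apply: eq_lpp => // i j _ jn; rewrite /cfg /= nth_cat sW jn.
by rewrite pure_mono// leq_addr.
Qed.

(** The stationary mean s u + t v(u) at u = p + w, for the value of t that makes
u critical, see [stat_meanE]. *)
Definition stat_mean (s w : R) := s * (p + 2 * w - w ^+ 2 / (1 - p)).

Lemma stat_meanE s w : 0 < w -> s * (p + w) + (s * w ^+ 2 / (p * (1 - p))) * v_of p (p + w) = stat_mean s w.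
Proof.
move=> w0; have /andP[p0 p1] := p01; rewrite /stat_mean /v_of; field.
by apply/and3P; split; rewrite gt_eqF//; lra.
Qed.

(** Below the critical slope g_pp is the stationary mean at its minimizer. *)
Lemma stat_mean_gpp s t : 0 < s -> 0 < t -> t < s * ((1 - p) / p) ->
  exists w, [/\ 0 < w, w < 1 - p, s * w ^+ 2 / (p * (1 - p)) = t & stat_mean s w = g_pp p s t].
Proof.
move=> s0 t0 ts; have /andP[p0 p1] := p01; have q0 : 0 < 1 - p by lra.
have c0 : 0 < p * (1 - p) by rewrite mulr_gt0.
pose w := Num.sqrt (t * (p * (1 - p)) / s).
have x0 : 0 < t * (p * (1 - p)) / s by rewrite divr_gt0 ?mulr_gt0.
have w0 : 0 < w by rewrite sqrtr_gt0.
have w2 : w ^+ 2 = t * (p * (1 - p)) / s by rewrite sqr_sqrtr// ltW.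
have sw : s * w ^+ 2 = t * (p * (1 - p)) by rewrite w2 mulrC divfK// gt_eqF.
exists w; split=> //.
- rewrite -(@ltr_pXn2r _ 2)// ?nnegrE ?ltW// w2 ltr_pdivrMr//.
  have -> : t * (p * (1 - p)) = (t * p) * (1 - p) by ring.
  have -> : (1 - p) ^+ 2 * s = (s * (1 - p)) * (1 - p) by ring.
  by rewrite ltr_pM2r// -ltr_pdivlMr// -mulrA.
- by rewrite sw mulfK// gt_eqF.
- rewrite /g_pp ts.
  have E : Num.sqrt (p * s) * Num.sqrt ((1 - p) * t) = s * w.
    rewrite -sqrtrM; last by rewrite mulr_ge0// ltW.
    have -> : p * s * ((1 - p) * t) = (s * w) ^+ 2.
      have -> : (s * w) ^+ 2 = s * (s * w ^+ 2) by ring.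
      by rewrite sw; ring.
    by rewrite sqrtr_sqr ger0_norm// mulr_ge0// ltW.
  have e1 : Num.sqrt (p * s) ^+ 2 = p * s by rewrite sqr_sqrtr// mulr_ge0// ltW.
  have e2 : Num.sqrt ((1 - p) * t) ^+ 2 = (1 - p) * t by rewrite sqr_sqrtr// mulr_ge0// ltW.
  rewrite sqrrD e1 e2 -mulr_natl E /stat_mean mulrBr mulrDr [s * (_ / _)]mulrA sw.
  by field; rewrite gt_eqF.
Qed.

Lemma gpp_flat s t : s * ((1 - p) / p) <= t -> g_pp p s t = s.
Proof. by move=> ts; rewrite /g_pp ifF//; apply/negbTE; rewrite -leNgt. Qed.

(** Beyond the critical slope the minimizer would be u = 1, which is excluded;
the height t is lowered to a value whose minimizer is close to 1. *)
Lemma stat_mean_approx s t r : 0 < s -> 0 < t -> r < g_pp p s t ->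
  exists w, [/\ 0 < w, w < 1 - p, s * w ^+ 2 / (p * (1 - p)) <= t & r < stat_mean s w].
Proof.
move=> s0 t0; have /andP[p0 p1] := p01; have q0 : 0 < 1 - p by lra.
have [ts|ts] := ltP t (s * ((1 - p) / p)).
  by have [w [w0 w1 wt <-]] := stat_mean_gpp s0 t0 ts; exists w; split=> //; rewrite wt.
rewrite gpp_flat// => rs.
pose th := Num.min (1 / 2) ((s - r) / (2 * s)).
have th0 : 0 < th by rewrite lt_min; apply/andP; split; rewrite divr_gt0//; lra.
have th1 : th <= 1 / 2 by rewrite ge_min lexx.
have th2 : th * (2 * s) <= s - r.
  by rewrite -ler_pdivlMr ?mulr_gt0// ge_min lexx orbT.
exists ((1 - th) * (1 - p)); split.
- by rewrite mulr_gt0//; lra.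
- by rewrite gtr_pMl//; lra.
- apply: le_trans ts; rewrite exprMn.
  have -> : s * ((1 - th) ^+ 2 * (1 - p) ^+ 2) / (p * (1 - p)) =
    (1 - th) ^+ 2 * (s * ((1 - p) / p)) by field; rewrite !gt_eqF.
  have b0 : 0 <= s * ((1 - p) / p) by rewrite mulr_ge0 ?divr_ge0// ltW.
  by rewrite ler_piMl// exprn_ile1//; lra.
- have -> : stat_mean s ((1 - th) * (1 - p)) = s - (1 - p) * (th * (th * s)).
    by rewrite /stat_mean; field; rewrite gt_eqF.
  have h1 : (1 - p) * (th * (th * s)) < th * (th * s).
    by rewrite gtr_pMl ?mulr_gt0//; lra.
  have h2 : th * (th * s) <= 1 / 2 * (th * s) by rewrite ler_pM2r// mulr_gt0.
  lra.
Qed.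

(** Adding rows increases the passage time, so a lower height is enough. *)
Lemma gpp_lower s t r al : 0 < s -> 0 < t -> r < g_pp p s t -> 0 < al ->
  exists K : R, forall N, K <= N%:R ->
    Elpp p (Num.truncn (N%:R * s)) (Num.truncn (N%:R * t))
      (fun l => (l%:R <= N%:R * r)%R%:R) <= al.
Proof.
move=> s0 t0 rg al0; have /andP[p0 p1] := p01.
have [w [w0 w1 wt rw]] := stat_mean_approx s0 t0 rg.
have c0 : 0 < p * (1 - p) by rewrite mulr_gt0//; lra.
pose t' := s * w ^+ 2 / (p * (1 - p)).
have t'0 : 0 < t' by rewrite divr_gt0// mulr_gt0// exprn_gt0.
have pu : p < p + w by lra.
have u1 : p + w < 1 by lra.
have e0 : 0 < stat_mean s w - r by lra.
have [K H] := lln_lower p01 pu u1 t'0 e0 al0.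
exists K => N /H.
have -> : t' * (p * (1 - p)) / (p + w - p) ^+ 2 = s.
  have -> : p + w - p = w by ring.
  by rewrite /t' divfK ?gt_eqF// mulfK// gt_eqF// exprn_gt0.
rewrite stat_meanE// subKr; apply: le_trans; apply: Elpp_rows.
by apply: le_truncn; rewrite ler_wpM2l.
Qed.

Lemma gpp_upper s t r : 0 < s -> 0 < t -> t < s * ((1 - p) / p) -> g_pp p s t < r ->
  exists2 kap : R, 0 < kap & exists K : R, forall N, K <= N%:R ->
    Elpp p (Num.truncn (N%:R * s)) (Num.truncn (N%:R * t)).+1
      (fun l => (N%:R * r <= l%:R)%R%:R) <= 2 * expR (- (kap * N%:R)).
Proof.
move=> s0 t0 ts gr; have /andP[p0 p1] := p01.
have [w [w0 w1 wt wg]] := stat_mean_gpp s0 t0 ts.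
have pu : p < p + w by lra.
have u1 : p + w < 1 by lra.
pose gap := r - g_pp p s t; have gap0 : 0 < gap by rewrite /gap; lra.
pose e := gap / (4 * (s + t)).
have st0 : 0 < 4 * (s + t) by lra.
have e0 : 0 < e by rewrite divr_gt0.
have eE : e * (4 * (s + t)) = gap by rewrite divfK// gt_eqF.
have [lam lam0 H] := lpp_upper_tail p01 pu u1 e0.
pose v := v_of p (p + w).
have v0 : 0 <= v by rewrite /v /v_of divr_ge0 ?mulr_ge0//; lra.
exists (lam * (gap / 8)); first by rewrite mulr_gt0// divr_gt0.
exists (2 * (v + e) / gap) => N; rewrite ler_pdivrMr// => NK.
have Np : 0 <= N%:R :> R by [].
set m := Num.truncn _; set n := Num.truncn _.
have [m1 _] := truncn_bounds (mulr_ge0 Np (ltW s0)).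
have [n1 _] := truncn_bounds (mulr_ge0 Np (ltW t0)).
rewrite -/m in m1; rewrite -/n in n1.
have := H m n.+1 (gap / 8 * N%:R); rewrite -/v.
rewrite [lam * (gap / 8 * _)]mulrA; apply: le_trans.
apply: Ex_le => [|Ws]; first by do 2 apply: nneg_lpow.
apply: ind_le => h; apply: le_trans h.
have gE : s * (p + w) + t * v = g_pp p s t by rewrite -wg -stat_meanE// wt.
have rE : r = g_pp p s t + gap by rewrite /gap; lra.
rewrite -natr1 rE -gE -eE in NK *.
have h1 : m%:R * (p + w + e) <= N%:R * s * (p + w + e) by rewrite ler_wpM2r//; lra.
have h2 : n%:R * (v + e) <= N%:R * t * (v + e) by rewrite ler_wpM2r//; lra.
lra.
Qed.

Lemma gpp_gt0 s t : 0 < s -> 0 < t -> 0 < g_pp p s t.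
Proof.
move=> s0 t0; have /andP[p0 p1] := p01.
have [ts|ts] := ltP t (s * ((1 - p) / p)); last by rewrite gpp_flat.
have [w [w0 w1 wt <-]] := stat_mean_gpp s0 t0 ts.
rewrite /stat_mean mulr_gt0//.
have : w ^+ 2 / (1 - p) <= w by rewrite ler_pdivrMr ?expr2 ?ler_pM2l; lra.
lra.
Qed.

Lemma gpp_le s t : 0 < s -> 0 < t -> g_pp p s t <= s.
Proof.
move=> s0 t0; have /andP[p0 p1] := p01.
have [ts|ts] := ltP t (s * ((1 - p) / p)); last by rewrite gpp_flat.
have [w [w0 w1 wt <-]] := stat_mean_gpp s0 t0 ts.
have -> : stat_mean s w = s - s * ((1 - p - w) ^+ 2 / (1 - p)).
  by rewrite /stat_mean; field; rewrite gt_eqF//; lra.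
by rewrite gerBl mulr_ge0 ?(ltW s0)// divr_ge0 ?exprn_even_ge0//; lra.
Qed.

End Shape.

(** * Superexponential decay of the left tail *)

Lemma uniq_flatten_map (I T : eqType) (S : I -> seq T) (s : seq I) : uniq s ->
  (forall i, uniq (S i)) ->
  (forall i j x, i \in s -> j \in s -> x \in S i -> x \in S j -> i = j) ->
  uniq (flatten (map S s)).
Proof.
elim: s => //= i s IH /andP[iNs us] uS dS; rewrite cat_uniq uS IH//=; last first.
  by move=> j k x js ks; apply: dS; rewrite inE ?js ?ks orbT.
rewrite andbT; apply/hasPn => x /flatten_mapP[j js xj]; apply/negP => xi.
have e : i = j by apply: (dS i j x) => //; rewrite inE ?eqxx// js orbT.
by rewrite e js in iNs.
Qed.

(** Cells (i + j, i), for i < q, follow each other along a diagonal. *)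
Lemma pure_corridor om m n j q :
  (sumn [seq pure (shift ((i + j) * m) (i * n) om) m n | i <- iota 0 q]
    <= pure om ((q + j) * m) (q * n))%N.
Proof.
elim: q => [|q IH] //.
rewrite -addn1 iotaD map_cat sumn_cat /= addn0 add0n.
have -> : ((q + 1 + j) * m = (q + j) * m + m)%N by lia.
have -> : ((q + 1) * n = q * n + n)%N by lia.
by apply: leq_trans (pure_superadd_cells _ _ _ _ _); rewrite leq_add2r.
Qed.

Lemma nat_le_truncn (R : realType) (a : nat) (x : R) :
  0 <= x -> a%:R <= x -> (a <= Num.truncn x)%N.
Proof. by move=> x0 ax; rewrite truncn_ge_nat. Qed.

Section LeftTail.
Context {R : realType} {d : measure_display} {T : measurableType d}.
Variables (P : probability T R) (p : R) (omega : site -> {RV P >-> bool}).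
Hypotheses (p01 : 0 < p < 1) (iid : iid_bernoulli p omega).

Let ber_p : prob_law (ber p).
Proof. by apply: prob_ber; have [p0 p1] := andP p01; rewrite !ltW. Qed.

Let ber0 : nneg_law (ber p). Proof. by case: ber_p. Qed.

(** The passage time of a cell, as a function of the flat list of its weights. *)
Definition cell_lpp m n (C : seq bool) := pure (cfg (reshape (nseq n m) C)) m n.

(** Each of the l corridors joins the same two corners at a small extra cost, and
they use disjoint cells; if the passage time is at most a then so is the sum
along every corridor. *)
Lemma corridors m n q l (a : R) :
  Elpp p ((q + l) * m) (q * n) (fun k => (k%:R <= a)%R%:R) <=
  Ex (lpow (lpow (ber p) (n * m)) q)
    (fun Cs => (\sum_(C <- Cs) (cell_lpp m n C)%:R <= a)%R%:R) ^+ l.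
Proof.
pose om x := env omega x.
pose cells := [seq [seq box ((i + j) * m) (i * n) m n | i <- iota 0 q] | j <- iota 0 l].
pose good (Cs : seq (seq bool)) := (\sum_(C <- Cs) (cell_lpp m n C)%:R <= a)%R.
have sz : all (fun vs => size vs == n * m)%N (flatten cells).
  by apply/allP => vs /allpairsPdep[j [i [_ _ ->]]]; rewrite size_box.
have szc : size (flatten cells) = (l * q)%N.
  by rewrite size_allpairs !size_iota.
have uq : uniq (flatten (flatten cells)).
  have -> : flatten cells = map (fun c : nat * nat => box ((c.2 + c.1) * m) (c.2 * n) m n)
      [seq (j, i) | j <- iota 0 l, i <- iota 0 q].
    by rewrite map_flatten -map_comp; congr flatten; apply: eq_map => j /=; rewrite -map_comp.
  apply: uniq_flatten_map => [|c|]; last 2 first.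
  - exact: uniq_box.
  - move=> [j i] [j' i'] [x y] _ _; rewrite !mem_box /=.
    move=> /and4P[h1 h2 h3 h4] /and4P[h5 h6 h7 h8].
    have ei : i = i' by nia.
    by rewrite -ei in h5 h6 *; congr pair; nia.
  - by apply: allpairs_uniq; rewrite ?iota_uniq// => -[? ?] [? ?] _ _ /= [-> ->].
have [mE PE] := nested_law p01 iid
  (fun Ls => all good (reshape (nseq l q) Ls)) sz uq.
rewrite szc (@Ex_lpow_reshape _ _ (lpow (ber p) (n * m)) q l
  (fun Ls => (all good Ls)%:R)) in PE; last exact: nneg_lpow.
have -> : Ex (lpow (lpow (ber p) (n * m)) q) (fun Cs => (good Cs)%:R) ^+ l =
    Ex (lpow (lpow (lpow (ber p) (n * m)) q) l) (fun Cs => (all good Cs)%:R).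
  rewrite -Ex_lpow_prod; apply: eq_Ex => Cs.
  by elim: Cs => [|C Cs IH]; rewrite ?big_nil// big_cons IH -natrM mulnb.
rewrite -lee_fin -PE.
have [mL] := law_pure p01 iid 0 0 ((q + l) * m) (q * n) (fun k => (k%:R <= a)%R).
move=> <-; apply: le_measure; rewrite ?inE// => x /=.
rewrite shift0 => le_a.
have -> : map (map (env omega x)) (flatten cells) =
    flatten [seq [seq map (env omega x) (box ((i + j) * m) (i * n) m n) | i <- iota 0 q] | j <- iota 0 l].
  by rewrite map_flatten -map_comp; congr flatten; apply: eq_map => j /=; rewrite -map_comp.
set cc := [seq _ | j <- _].
have -> : nseq l q = shape cc.
  rewrite (@shape_nseq _ _ q) ?size_map ?size_iota//.
  by apply/allP => Cs /mapP[j _ ->]; rewrite size_map size_iota.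
rewrite flattenK; apply/allP => Cs /mapP[j]; rewrite mem_iota add0n /= => jl ->.
rewrite /good big_map; apply: le_trans le_a.
rewrite -natr_sum ler_nat.
apply: (@leq_trans (pure (env omega x) ((q + j) * m) (q * n))); last first.
  by apply: pure_mono => //; rewrite leq_mul2r leq_add2l ltnW ?orbT.
apply: leq_trans (pure_corridor _ _ _ _ _).
rewrite sumnE big_map; apply: leq_sum => i _.
by rewrite pure_box.
Qed.

Lemma Elpp_cols_rows m m' n n' (a : R) : (m' <= m)%N -> (n' <= n)%N ->
  Elpp p m n (fun l => (l%:R <= a)%R%:R) <= Elpp p m' n' (fun l => (l%:R <= a)%R%:R).
Proof.
move=> mm nn; rewrite -lee_fin.
have [m1 <-] := law_pure p01 iid 0 0 m n (fun k => (k%:R <= a)%R).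
have [m2 <-] := law_pure p01 iid 0 0 m' n' (fun k => (k%:R <= a)%R).
apply: le_measure; rewrite ?inE// => x /=.
by rewrite shift0 => h; apply: le_trans h; rewrite ler_nat pure_mono.
Qed.

(** The cell size is fixed first, so that the mean of one cell exceeds k r; this
fixes the exponential rate of one corridor. The number l of corridors is chosen
afterwards and multiplies that rate, while it only removes l cells from the
length of each corridor. *)
Lemma left_tail s t r M : 0 < s -> 0 < t -> r < g_pp p s t ->
  exists K : R, forall N, K <= N%:R ->
    Elpp p (Num.truncn (N%:R * s)) (Num.truncn (N%:R * t)).+1
      (fun l => (l%:R <= N%:R * r)%R%:R) <= expR (- (M * N%:R)).
Proof.
move=> s0 t0 rg; have g0 := gpp_gt0 p01 s0 t0.
wlog r0 : r rg / 0 <= r.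
  move=> H; have rg' : Num.max r 0 < g_pp p s t by rewrite gt_max rg.
  have m0 : 0 <= Num.max r 0 by rewrite le_max lexx orbT.
  have [K HK] := H _ rg' m0; exists K => N /HK; apply: le_trans.
  apply: Ex_le => [|Ws]; first by do 2 apply: nneg_lpow.
  by apply: ind_le => h; apply: le_trans h _; rewrite ler_wpM2l// le_max lexx.
pose r1 := (r + g_pp p s t) / 2; pose r2 := (r1 + r) / 2; pose r3 := (r2 + r) / 2.
have rr1 : r < r1 by rewrite /r1; lra.
have r1g : r1 < g_pp p s t by rewrite /r1; lra.
have r10 : 0 < r1 by lra.
(* al is such that r1 (1 - al) = r2 is still larger than r. *)
pose al := (r1 - r) / (2 * r1).
have al0 : 0 < al by rewrite divr_gt0 ?mulr_gt0//; lra.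
have alE : al * (2 * r1) = r1 - r by rewrite divfK// gt_eqF// mulr_gt0.
have [K1 HK1] := gpp_lower p01 s0 t0 r1g al0.
(* The cell has floor(k s) columns and floor(k t) rows, both positive. *)
pose k := (Num.truncn (Num.max 1 (Num.max K1 (Num.max (1 / s) (1 / t))))).+1.
have kK : Num.max 1 (Num.max K1 (Num.max (1 / s) (1 / t))) <= k%:R :> R.
  by rewrite ltW// /k truncnS_gt.
move: kK; rewrite !ge_max => /and4P[k1 kK1 ks kt].
rewrite ler_pdivrMr// in ks; rewrite ler_pdivrMr// in kt.
set m := Num.truncn (k%:R * s); set n := Num.truncn (k%:R * t).
have k0 : 0 < k%:R :> R by lra.
have m0 : (0 < m)%N by rewrite truncn_gt0.
have n0 : (0 < n)%N by rewrite truncn_gt0.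
have [m1 _] := truncn_bounds (mulr_ge0 (ltW k0) (ltW s0)).
have [n1 _] := truncn_bounds (mulr_ge0 (ltW k0) (ltW t0)).
rewrite -/m in m1; rewrite -/n in n1.
pose mu := lpow (ber p) (n * m).
have mup : prob_law mu by exact: prob_lpow.
have muE (f : nat -> R) : Ex mu (fun C => f (cell_lpp m n C)) = Elpp p m n f.
  by rewrite /mu /Elpp /cell_lpp -(Ex_lpow_reshape m n (fun Ws => f (pure (cfg Ws) m n))).
have EX : k%:R * r2 <= Ex mu (fun C => (cell_lpp m n C)%:R).
  rewrite (muE (fun l => l%:R)).
  have h := HK1 k kK1; rewrite -/m -/n in h.
  apply: (@le_trans _ _ (Elpp p m n (fun l => k%:R * r1 + (- (k%:R * r1)) * (l%:R <= k%:R * r1)%R%:R))).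
    rewrite /Elpp Ex_affine; last by do 2 apply: prob_lpow.
    rewrite /Elpp in h.
    have h' : k%:R * r1 * Ex (lpow (lpow (ber p) m) n)
        (fun Ws => ((pure (cfg Ws) m n)%:R <= k%:R * r1)%R%:R) <= k%:R * r1 * al.
      by rewrite ler_wpM2l// mulr_ge0// ltW.
    have e : k%:R * r2 = k%:R * r1 - k%:R * r1 * al.
      have -> : k%:R * r1 * al = k%:R * (al * (2 * r1)) / 2 by field.
      by rewrite alE /r2; field.
    by rewrite e mulNr; lra.
  apply: Ex_le => [|Ws]; first by do 2 apply: nneg_lpow.
  case: (leP (pure _ _ _)%:R) => h1; last by rewrite mulr0 addr0 ltW.
  by rewrite mulr1 subrr.
pose B := m%:R : R; have B0 : 0 < B by rewrite ltr0n.
have r23 : r < r3 by rewrite /r3 /r2; lra.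
have r32 : r3 < r2 by rewrite /r3 /r2; lra.
pose lam := Num.min (1 / 3 / B) (k%:R * (r2 - r3) / B ^+ 2).
have lam0 : 0 < lam.
  rewrite lt_min; apply/andP; split; first by rewrite !divr_gt0.
  by rewrite divr_gt0 ?exprn_gt0// mulr_gt0//; lra.
have lam1 : lam * B <= 1 / 3 by rewrite -ler_pdivlMr// ge_min lexx.
have lam2 : lam * B ^+ 2 <= k%:R * (r2 - r3).
  by rewrite -ler_pdivlMr ?exprn_gt0// ge_min lexx orbT.
have mgf : Ex mu (fun C => expR (lam * - (cell_lpp m n C)%:R)) <= expR (lam * - (k%:R * r3)).
  apply: le_trans (@mgf_bounded _ _ mu (fun C => - (cell_lpp m n C)%:R) B
    (- (k%:R * r2)) lam mup B0 _ _ lam0 lam1) _.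
  - by move=> C; rewrite normrN ger0_norm// ler_nat pure_le.
  - under eq_Ex => C do rewrite -mulN1r.
    by rewrite ExZ mulN1r lerN2.
  - by rewrite ler_expR ler_pM2l//; lra.
have cher q a : Ex (lpow mu q) (fun Cs => (\sum_(C <- Cs) (cell_lpp m n C)%:R <= a)%R%:R)
    <= expR (- (lam * (q%:R * (k%:R * r3) - a))).
  have := @chernoff _ _ mu q (fun C => - (cell_lpp m n C)%:R) lam (- (k%:R * r3)) (- a)
    (proj1 mup) lam0 mgf.
  under eq_Ex => Cs do rewrite sumrN lerN2.
  by have -> : - a - q%:R * - (k%:R * r3) = q%:R * (k%:R * r3) - a by ring.
pose c := lam * (r3 - r) / 4.
have c0 : 0 < c by rewrite /c divr_gt0// mulr_gt0//; lra.
(* With l corridors the exponent is at least l * c * N, which exceeds M * N. *)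
pose l := (Num.truncn (Num.max 0 (M / c))).+1.
have lM : M <= l%:R * c.
  rewrite -ler_pdivrMr//.
  have : Num.max 0 (M / c) <= l%:R by rewrite ltW// /l truncnS_gt.
  by rewrite ge_max => /andP[].
pose K2 := 2 * k%:R * (l.+1%:R + 1) + k%:R * l.+1%:R * (4 * r / (r3 - r) + 4).
exists K2 => N NK.
pose q := (N %/ k - l)%N.
have rd : 0 < r3 - r by lra.
have K20 : 0 <= 4 * r / (r3 - r) by rewrite divr_ge0//; [lra|exact: ltW].
have kl : (k * l.+1 <= N)%N.
  rewrite -(@ler_nat R) natrM; apply: le_trans NK; rewrite /K2.
  have : 0 <= k%:R * l.+1%:R * (4 * r / (r3 - r)).
    by apply: mulr_ge0 K20; rewrite mulr_ge0.
  have : 0 <= k%:R * (l.+1%:R : R) by rewrite mulr_ge0.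
  by move=> *; lra.
have kN : (k * (q + l) <= N)%N.
  have : (l <= N %/ k)%N by rewrite leq_divRL// mulnC (leq_trans _ kl)// leq_mul2l leqnSn orbT.
  by move=> h; rewrite /q subnK// mulnC leq_divM.
have Nk : (N <= k * (q + l).+1)%N.
  have : (l <= N %/ k)%N by rewrite leq_divRL// mulnC (leq_trans _ kl)// leq_mul2l leqnSn orbT.
  by move=> h; rewrite /q subnK// mulnC ltnW// ltn_ceil.
apply: le_trans (Elpp_cols_rows (m' := (q + l) * m) (n' := q * n) _ _ _) _.
- apply: nat_le_truncn; first by rewrite mulr_ge0// ltW.
  apply: (@le_trans _ _ ((k * (q + l))%:R * s)).
    by rewrite [(k * _)%N]mulnC !natrM -mulrA ler_wpM2l.
  by rewrite ler_wpM2r ?ler_nat// ltW.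
- apply: leqW; apply: nat_le_truncn; first by rewrite mulr_ge0// ltW.
  apply: (@le_trans _ _ ((k * q)%:R * t)).
    by rewrite [(k * _)%N]mulnC !natrM -mulrA ler_wpM2l.
  rewrite ler_wpM2r ?(ltW t0)// ler_nat (leq_trans _ kN)//.
  by rewrite leq_mul2l leq_addr orbT.
apply: le_trans (corridors _ _ _ _ _) _.
apply: (@le_trans _ _ (expR (- (lam * (q%:R * (k%:R * r3) - N%:R * r))) ^+ l)).
  apply: lerXn2r (cher q _); rewrite ?nnegrE ?expR_ge0//.
  by apply: Ex_ge0 => [|Cs]; [do 2 apply: nneg_lpow|case/andP: (ind_bounds R (\sum_(C <- Cs) (cell_lpp m n C)%:R <= N%:R * r))].
rewrite -expRM_natl ler_expR.
have Nk' : N%:R <= k%:R * (q%:R + l%:R + 1) :> R by rewrite -natrD natr1 -natrM ler_nat.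
have key : N%:R * (r3 - r) / 4 <= q%:R * (k%:R * r3) - N%:R * r.
  have hr : 4 * r / (r3 - r) * (r3 - r) = 4 * r by rewrite divfK// gt_eqF.
  have h1 : K2 * (r3 - r) <= N%:R * (r3 - r) by rewrite ler_pM2r.
  have h2 : (N%:R - k%:R * (l%:R + 1)) * r3 <= k%:R * q%:R * r3.
    by rewrite ler_wpM2r// ?(le_trans r0 (ltW r23))//; move: Nk'; clear; lra.
  have h3 : 0 <= k%:R * (r3 - r) by rewrite mulr_ge0// ltW.
  have h4 : 0 <= k%:R * l%:R * (r3 - r) by rewrite !mulr_ge0// ltW.
  move: h1 hr; rewrite /K2 -[l.+1%:R]natr1; move: (4 * r / _) => A h1 hr.
  have h5 : k%:R * (l%:R + 1) * (A * (r3 - r)) = k%:R * (l%:R + 1) * (4 * r) by rewrite hr.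
  have h6 : 0 <= k%:R * l%:R * r by rewrite !mulr_ge0.
  have h7 : 0 <= k%:R * r by rewrite mulr_ge0.
  by move: h1 h2 h3 h4 h5 h6 h7; clear; lra.
have : l%:R * (lam * (N%:R * (r3 - r) / 4)) <= l%:R * (lam * (q%:R * (k%:R * r3) - N%:R * r)).
  by rewrite ler_wpM2l// ler_pM2l.
have : M * N%:R <= l%:R * c * N%:R by rewrite ler_wpM2r.
by rewrite /c; clear; lra.
Qed.

End LeftTail.

(** * The rate function of a supermultiplicative family of tails *)

Lemma expR_eventually_le (R : realType) (a b : R) (K : nat) :
  (forall N, (K <= N)%N -> expR (- (N%:R * b)) <= 2 * expR (- (N%:R * a))) -> a <= b.
Proof.
move=> h; rewrite leNgt; apply/negP => ba.
pose N := (K + (Num.truncn (1 / (a - b))).+1)%N.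
have d0 : 0 < a - b by lra.
have NK : 1 < N%:R * (a - b).
  rewrite -ltr_pdivrMr//; apply: (lt_le_trans (truncnS_gt _)).
  by rewrite ler_nat leq_addl.
have := h N (leq_addr _ _).
rewrite leNgt => /negP; apply.
have -> : - (N%:R * b) = - (N%:R * a) + N%:R * (a - b) by ring.
rewrite expRD mulrC ltr_pM2l ?expR_gt0//.
by apply: lt_le_trans (expR_ge1Dx _); lra.
Qed.

(** What the rate function uses of the tails q N a = P(G_N >= a): monotonicity
and supermultiplicativity, a lower bound by the probability that a whole row is
open (L = - ln p), and the two sides of the law of large numbers at g. *)
Record upper_tails (R : realType) (q : nat -> R -> R) (s L g : R) : Prop := UpperTails {
  tails_s_gt0 : 0 < s;
  tails_L_ge0 : 0 <= L;
  tails_ge0 : forall N a, 0 <= q N a;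
  tails_le1 : forall N a, q N a <= 1;
  tails_anti : forall N a b, a <= b -> q N b <= q N a;
  tails_super : forall N M a b, q N a * q M b <= q (N + M)%N (a + b);
  tails_lower : forall N a, a <= N%:R * s - 1 -> expR (- (N%:R * (s * L))) <= q N a;
  tails_g_le : g <= s;
  tails_below : forall r, r < g ->
    exists K : nat, forall N, (K <= N)%N -> 1 / 2 <= q N (N%:R * r);
  tails_above : forall r, g < r -> r < s -> exists2 k, 0 < k &
    exists K : nat, forall N, (K <= N)%N -> q N (N%:R * r) <= 2 * expR (- (N%:R * k))
}.

Section Rate.
Context {R : realType}.
Variables (q : nat -> R -> R) (s L g : R).
Hypothesis tails : upper_tails q s L g.

Let s0 : 0 < s. Proof. exact: tails_s_gt0 tails. Qed.
Let L0 : 0 <= L. Proof. exact: tails_L_ge0 tails. Qed.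
Let q_ge0 : forall N a, 0 <= q N a. Proof. exact: tails_ge0 tails. Qed.
Let q_le1 : forall N a, q N a <= 1. Proof. exact: tails_le1 tails. Qed.
Let q_anti := tails_anti tails.
Let q_super := tails_super tails.
Let q_lower := tails_lower tails.
Let gs : g <= s. Proof. exact: tails_g_le tails. Qed.
Let q_low := tails_below tails.
Let q_up := tails_above tails.

(** Small N are excluded when the threshold N r exceeds the largest value of G_N,
where the probability vanishes. *)
Definition ratios (r : R) : set R :=
  [set x | exists N, [/\ (0 < N)%N, 0 < q N (N%:R * r) & x = - ln (q N (N%:R * r)) / N%:R]].

Definition J r := inf (ratios r).

Lemma q_pos r N : 1 <= N%:R * (s - r) -> 0 < q N (N%:R * r).
Proof. by move=> h; apply: lt_le_trans (q_lower _); [exact: expR_gt0|lra]. Qed.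

Definition first_index r := (Num.truncn (1 / (s - r))).+1.

Lemma first_indexP r N : r < s -> (first_index r <= N)%N -> 1 <= N%:R * (s - r).
Proof.
move=> rs h; rewrite -ler_pdivrMr ?subr_gt0//; apply: (le_trans (ltW (truncnS_gt _))).
by rewrite ler_nat.
Qed.

Lemma ratios_ge0 r : lbound (ratios r) 0.
Proof.
by move=> _ [N [N0 q0 ->]]; rewrite divr_ge0// oppr_ge0 ln_le0.
Qed.

Lemma has_inf_ratios r : r < s -> has_inf (ratios r).
Proof.
move=> rs; split; last by exists 0; exact: ratios_ge0.
exists (- ln (q (first_index r) ((first_index r)%:R * r)) / (first_index r)%:R), (first_index r); split=> //.
by apply: q_pos; apply: first_indexP.
Qed.

Lemma J_ge0 r : r < s -> 0 <= J r.
Proof. by move=> rs; apply: lb_le_inf; [case: (has_inf_ratios rs)|exact: ratios_ge0]. Qed.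

(** The infimum in the definition of J bounds every term, with no error. *)
Lemma q_le_J r N : r < s -> q N (N%:R * r) <= expR (- (N%:R * J r)).
Proof.
move=> rs; case: N => [|N]; first by rewrite !mul0r oppr0 expR0.
have [q0|] := ltP 0 (q N.+1 (N.+1%:R * r)); last first.
  by move=> h; apply: le_trans h _; exact: expR_ge0.
rewrite -[leLHS]lnK ?posrE// ler_expR lerNr.
rewrite mulrC -ler_pdivlMr//; apply: ge_inf; first by exists 0; exact: ratios_ge0.
by exists N.+1.
Qed.

Lemma q_iter r k b a :
  q k (k%:R * r) ^+ a * q b (b%:R * r) <= q (a * k + b) ((a * k + b)%:R * r).
Proof.
elim: a => [|a IH]; first by rewrite expr0 mul1r mul0n add0n.
rewrite exprS mulSn -addnA natrD mulrDl -mulrA.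
by apply: le_trans (q_super _ _ _ _); rewrite ler_wpM2l.
Qed.

(** Fekete's lemma: N is divided by an almost optimal k, and the remainder is
kept between [first_index] and [first_index] + k so that its factor is positive. *)
Lemma q_ge_J r eps : r < s -> 0 < eps -> exists K, forall N, (K <= N)%N ->
  expR (- (N%:R * (J r + eps))) <= q N (N%:R * r).
Proof.
move=> rs eps0; have J0 := J_ge0 rs.
have [_ [k [k0 qk ->]] hk] := inf_adherent (divr_gt0 eps0 (ltr0n R 2)) (has_inf_ratios rs).
have kp : 0 < k%:R :> R by rewrite ltr0n.
have {hk} qkJ : expR (- (k%:R * (J r + eps / 2))) <= q k (k%:R * r).
  move: hk; rewrite ltr_pdivrMr// ltrNl => /ltW hk.
  by rewrite -[leRHS]lnK ?posrE// ler_expR mulrC.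
(* N = a k + b with n0 <= b < n0 + k. *)
pose n0 := first_index r.
pose B := (n0 + k)%:R * (s * L).
have B0 : 0 <= B by rewrite /B mulr_ge0// mulr_ge0// ltW.
exists (n0 + (Num.truncn (B * 2 / eps)).+1)%N => N NK.
have NB : B <= N%:R * eps / 2.
  have : B * 2 / eps <= N%:R.
    apply: (le_trans (ltW (truncnS_gt _))).
    by rewrite ler_nat (leq_trans _ NK)// leq_addl.
  by rewrite ler_pdivrMr//; lra.
have n0N : (n0 <= N)%N by rewrite (leq_trans _ NK)// leq_addr.
pose a := ((N - n0) %/ k)%N; pose b := (n0 + (N - n0) %% k)%N.
have NE : N = (a * k + b)%N by rewrite /b addnCA /a -divn_eq subnKC.
have bk : (b <= n0 + k)%N by rewrite /b leq_add2l ltnW// ltn_mod.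
have qb : expR (- B) <= q b (b%:R * r).
  apply: le_trans (q_lower _).
    by rewrite ler_expR lerN2 ler_wpM2r ?ler_nat// mulr_ge0// ltW.
  have := @first_indexP r b rs (leq_addr _ _); lra.
rewrite [in leRHS]NE; apply: le_trans (q_iter _ _ _ _).
apply: (@le_trans _ _ (expR (- (k%:R * (J r + eps / 2))) ^+ a * expR (- B))).
  rewrite -expRM_natl -expRD ler_expR.
  have h : (a * k)%:R * (J r + eps / 2) <= N%:R * (J r + eps / 2).
    by rewrite ler_wpM2r// ?ler_nat ?NE ?leq_addr//; lra.
  by rewrite natrM in h; lra.
apply: ler_pM; rewrite ?exprn_ge0 ?expR_ge0//.
by apply: lerXn2r; rewrite ?nnegrE ?expR_ge0.
Qed.

Lemma J_le_of r c : r < s -> (forall eps, 0 < eps -> exists K : nat,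
   forall N, (K <= N)%N -> expR (- (N%:R * (c + eps))) <= q N (N%:R * r)) -> J r <= c.
Proof.
move=> rs h; apply/ler_addgt0Pr => e e0; have [K HK] := h _ e0.
apply: (@expR_eventually_le _ _ _ K) => N /HK /le_trans; apply.
apply: le_trans (q_le_J N rs) _.
by rewrite ler_peMl ?expR_ge0// ler1n.
Qed.

Lemma J_mono r r' : r <= r' -> r' < s -> J r <= J r'.
Proof.
move=> rr rs; apply: J_le_of; first exact: le_lt_trans rs.
move=> e e0; have [K HK] := q_ge_J rs e0; exists K => N /HK /le_trans; apply.
by apply: q_anti; rewrite ler_wpM2l.
Qed.

Lemma J_le_sL r : r < s -> J r <= s * L.
Proof.
move=> rs; apply: J_le_of => // e e0; exists (first_index r) => N h.
apply: le_trans (q_lower _).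
  by rewrite ler_expR lerN2 ler_wpM2l//; lra.
have := first_indexP rs h; lra.
Qed.

(** The smaller threshold is used for the first floor(l N) units, so that rounding
only increases the total threshold. *)
Lemma J_convex_le r1 r2 l : r1 <= r2 -> r2 < s -> 0 < l < 1 ->
  J (l * r1 + (1 - l) * r2) <= l * J r1 + (1 - l) * J r2.
Proof.
move=> r12 r2s /andP[l0 l1]; set r := _ + _.
have r1s := le_lt_trans r12 r2s.
have rs : r < s.
  have h : l * r1 <= l * r2 by rewrite ler_pM2l.
  by rewrite /r; lra.
have J20 := J_ge0 r2s; have J10 := J_ge0 r1s.
apply: J_le_of => // e e0.
have e20 : 0 < e / 2 by rewrite divr_gt0.
have [K1 HK1] := q_ge_J r1s e20; have [K2 HK2] := q_ge_J r2s e20.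
pose C := J r2 + e / 2.
exists ((Num.truncn (K1%:R / l)).+1 + ((Num.truncn (K2%:R / (1 - l))).+1 + (Num.truncn (2 * C / e)).+1))%N => N NK.
have N1 : K1%:R <= N%:R * l.
  rewrite -ler_pdivrMr//; apply: (le_trans (ltW (truncnS_gt _))).
  by rewrite ler_nat (leq_trans _ NK)// leq_addr.
have N2 : K2%:R <= N%:R * (1 - l).
  rewrite -ler_pdivrMr ?subr_gt0//; apply: (le_trans (ltW (truncnS_gt _))).
  by rewrite ler_nat (leq_trans _ NK)// addnCA leq_addr.
have N3 : 2 * C <= N%:R * e.
  rewrite -ler_pdivrMr//; apply: (le_trans (ltW (truncnS_gt _))).
  by rewrite ler_nat (leq_trans _ NK)// addnA leq_addl.
have Np : 0 <= N%:R :> R by [].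
have Nl0 : 0 <= N%:R * l by rewrite mulr_ge0// ltW.
pose a := Num.truncn (N%:R * l).
have /andP[a1 a2] := truncn_itv Nl0; rewrite -/a in a1 a2.
have aN : (a <= N)%N by rewrite -(@ler_nat R) (le_trans a1)// ler_piMr// ltW.
pose b := (N - a)%N; have bE : b%:R = N%:R - a%:R :> R by rewrite natrB.
have aK : (K1 <= a)%N by rewrite /a truncn_ge_nat.
have bK : (K2 <= b)%N by rewrite -(@ler_nat R) bE; lra.
have NE : N = (a + b)%N by rewrite subnKC.
apply: (@le_trans _ _ (q a (a%:R * r1) * q b (b%:R * r2))); last first.
  apply: le_trans (q_super _ _ _ _) _; rewrite -NE; apply: q_anti.
  have h : 0 <= (N%:R * l - a%:R) * (r2 - r1) by rewrite mulr_ge0// subr_ge0.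
  by rewrite bE /r; lra.
apply: le_trans (ler_pM _ _ (HK1 _ aK) (HK2 _ bK)); rewrite ?expR_ge0//.
rewrite -expRD ler_expR bE.
have ha : a%:R * (J r1 + e / 2) <= N%:R * l * (J r1 + e / 2) by rewrite ler_wpM2r//; lra.
have hb : (N%:R - a%:R) * (J r2 + e / 2) <= (N%:R * (1 - l) + 1) * (J r2 + e / 2).
  by rewrite ler_wpM2r//; [lra|rewrite -natr1 in a2; lra].
rewrite /C in N3; lra.
Qed.

Lemma J_convex r1 r2 l : r1 < s -> r2 < s -> 0 <= l <= 1 ->
  J (l * r1 + (1 - l) * r2) <= l * J r1 + (1 - l) * J r2.
Proof.
move=> r1s r2s /andP[]; rewrite le_eqVlt => /orP[/eqP<- _|l0].
  by rewrite subr0 !mul0r !add0r !mul1r.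
rewrite le_eqVlt => /orP[/eqP->|l1]; first by rewrite subrr !mul0r !addr0 !mul1r.
have [r12|/ltW r21] := leP r1 r2; first by apply: J_convex_le; rewrite ?l0.
have := @J_convex_le r2 r1 (1 - l) r21 r1s.
have -> : 1 - (1 - l) = l by ring.
move=> h; rewrite [X in J X]addrC [leRHS]addrC; apply: h.
by apply/andP; split; lra.
Qed.

(** Convexity with the endpoint r1, together with monotonicity, bounds the slopes
on both sides of r by J r1 / (r1 - r). *)
Lemma J_lipschitz r r1 r' : r < r1 -> r1 < s -> r' <= r1 ->
  (r1 - r) * `|J r - J r'| <= `|r - r'| * J r1.
Proof.
move=> rr1 r1s r'r1; have rs := lt_trans rr1 r1s.
have J1 := J_ge0 r1s.
have key x y : x <= y -> y < r1 -> (r1 - x) * J y <= (r1 - y) * J x + (y - x) * J r1.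
  move=> xy yr1; have d0 : 0 < r1 - x by lra.
  have := @J_convex x r1 ((r1 - y) / (r1 - x)) _ r1s.
  have -> : (r1 - y) / (r1 - x) * x + (1 - (r1 - y) / (r1 - x)) * r1 = y by field; rewrite gt_eqF.
  move=> /(_ (le_lt_trans xy (lt_trans yr1 r1s))) h.
  have /h {}h : 0 <= (r1 - y) / (r1 - x) <= 1.
    apply/andP; split; first by rewrite divr_ge0// ltW// subr_gt0.
    by rewrite ler_pdivrMr// mul1r; lra.
  have := ler_wpM2l (ltW d0) h; rewrite le_eqVlt => /orP[/eqP|] hh.
    rewrite hh le_eqVlt; apply/orP; left; apply/eqP; field; by rewrite gt_eqF.
  apply: (le_trans (ltW hh)); rewrite le_eqVlt; apply/orP; left; apply/eqP.
  by field; rewrite gt_eqF.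
have [rr'|r'r] := leP r r'.
  have m : J r <= J r' by apply: J_mono => //; exact: le_lt_trans r1s.
  rewrite ler0_norm ?subr_le0// [`|r - r'|]ler0_norm ?subr_le0//.
  move: r'r1; rewrite le_eqVlt => /orP[/eqP ->|r'r1].
    have := J_ge0 rs; nra.
  have := key r r' rr' r'r1; have J0 := J_ge0 rs.
  have h : 0 <= (r' - r) * J r by rewrite mulr_ge0// subr_ge0.
  by move: h; lra.
have m : J r' <= J r by apply: J_mono => //; exact: ltW.
rewrite ger0_norm ?subr_ge0// [`|r - r'|]ger0_norm ?subr_ge0//; last exact: ltW.
have r's : r' < s by exact: lt_trans rs.
have := key r' r (ltW r'r) rr1; have J0 := J_ge0 r's.
have h : 0 <= (r - r') * (J r) by rewrite mulr_ge0 ?subr_ge0 ?(ltW r'r)// J_ge0.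
by move: h; lra.
Qed.

Lemma J_cont r e : r < s -> 0 < e -> exists2 del, 0 < del &
  forall r', `|r - r'| < del -> r' < s /\ `|J r - J r'| <= e.
Proof.
move=> rs e0; pose r1 := (r + s) / 2.
have rr1 : r < r1 by rewrite /r1; lra.
have r1s : r1 < s by rewrite /r1; lra.
have J1 := J_ge0 r1s.
have d0 : 0 < r1 - r by lra.
exists (Num.min (r1 - r) ((r1 - r) * e / (J r1 + 1))).
  by rewrite lt_min d0 divr_gt0 ?mulr_gt0//; lra.
move=> r'; rewrite lt_min => /andP[h1 h2].
have r'r1 : r' < r1 by move: h1; rewrite ltr_norml => /andP[]; lra.
split; first exact: lt_trans r1s.
have := J_lipschitz rr1 r1s (ltW r'r1).
rewrite ltr_pdivlMr in h2; last by lra.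
move=> h; rewrite -(ler_pM2l d0); apply: (le_trans h).
apply: le_trans (ltW h2); rewrite ler_wpM2l//; lra.
Qed.

Definition Js := sup [set J r | r in [set r | r < s]].

Lemma has_sup_J : has_sup [set J r | r in [set r | r < s]].
Proof.
split; first by exists (J (s - 1)), (s - 1) => //=; lra.
by exists (s * L) => _ [r /= rs <-]; exact: J_le_sL.
Qed.

Lemma J_le_Js r : r < s -> J r <= Js.
Proof. by move=> rs; apply: sup_upper_bound; [exact: has_sup_J|exists r]. Qed.

Lemma Js_approx e : 0 < e -> exists2 r, r < s & forall r', r <= r' -> r' < s -> Js - e < J r'.
Proof.
move=> e0; have [_ [r /= rs <-] h] := sup_adherent e0 has_sup_J.
by exists r => // r' rr' r's; apply: lt_le_trans h _; exact: J_mono.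
Qed.

(** The constant value beyond s makes it continuous on the whole line. *)
Definition Jbar r := if r < s then J r else Js.

Lemma Jbar_lt r : r < s -> Jbar r = J r. Proof. by rewrite /Jbar => ->. Qed.

Lemma Jbar_s : Jbar s = Js. Proof. by rewrite /Jbar ltxx. Qed.

Lemma J_le_Jbar r del : r <= s -> 0 < del -> J (r - del) <= Jbar r.
Proof.
rewrite le_eqVlt => /orP[/eqP ->|rs] d0; first by rewrite Jbar_s J_le_Js//; lra.
by rewrite Jbar_lt//; apply: J_mono => //; lra.
Qed.

(** Values at s are approached from below; this lets statements about J be
passed to [Jbar] by a shift. *)
Lemma Jbar_approx r e : r <= s -> 0 < e -> exists2 del, 0 < del & Jbar r - e <= J (r - del).
Proof.
rewrite le_eqVlt => /orP[/eqP ->|rs] e0.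
  have [r1 r1s h] := Js_approx e0; exists (s - r1); first by lra.
  have -> : s - (s - r1) = r1 by ring.
  by rewrite Jbar_s ltW// h.
have [d d0 h] := J_cont rs e0; exists (d / 2); first lra.
have [|_] := h (r - d / 2); first by rewrite opprB addrC subrK ger0_norm; lra.
by rewrite Jbar_lt// ler_norml => /andP[]; lra.
Qed.

Lemma Jbar_convex x y l : x <= s -> y <= s -> 0 <= l <= 1 ->
  Jbar (l * x + (1 - l) * y) <= l * Jbar x + (1 - l) * Jbar y.
Proof.
move=> xs ys /[dup] l01 /andP[l0 l1]; set z := _ + _.
have zs : z <= s.
  have := ler_wpM2l l0 xs; have l1' : 0 <= 1 - l by lra.
  by have := ler_wpM2l l1' ys; rewrite /z; lra.
apply/ler_addgt0Pr => e e0; have [del d0 h] := Jbar_approx zs e0.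
rewrite -lerBlDr; apply: (le_trans h).
have -> : z - del = l * (x - del) + (1 - l) * (y - del) by rewrite /z; ring.
apply: le_trans (J_convex _ _ l01) _; [lra|lra|].
by apply: lerD; apply: ler_wpM2l => //; [exact: J_le_Jbar|lra|exact: J_le_Jbar].
Qed.

Lemma J_below r : r < g -> J r = 0.
Proof.
move=> rg; have rs := lt_le_trans rg gs.
apply/eqP; rewrite eq_le J_ge0// andbT.
have [K HK] := q_low rg; apply: (@expR_eventually_le _ _ _ K) => N /HK h.
rewrite mulr0 oppr0 expR0; have := q_le_J N rs; lra.
Qed.

Lemma J_above r : g < r -> r < s -> 0 < J r.
Proof.
move=> gr rs; have [k k0 [K HK]] := q_up gr rs.
apply: lt_le_trans k0 _; apply/ler_addgt0Pr => e e0.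
have [K' HK'] := q_ge_J rs e0.
apply: (@expR_eventually_le _ _ _ (K + K')) => N NK.
have /HK' h1 : (K' <= N)%N by rewrite (leq_trans _ NK)// leq_addl.
have /HK h2 : (K <= N)%N by rewrite (leq_trans _ NK)// leq_addr.
exact: le_trans h1 h2.
Qed.

Lemma Jbar_g : Jbar g = 0.
Proof.
apply/eqP; rewrite eq_le; apply/andP; split.
  apply/ler_addgt0Pr => e e0; have [del d0 h] := Jbar_approx gs e0.
  by rewrite J_below in h; lra.
have h : g - 1 < g by lra.
by rewrite -(J_below h); exact: J_le_Jbar.
Qed.

(** A convex function that vanishes at g and is positive beyond g. *)
Lemma Jbar_strict r1 r2 : g <= r1 -> r1 < r2 -> r2 <= s -> Jbar r1 < Jbar r2.
Proof.
move=> gr1 r12 r2s; have r1s := lt_le_trans r12 r2s.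
have key y : r1 < y -> y < s -> J r1 < J y.
  move=> r1y ys; have gy := le_lt_trans gr1 r1y; have Jy := J_above gy ys.
  have gs' := lt_trans gy ys.
  have Jg : J g = 0 by rewrite -Jbar_lt// Jbar_g.
  have d0 : 0 < y - g by lra.
  have := @J_convex g y ((y - r1) / (y - g)) gs' ys.
  have -> : (y - r1) / (y - g) * g + (1 - (y - r1) / (y - g)) * y = r1 by field; rewrite gt_eqF.
  rewrite Jg mulr0 add0r => h; apply: (le_lt_trans (h _)).
    apply/andP; split; first by rewrite divr_ge0// ltW// subr_gt0.
    by rewrite ler_pdivrMr// mul1r; lra.
  by rewrite gtr_pMl// gtrBl divr_gt0// subr_gt0.
rewrite Jbar_lt//; pose y := (r1 + r2) / 2.
have r1y : r1 < y by rewrite /y; lra.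
have ys : y < s by rewrite /y; lra.
apply: lt_le_trans (key _ r1y ys) _.
have -> : y = r2 - (r2 - r1) / 2 by rewrite /y; field.
by apply: J_le_Jbar => //; rewrite divr_gt0// subr_gt0.
Qed.

(** Continuity provides a point b where J exceeds M but is still below M', so
every point with a value above M' lies beyond b. The alternative occurs when M
is at least the supremum of J. *)
Lemma J_level M M' : 0 <= M -> M < M' ->
  (exists b, [/\ b < s, M < J b & J b < M']) \/ (forall r, r <= s -> Jbar r <= M).
Proof.
move=> M0 MM'; have [[r0 r0s Jr0]|none] := pselect (exists2 r, r < s & M < J r); last first.
  right=> r rs; apply/ler_addgt0Pr => e e0; have [del d0 h] := Jbar_approx rs e0.
  rewrite -lerBlDr; apply: (le_trans h); rewrite leNgt; apply/negP => h'.
  by apply: none; exists (r - del) => //; lra.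
left; have [J1|J1] := ltP (J r0) M'; first by exists r0.
have [c cI Jc] : exists2 c, c \in `[g - 1, r0] & J c = (M + M') / 2.
  have g1 : g - 1 < g by lra.
  have gr : g - 1 <= r0.
    by rewrite leNgt; apply/negP => h; rewrite J_below in J1; lra.
  apply: IVT => //.
    apply: continuous_in_subspaceT => x /set_mem; rewrite /= in_itv /= => /andP[_ xr].
    apply/cvgrPdist_le => e e0.
    have [d d0 h] := J_cont (le_lt_trans xr r0s) e0.
    by exists d => // y /= /h[].
  rewrite (J_below g1) minElt maxElt (le_lt_trans M0 Jr0).
  by apply/andP; split; lra.
move: cI; rewrite in_itv /= => /andP[_ cr]; exists c; rewrite Jc; split; [|lra|lra].
exact: le_lt_trans r0s.
Qed.

End Rate.

(** * Identification of the rate function *)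

Section Esup.
Context {R : realType}.
Implicit Types (u : nat -> \bar R) (y : \bar R).

Lemma limn_esup_le u y (K : nat) : (forall N, (K <= N)%N -> (u N <= y)%E) ->
  (limn_esup u <= y)%E.
Proof.
move=> h; rewrite /limn_esup /limf_esup.
apply: (@le_trans _ _ (ereal_sup (u @` [set N | (K <= N)%N]))).
  by apply: ereal_inf_lbound; exists [set N | (K <= N)%N] => //; exact: nbhs_infty_ge.
by apply: ge_ereal_sup => _ [N /= /h ? <-].
Qed.

Lemma limn_einf_ge u y (K : nat) : (forall N, (K <= N)%N -> (y <= u N)%E) ->
  (y <= limn_einf u)%E.
Proof.
move=> h; rewrite /limn_einf leeNr; apply: (@limn_esup_le _ _ K) => N /h.
by rewrite leeN2.
Qed.

Lemma ereal_between (x y : \bar R) : (x < y)%E -> exists r : R, (x < r%:E)%E /\ (r%:E < y)%E.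
Proof.
case: x y => [x| |] [y| |] //.
- by rewrite lte_fin => xy; exists ((x + y) / 2); rewrite !lte_fin; split; lra.
- by move=> _; exists (x + 1); rewrite ltry lte_fin; split=> //; lra.
- by move=> _; exists (y - 1); rewrite ltNyr lte_fin; split=> //; lra.
- by move=> _; exists 0; rewrite ltNyr ltry.
Qed.

Context {d : measure_display} {T : measurableType d} (P : probability T R).

Lemma log_prob_le N A (c : R) : (0 < N)%N -> measurable A ->
  (P A <= (expR (- (N%:R * c)))%:E)%E -> (log_prob P N A <= (- c)%:E)%E.
Proof.
move=> N0 mA h; rewrite /log_prob.
have NR : 0 < N%:R :> R by rewrite ltr0n.
have -> : (- c)%:E = ((N%:R^-1)%:E * (- (N%:R * c))%:E)%E.
  by rewrite -EFinM mulrN mulrA mulVf ?mul1r// gt_eqF.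
apply: lee_wpmul2l; first by rewrite lee_fin invr_ge0 ltW.
rewrite -[X in (_ <= X%:E)%E]expRK -lne_EFin ?expR_gt0//.
by rewrite lee_lne// in_itv /= ?measure_ge0 ?leey ?lee_fin ?expR_ge0.
Qed.

Lemma log_prob_ge N A (c : R) : (0 < N)%N -> measurable A ->
  ((expR (- (N%:R * c)))%:E <= P A)%E -> ((- c)%:E <= log_prob P N A)%E.
Proof.
move=> N0 mA h; rewrite /log_prob.
have NR : 0 < N%:R :> R by rewrite ltr0n.
have -> : (- c)%:E = ((N%:R^-1)%:E * (- (N%:R * c))%:E)%E.
  by rewrite -EFinM mulrN mulrA mulVf ?mul1r// gt_eqF.
apply: lee_wpmul2l; first by rewrite lee_fin invr_ge0 ltW.
rewrite -[X in (X%:E <= _)%E]expRK -lne_EFin ?expR_gt0//.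
by rewrite lee_lne// in_itv /= ?measure_ge0 ?leey ?lee_fin ?expR_ge0.
Qed.

End Esup.

Section Assembly.
Context {d : measure_display} {T : measurableType d} {R : realType}.
Variables (P : probability T R) (p s t : R) (omega : site -> {RV P >-> bool}).
Hypotheses (p01 : 0 < p < 1) (s0 : 0 < s) (t0 : 0 < t) (iid : iid_bernoulli p omega).

Let ber_p : prob_law (ber p).
Proof. by apply: prob_ber; have [p0 p1] := andP p01; rewrite !ltW. Qed.
Let ber0 : nneg_law (ber p). Proof. by case: ber_p. Qed.

Definition qtail N (a : R) :=
  Elpp p (Num.truncn (N%:R * s)) (Num.truncn (N%:R * t)).+1 (fun l => (a <= l%:R)%R%:R).

Lemma G_floorE N x : G_floor omega s t N x =
  pure (env omega x) (Num.truncn (N%:R * s)) (Num.truncn (N%:R * t)).+1.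
Proof. exact: last_passageE. Qed.

Lemma law_G N (f : nat -> bool) : measurable [set x | f (G_floor omega s t N x)] /\
  P [set x | f (G_floor omega s t N x)] =
  (Elpp p (Num.truncn (N%:R * s)) (Num.truncn (N%:R * t)).+1 (fun l => (f l)%:R))%:E.
Proof.
have := law_pure p01 iid 0 0 (Num.truncn (N%:R * s)) (Num.truncn (N%:R * t)).+1 f.
by under eq_set => x do rewrite shift0 -G_floorE.
Qed.

Lemma P_tail N a : P [set x | (a <= (G_floor omega s t N x)%:R)%R] = (qtail N a)%:E.
Proof. by rewrite (law_G N (fun l => (a <= l%:R)%R)).2. Qed.

Lemma Elpp_ge0 m n (f : nat -> bool) : 0 <= Elpp p m n (fun l => (f l)%:R).
Proof. by apply: Ex_ge0 => [|Ws]; [do 2 apply: nneg_lpow|case: (f _)]. Qed.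

Lemma Elpp_le1 m n (f : nat -> bool) : Elpp p m n (fun l => (f l)%:R) <= 1.
Proof. by apply: Ex_le_cst => [|Ws]; [do 2 apply: prob_lpow|case: (f _)]. Qed.

Lemma Elpp_le m n (f g : nat -> bool) : (forall l, f l -> g l) ->
  Elpp p m n (fun l => (f l)%:R) <= Elpp p m n (fun l => (g l)%:R).
Proof.
move=> fg; apply: Ex_le => [|Ws]; first by do 2 apply: nneg_lpow.
by apply: ind_le; exact: fg.
Qed.

Lemma truncnD_le (x y : R) : 0 <= x -> 0 <= y ->
  (Num.truncn x + Num.truncn y <= Num.truncn (x + y))%N.
Proof.
move=> x0 y0; apply: nat_le_truncn; first exact: addr_ge0.
by rewrite natrD lerD//; apply: (truncn_bounds _).1.
Qed.

Lemma qtail_super N M a b : qtail N a * qtail M b <= qtail (N + M) (a + b).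
Proof.
have st x : 0 < x -> forall k : nat, 0 <= k%:R * x :> R by move=> x0 k; rewrite mulr_ge0// ltW.
have hs := truncnD_le (st s s0 N) (st s s0 M).
have ht := truncnD_le (st t t0 N) (st t t0 M).
rewrite -!mulrDl -natrD in hs ht.
rewrite -lee_fin /qtail.
have := @indep_pure R d T P p omega p01 iid 0 0 (Num.truncn (N%:R * s)) (Num.truncn (N%:R * t)).+1
  (Num.truncn (N%:R * s)) (Num.truncn (N%:R * t)) (Num.truncn (M%:R * s)) (Num.truncn (M%:R * t)).+1
  (fun l => (a <= l%:R)%R) (fun l => (b <= l%:R)%R).
move=> <-; last by rewrite add0n.
have [mE1 _] := law_pure p01 iid 0 0 (Num.truncn (N%:R * s)) (Num.truncn (N%:R * t)).+1 (fun l => (a <= l%:R)%R).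
have [mE2 _] := law_pure p01 iid (Num.truncn (N%:R * s)) (Num.truncn (N%:R * t)) (Num.truncn (M%:R * s)) (Num.truncn (M%:R * t)).+1 (fun l => (b <= l%:R)%R).
have [mE3 <-] := law_pure p01 iid 0 0 (Num.truncn ((N + M)%:R * s)) (Num.truncn ((N + M)%:R * t)).+1 (fun l => (a + b <= l%:R)%R).
apply: le_measure; rewrite ?inE//; first exact: measurableI.
move=> x [/= h1 h2]; apply: (le_trans (lerD h1 h2)); rewrite -natrD ler_nat !shift0.
apply: leq_trans (pure_superadd _ _ _ _ _) _.
by apply: pure_mono; rewrite ?addnS.
Qed.

Definition neg_ln_p := - ln p.

Lemma neg_ln_p_ge0 : 0 <= neg_ln_p.
Proof. by have /andP[p0 p1] := p01; rewrite /neg_ln_p oppr_ge0 ln_le0// ltW. Qed.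

Lemma pure_all_open W Ws m n : size W = m -> all id W -> (m <= pure (cfg (W :: Ws)) m n.+1)%N.
Proof.
move=> sW aW; suff h i : (i <= m)%N -> (i <= pure (cfg (W :: Ws)) i n.+1)%N by exact: h.
elim: i => // i IH im; rewrite (leq_trans _ (pure_mono _ (leqnn _) (ltn0Sn n)))//.
have {}IH : (i <= pure (cfg (W :: Ws)) i 1)%N.
  elim: i im {IH} => // i IH im; rewrite pureS /cfg /=.
  have -> : nth false W i = true by apply: (all_nthP false aW); rewrite sW ltnW.
  by rewrite leq_max addn1 ltnS IH// ltnW.
rewrite pureS /cfg /=.
have -> : nth false W i = true by apply: (all_nthP false aW); rewrite sW.
by rewrite leq_max addn1 ltnS IH.
Qed.

(** If the weights of the bottom row are all 1, a horizontal path collects them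
all. *)
Lemma qtail_lower N a : a <= N%:R * s - 1 -> expR (- (N%:R * (s * neg_ln_p))) <= qtail N a.
Proof.
move=> aN; have /andP[p0 p1] := p01.
have Ns0 : 0 <= N%:R * s by rewrite mulr_ge0// ltW.
set m := Num.truncn (N%:R * s).
have [m1 m2] := truncn_bounds Ns0; rewrite -/m in m1 m2.
apply: (@le_trans _ _ (p ^+ m)).
  have -> : p ^+ m = expR (- (m%:R * neg_ln_p)).
    by rewrite /neg_ln_p mulrN opprK expRM_natl lnK.
  by rewrite ler_expR lerN2 mulrA ler_wpM2r ?neg_ln_p_ge0.
rewrite /qtail /Elpp -/m Ex_lpowS.
have -> : p ^+ m = Ex (lpow (ber p) m) (fun W => (all id W)%:R).
  transitivity (Ex (ber p) (fun b : bool => b%:R) ^+ m).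
    by rewrite Ex_ber mulr0 add0r mulr1.
  rewrite -Ex_lpow_prod; apply: eq_Ex => W.
  by elim: W => [|b W IH]; rewrite ?big_nil// big_cons IH -natrM mulnb.
apply: Ex_lpow_size => // W sW.
rewrite -[leLHS](Ex_cst _ (prob_lpow (Num.truncn (N%:R * t)) (prob_lpow m ber_p))).
apply: Ex_le => [|Ws]; first by do 2 apply: nneg_lpow.
apply: ind_le => aW; apply: (le_trans aN); apply: (le_trans m2).
by rewrite ler_nat pure_all_open.
Qed.

Lemma qtail_anti N a b : a <= b -> qtail N b <= qtail N a.
Proof. by move=> ab; apply: (@Elpp_le _ _ (fun l => (b <= l%:R)%R) (fun l => (a <= l%:R)%R)) => l; exact: le_trans. Qed.

Let q_ge0 N a : 0 <= qtail N a. Proof. exact: (Elpp_ge0 _ _ (fun l => (a <= l%:R)%R)). Qed.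
Let q_le1 N a : qtail N a <= 1. Proof. exact: (Elpp_le1 _ _ (fun l => (a <= l%:R)%R)). Qed.

Local Notation g := (g_pp p s t).
Local Notation Jr := (J qtail).
Local Notation Jb := (Jbar qtail s).

Let gs : g <= s. Proof. exact: gpp_le. Qed.

Lemma real_to_nat (K : R) : exists k : nat, forall N, (k <= N)%N -> K <= N%:R.
Proof.
exists (Num.truncn K).+1 => N h; apply: (le_trans (ltW (truncnS_gt _))).
by rewrite ler_nat.
Qed.

Lemma qtail_low r : r < g -> exists K : nat, forall N, (K <= N)%N -> 1 / 2 <= qtail N (N%:R * r).
Proof.
move=> rg; have h2 : 0 < 1 / 2 :> R by lra.
have [K HK] := gpp_lower p01 s0 t0 rg h2; have [k hk] := real_to_nat K.
exists k => N /hk /HK h; rewrite /qtail.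
set m := Num.truncn (N%:R * s) in h *; set n := Num.truncn (N%:R * t) in h *.
have h' := le_trans (Elpp_rows p01 m (N%:R * r) (leqnSn n)) h.
suff : 1 <= Elpp p m n.+1 (fun l => (N%:R * r <= l%:R)%R%:R) + Elpp p m n.+1 (fun l => (l%:R <= N%:R * r)%R%:R) by lra.
rewrite /Elpp -ExD.
rewrite -[leLHS](Ex_cst _ (prob_lpow n.+1 (prob_lpow m ber_p))).
apply: Ex_le => [|Ws]; first by do 2 apply: nneg_lpow.
by apply: (ind_le2 R (a := true)) => _; exact: le_total.
Qed.

Lemma qtail_up r : g < r -> r < s -> exists2 k, 0 < k &
  exists K : nat, forall N, (K <= N)%N -> qtail N (N%:R * r) <= 2 * expR (- (N%:R * k)).
Proof.
move=> gr rs.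
have ts : t < s * ((1 - p) / p).
  by rewrite ltNge; apply/negP => /gpp_flat h; rewrite h in gr; lra.
have [k k0 [K HK]] := gpp_upper p01 s0 t0 ts gr; have [K' hK'] := real_to_nat K.
by exists k => //; exists K' => N /hK' /HK; rewrite [k * _]mulrC.
Qed.

Lemma qtail_tails : upper_tails qtail s neg_ln_p g.
Proof.
split=> //; [exact: neg_ln_p_ge0|exact: qtail_anti|exact: qtail_super|exact: qtail_lower
  |exact: qtail_low|exact: qtail_up].
Qed.

Let tails := qtail_tails.
Let qJ_le r N := @q_le_J _ _ _ _ _ tails r N.
Let qJ_ge r e := @q_ge_J _ _ _ _ _ tails r e.

(** The limit that defines the rate exists, so it is the number J r. *)
Lemma right_tailE r : r < s -> right_tail omega s t r = (Jr r)%:E.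
Proof.
move=> rs; rewrite /right_tail.
suff -> : limn (fun N => log_prob P N [set x | (N%:R * r <= (G_floor omega s t N x)%:R)%R])
    = (- Jr r)%:E by rewrite -EFinN opprK.
apply: cvg_lim => //; apply: cvg_EFin.
  near=> N; rewrite /log_prob P_tail.
  have qp : 0 < qtail N (N%:R * r).
    apply: (q_pos tails); apply: first_indexP => //.
    by near: N; exact: nbhs_infty_ge.
  by rewrite lne_EFin.
apply/cvgrPdist_le => e e0; have [K HK] := qJ_ge rs e0.
near=> N.
have N0 : (0 < N)%N by near: N; exact: nbhs_infty_gt.
have NK : (K <= N)%N by near: N; exact: nbhs_infty_ge.
have NR : 0 < N%:R :> R by rewrite ltr0n.
have qp : 0 < qtail N (N%:R * r) by apply: lt_le_trans (HK _ NK); exact: expR_gt0.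
rewrite /= /log_prob P_tail lne_EFin//=.
have h1 := qJ_le N rs; have h2 := HK _ NK.
rewrite -[leLHS]lnK ?posrE// ler_expR in h1.
rewrite -[leRHS]lnK ?posrE// ler_expR in h2.
have a1 : N%:R^-1 * ln (qtail N (N%:R * r)) <= - Jr r.
  by rewrite ler_pdivrMl// mulrN.
have a2 : - (Jr r + e) <= N%:R^-1 * ln (qtail N (N%:R * r)).
  by rewrite ler_pdivlMl// mulrN.
by rewrite ger0_norm; lra.
Unshelve. all: by end_near. Qed.

Lemma J_rate_s : J_rate omega s t s = (Jb s)%:E.
Proof.
rewrite /J_rate ltxx Jbar_s; apply: cvg_lim => //; apply: cvg_EFin.
  near=> r; rewrite right_tailE//; near: r; exact: nbhs_left_lt.
apply/cvgrPdist_le => e e0.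
have [r0 r0s h] := Js_approx tails e0.
near=> r.
have rs : r < s by near: r; exact: nbhs_left_lt.
have r0r : r0 <= r by near: r; exact: nbhs_left_ge.
rewrite /= right_tailE//=.
have a1 := h r r0r rs.
have a2 := J_le_Js tails rs.
by rewrite ger0_norm; lra.
Unshelve. all: by end_near. Qed.

Lemma I_rateE r : I_rate omega p s t r = if g <= r <= s then (Jb r)%:E else +oo%E.
Proof.
rewrite /I_rate; case: ifP => // /andP[_].
rewrite le_eqVlt => /orP[/eqP ->|rs]; first exact: J_rate_s.
by rewrite /J_rate rs right_tailE// Jbar_lt.
Qed.

End Assembly.

(** * The large deviation principle *)

Section LDP.
Context {d : measure_display} {T : measurableType d} {R : realType}.
Variables (P : probability T R) (p s t : R) (omega : site -> {RV P >-> bool}).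
Hypotheses (p01 : 0 < p < 1) (s0 : 0 < s) (t0 : 0 < t) (iid : iid_bernoulli p omega).

Let ber_p : prob_law (ber p).
Proof. by apply: prob_ber; have [p0 p1] := andP p01; rewrite !ltW. Qed.
Let ber0 : nneg_law (ber p). Proof. by case: ber_p. Qed.

Local Notation q := (qtail p s t).
Local Notation g := (g_pp p s t).
Local Notation Jb := (Jbar q s).

Let gs : g <= s. Proof. exact: gpp_le. Qed.
Let g0 : 0 < g. Proof. exact: gpp_gt0. Qed.
Let tails : upper_tails q s (neg_ln_p p) g. Proof. exact: (qtail_tails p01 s0 t0 iid). Qed.
Let IE := I_rateE p01 s0 t0 iid.

Lemma Elpp_le2 m n (f f1 f2 : nat -> bool) : (forall l, f l -> f1 l || f2 l) ->
  Elpp p m n (fun l => (f l)%:R) <=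
  Elpp p m n (fun l => (f1 l)%:R) + Elpp p m n (fun l => (f2 l)%:R).
Proof.
move=> h; rewrite /Elpp -ExD; apply: Ex_le => [|Ws]; first by do 2 apply: nneg_lpow.
by apply: ind_le2; exact: h.
Qed.

Lemma expR_le_half (y : R) : 1 <= y -> expR (- y) <= 1 / 2.
Proof.
move=> y1; rewrite expRN -[leRHS]invrK lef_pV2 ?posrE ?expR_gt0 ?invr_gt0//.
by have := expR_ge1Dx y; lra.
Qed.

Lemma event_law N (F : set R) : measurable [set x | F (N%:R^-1 * (G_floor omega s t N x)%:R)] /\
  P [set x | F (N%:R^-1 * (G_floor omega s t N x)%:R)] =
  (Elpp p (Num.truncn (N%:R * s)) (Num.truncn (N%:R * t)).+1
     (fun l => (`[< F (N%:R^-1 * l%:R) >])%:R))%:E.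
Proof.
have := law_G s t p01 iid N (fun l => `[< F (N%:R^-1 * l%:R) >]).
have -> // : [set x | `[< F (N%:R^-1 * (G_floor omega s t N x)%:R) >]] =
  [set x | F (N%:R^-1 * (G_floor omega s t N x)%:R)].
by apply/seteqP; split => x /asboolP.
Qed.

(** A closed set that misses g splits into a left part, whose probability is
superexponentially small, and a right part beyond a level b with J b > M. *)
Lemma closed_set_prob (C : set R) (M c : R) : 0 <= M -> M < c -> closed C ->
  (forall r, 0 <= r <= s -> C r -> g <= r -> c < Jb r) ->
  exists K : nat, forall N, (K <= N)%N -> (0 < N)%N ->
    Elpp p (Num.truncn (N%:R * s)) (Num.truncn (N%:R * t)).+1
     (fun l => (`[< (`[0, s] `&` C) (N%:R^-1 * l%:R) >])%:R) <= expR (- (N%:R * M)).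
Proof.
move=> M0 Mc clC hC.
have nCg : ~ C g.
  by move=> Cg; have := hC g _ Cg (lexx _); rewrite (Jbar_g tails) (ltW g0) gs => /(_ isT); lra.
have [e e0 he] : exists2 e : R, 0 < e & forall r, `|g - r| < e -> ~ C r.
  have : nbhs g (~` C) by apply: open_nbhs_nbhs; split=> //; exact: closed_openC.
  by move=> /nbhs_ballP[e e0 be]; exists e => // r /be.
have ge : g - e < g by lra.
have [K1 HK1] := left_tail p01 iid (M + 1) s0 t0 ge.
have [k1 hk1] := real_to_nat K1.
have lt_g (N l : nat) : (0 < N)%N -> C (N%:R^-1 * l%:R) -> N%:R^-1 * l%:R < g ->
    l%:R <= N%:R * (g - e).
  move=> N0 Cl lg; have NR : 0 < N%:R :> R by rewrite ltr0n.
  rewrite -ler_pdivrMl// leNgt; apply/negP => h.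
  by apply: (he (N%:R^-1 * l%:R)) => //; rewrite ger0_norm; lra.
have left N : (k1 <= N)%N -> Elpp p (Num.truncn (N%:R * s)) (Num.truncn (N%:R * t)).+1
      (fun l => (l%:R <= N%:R * (g - e))%R%:R) <= expR (- (N%:R * M)) * expR (- N%:R).
  by move=> /hk1 /HK1; rewrite -expRD; congr (_ <= expR _); ring.
have le_half N : (0 < N)%N -> expR (- N%:R) <= 1 / 2 :> R.
  by move=> N0; apply: expR_le_half; rewrite ler1n.
have [[b [bs Mb bc]]|none] := J_level tails M0 Mc; last first.
  exists k1 => N Nk N0; apply: le_trans (le_trans (left N Nk) _).
    apply: (Elpp_le p01) => l /asboolP[]; rewrite /= in_itv /= => rs Cr.
    apply: (lt_g N l N0 Cr); rewrite ltNge; apply/negP => gr.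
    have := hC _ rs Cr gr; have /andP[_ r1] := rs; have := none _ r1; lra.
  by rewrite ler_piMr ?expR_ge0//; have := le_half N N0; lra.
have [k2 hk2] := real_to_nat (1 / (J q b - M)).
exists (k1 + k2)%N => N Nk N0.
have N1 : (k1 <= N)%N by rewrite (leq_trans _ Nk)// leq_addr.
have N2 : (k2 <= N)%N by rewrite (leq_trans _ Nk)// leq_addl.
have {}hk2 := hk2 N N2; rewrite ler_pdivrMr in hk2; last by lra.
apply: (le_trans (@Elpp_le2 _ _ _ (fun l => (l%:R <= N%:R * (g - e))%R)
    (fun l => (N%:R * b <= l%:R)%R) _)).
  move=> l /asboolP[]; rewrite /= in_itv /= => rs Cr.
  have [rg|gr] := ltP (N%:R^-1 * l%:R) g; first by rewrite (lt_g N l N0 Cr rg).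
  apply/orP; right; rewrite -ler_pdivlMl ?ltr0n// leNgt; apply/negP => rb.
  have := hC _ rs Cr gr; rewrite Jbar_lt; last exact: lt_trans bs.
  by have := J_mono tails (ltW rb) bs; lra.
have h1 := left N N1.
have h2 : q N (N%:R * b) <= expR (- (N%:R * M)) * expR (- (N%:R * (J q b - M))).
  apply: le_trans (q_le_J tails N bs) _; rewrite -expRD ler_expR; lra.
have h3 : expR (- (N%:R * M)) * expR (- (N%:R * (J q b - M))) <= expR (- (N%:R * M)) * (1 / 2).
  by rewrite ler_wpM2l ?expR_ge0// expR_le_half.
have h4 : expR (- (N%:R * M)) * expR (- N%:R) <= expR (- (N%:R * M)) * (1 / 2).
  by rewrite ler_wpM2l ?expR_ge0// le_half.
rewrite /qtail in h2; lra.
Qed.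

Lemma ldp_upper (F : set R) : closed_in `[0, s] F ->
  (limn_esup (fun N : nat =>
     log_prob P N [set x | F (N%:R^-1 * (G_floor omega s t N x)%:R)%R])
   <= - ereal_inf [set I_rate omega p s t r | r in F])%E.
Proof.
move=> [C clC ->]; set c := ereal_inf _.
rewrite leNgt; apply/negP => /ereal_between[y [cy yl]].
move: yl; apply/negP; rewrite -leNgt.
rewrite lteNl -EFinN in cy.
have [K HK] : exists K : nat, forall N, (K <= N)%N -> (0 < N)%N ->
    Elpp p (Num.truncn (N%:R * s)) (Num.truncn (N%:R * t)).+1
     (fun l => (`[< (`[0, s] `&` C) (N%:R^-1 * l%:R) >])%:R) <= expR (- (N%:R * - y)).
  have [y0|y0] := leP 0 (- y); last first.
    exists 0%N => N _ _; apply: (@le_trans _ _ 1); first exact: (Elpp_le1 p01).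
    by rewrite -expR0 ler_expR oppr_ge0 mulr_ge0_le0// ltW.
  have [c' [yc' c'c]] := ereal_between cy; rewrite lte_fin in yc'.
  apply: (closed_set_prob y0 yc' clC) => r rs Cr gr.
  rewrite -lte_fin; apply: (lt_le_trans c'c).
  have /andP[_ r1] := rs.
  have <- : I_rate omega p s t r = (Jb r)%:E by rewrite IE gr r1.
  by apply: ereal_inf_lbound; exists r => //; split=> //=; rewrite in_itv.
apply: (@limn_esup_le _ _ _ K.+1) => N NK.
have N0 : (0 < N)%N by exact: leq_trans NK.
have [mE PE] := event_law N (`[0, s] `&` C).
rewrite -[y]opprK; apply: log_prob_le => //.
by rewrite PE lee_fin; apply: HK => //; exact: ltnW.
Qed.

(** For r < s the window [r, b) has probability at least P(G >= N r) -
P(G >= N b), and the second term is negligible because J is strictly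
increasing. For r = s the window reaches the largest possible value of G. *)
Lemma open_set_prob (U : set R) (r e : R) : open U -> U r -> g <= r <= s -> 0 < e ->
  exists K : nat, forall N, (K <= N)%N -> (0 < N)%N ->
    expR (- (N%:R * (Jb r + e))) <=
    Elpp p (Num.truncn (N%:R * s)) (Num.truncn (N%:R * t)).+1
     (fun l => (`[< (`[0, s] `&` U) (N%:R^-1 * l%:R) >])%:R).
Proof.
move=> oU Ur /andP[gr rs] e0; have s0' := s0.
have [del del0 hdel] : exists2 del : R, 0 < del & forall r', `|r - r'| < del -> U r'.
  have : nbhs r U by apply: open_nbhs_nbhs; split.
  by move=> /nbhs_ballP[del d0 be]; exists del => // r' /be.
move: rs; rewrite le_eqVlt => /orP[/eqP rE|rs].
  pose b := Num.max (s - del / 2) (s / 2).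
  have bs : b < s by rewrite /b gt_max; apply/andP; split; lra.
  have b0 : 0 < b by rewrite /b lt_max; apply/orP; right; lra.
  have bd : s - del / 2 <= b by rewrite le_max lexx.
  have [K HK] := q_ge_J tails bs e0.
  exists K => N NK N0; have NR : 0 < N%:R :> R by rewrite ltr0n.
  apply: le_trans (le_trans (HK N NK) _).
    rewrite ler_expR lerN2 ler_wpM2l// lerD2r rE Jbar_s.
    exact: J_le_Js tails _ bs.
  rewrite /qtail /Elpp; apply: Ex_le => [|Ws]; first by do 2 apply: nneg_lpow.
  apply: ind_le => h; apply/asboolP; split.
    rewrite /= in_itv /= mulr_ge0//= ler_pdivrMl//.
    apply: (@le_trans _ _ (Num.truncn (N%:R * s))%:R); first by rewrite ler_nat pure_le.
    by apply: (truncn_bounds _).1; rewrite mulr_ge0// ltW.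
  have h1 : b <= N%:R^-1 * (pure (cfg Ws) (Num.truncn (N%:R * s)) (Num.truncn (N%:R * t)).+1)%:R.
    by rewrite ler_pdivlMl.
  have h2 : N%:R^-1 * (pure (cfg Ws) (Num.truncn (N%:R * s)) (Num.truncn (N%:R * t)).+1)%:R <= s.
    rewrite ler_pdivrMl//.
    apply: (@le_trans _ _ (Num.truncn (N%:R * s))%:R); first by rewrite ler_nat pure_le.
    by apply: (truncn_bounds _).1; rewrite mulr_ge0// ltW.
  by apply: hdel; rewrite rE ger0_norm; lra.
pose b := Num.min (r + del / 2) ((r + s) / 2).
have rb : r < b by rewrite /b lt_min; apply/andP; split; lra.
have bs : b < s by rewrite /b gt_min; apply/orP; right; lra.
have bd : b <= r + del / 2 by rewrite ge_min lexx.
have Jrb : J q r < J q b.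
  have := Jbar_strict tails gr rb (ltW bs).
  by rewrite (Jbar_lt _ rs) (Jbar_lt _ bs).
pose e' := Num.min (e / 2) ((J q b - J q r) / 2).
have e'0 : 0 < e' by rewrite lt_min; apply/andP; split; lra.
have e'1 : e' <= e / 2 by rewrite ge_min lexx.
have e'2 : e' <= (J q b - J q r) / 2 by rewrite ge_min lexx orbT.
have [K HK] := q_ge_J tails rs e'0.
have [k hk] := real_to_nat (1 / e').
exists (K + k)%N => N Nk N0; have NR : 0 < N%:R :> R by rewrite ltr0n.
have N1 : (K <= N)%N by rewrite (leq_trans _ Nk)// leq_addr.
have N2 : (k <= N)%N by rewrite (leq_trans _ Nk)// leq_addl.
have {}hk := hk N N2; rewrite ler_pdivrMr// in hk.
rewrite (Jbar_lt _ rs).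
have h1 := HK N N1.
have h2 := q_le_J tails N bs.
have := @Elpp_le2 (Num.truncn (N%:R * s)) (Num.truncn (N%:R * t)).+1
  (fun l => (N%:R * r <= l%:R)%R) (fun l => `[< (`[0, s] `&` U) (N%:R^-1 * l%:R) >])
  (fun l => (N%:R * b <= l%:R)%R).
rewrite -/(q N (N%:R * r)) -/(q N (N%:R * b)) => h3.
have hinc : forall l : nat, N%:R * r <= l%:R ->
    `[< (`[0, s] `&` U) (N%:R^-1 * l%:R) >] || (N%:R * b <= l%:R)%R.
  move=> l rl; have [bl|lb] := leP (N%:R * b) l%:R; first by rewrite orbT.
  rewrite orbF; apply/asboolP.
  have a1 : r <= N%:R^-1 * l%:R by rewrite ler_pdivlMl.
  have a2 : N%:R^-1 * l%:R < b by rewrite ltr_pdivrMl.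
  split; last by apply: hdel; rewrite ler0_norm; lra.
  rewrite /= in_itv /=; apply/andP; split; last by lra.
  by apply: le_trans a1; apply: le_trans gr; exact: ltW.
have {}h3 := h3 hinc.
set X := expR (- (N%:R * (J q r + e'))) in h1.
have h4 : expR (- (N%:R * J q b)) <= X * (1 / 2).
  apply: (@le_trans _ _ (X * expR (- (N%:R * e')))).
    have : N%:R * (e' + e') <= N%:R * (J q b - J q r) by rewrite ler_wpM2l//; lra.
    by rewrite -expRD ler_expR; lra.
  by rewrite ler_wpM2l ?expR_ge0// expR_le_half.
have h5 : expR (- (N%:R * (J q r + e))) <= X * (1 / 2).
  apply: (@le_trans _ _ (X * expR (- (N%:R * e')))).
    have : N%:R * (e' + e') <= N%:R * e by rewrite ler_wpM2l//; lra.
    by rewrite -expRD ler_expR; lra.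
  by rewrite ler_wpM2l ?expR_ge0// expR_le_half.
lra.
Qed.

Lemma ldp_lower (H : set R) : open_in `[0, s] H ->
  (- ereal_inf [set I_rate omega p s t r | r in H]
   <= limn_einf (fun N : nat =>
     log_prob P N [set x | H (N%:R^-1 * (G_floor omega s t N x)%:R)%R]))%E.
Proof.
move=> [U oU ->]; rewrite leeNl; apply: le_ereal_inf_tmp => _ [r [/= r0s Ur] <-].
rewrite IE; case: ifPn => grs; last by rewrite leey.
rewrite leeNl leNgt; apply/negP => /ereal_between[y [ly yr]].
rewrite -EFinN lte_fin in yr.
have e0 : 0 < - Jb r - y by lra.
have [K HK] := open_set_prob oU Ur grs e0.
move: ly; apply/negP; rewrite -leNgt.
apply: (@limn_einf_ge _ _ _ K.+1) => N NK.
have N0 : (0 < N)%N by exact: leq_trans NK.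
have [mE PE] := event_law N (`[0, s] `&` U).
rewrite -[y]opprK; apply: log_prob_ge => //.
rewrite PE lee_fin; apply: le_trans (HK N (ltnW NK) N0).
by have -> : Jb r + (- Jb r - y) = - y by ring.
Qed.

Lemma Jbar_continuous (r : R) : Jb x @[x --> r] --> Jb r.
Proof.
apply/cvgrPdist_le => e e0.
have [rs|sr] := ltP r s.
  have [del d0 h] := J_cont tails rs e0.
  by exists del => // r' /= /h[r's]; rewrite !Jbar_lt.
have [r0 r0s h] := Js_approx tails e0.
exists (s - r0) => /=; first by lra.
move=> r' /= hr; have r0r' : r0 < r' by move: hr; rewrite ltr_norml => /andP[]; lra.
have -> : Jb r = Js q s by rewrite /Jbar ltNge sr.
have [r's|sr'] := ltP r' s; last by rewrite /Jbar ltNge sr' subrr normr0 ltW.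
rewrite Jbar_lt//; have h1 := h r' (ltW r0r') r's; have h2 := J_le_Js tails r's.
by rewrite ger0_norm; lra.
Qed.

Lemma I_rate_continuous : {within `[g, s], continuous (I_rate omega p s t)}.
Proof.
apply: (@subspace_eq_continuous _ _ _ (EFin \o Jb)).
  by move=> r /set_mem; rewrite /= in_itv /= => grs; have := IE r; rewrite grs => E; exact: (esym E).
apply: continuous_subspaceT => r; apply: cvg_EFin; first exact: nearW.
exact: Jbar_continuous.
Qed.

Lemma I_rate_convex :
  convex_function (`[g, s]%classic : set R^o) (fun r : R^o => fine (I_rate omega p s t r)).
Proof.
move=> l x y /set_mem /=; rewrite in_itv /= => xgs /set_mem /=; rewrite in_itv /= => ygs.
have l01 : 0 <= (l%:inum : R) <= 1 by rewrite ge0 le1.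
have /andP[gx xs] := xgs; have /andP[gy ys] := ygs; have /andP[l0 l1] := l01.
have zE : conv l x y = l%:inum * x + (1 - l%:inum) * y :> R by [].
have zgs : g <= conv l x y <= s.
  rewrite zE; have l1' : 0 <= 1 - l%:inum :> R by lra.
  have a1 := ler_wpM2l l0 gx; have a2 := ler_wpM2l l1' gy.
  have a3 := ler_wpM2l l0 xs; have a4 := ler_wpM2l l1' ys.
  by apply/andP; split; lra.
by rewrite !IE xgs ygs zgs /= zE; exact: (Jbar_convex tails xs ys l01).
Qed.

Lemma I_rate_eq0 r : I_rate omega p s t r = 0%E <-> r = g.
Proof.
rewrite IE; split => [|->]; last by rewrite lexx gs (Jbar_g tails).
case: ifP => // /andP[gr rs] [Jr0]; apply/eqP; rewrite eq_le gr andbT leNgt; apply/negP => gr'.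
by have := Jbar_strict tails (lexx g) gr' rs; rewrite (Jbar_g tails) Jr0 ltxx.
Qed.

End LDP.

Theorem theorem3p4 (d : measure_display) (T : measurableType d) (R : realType)
    (P : probability T R) (p s t : R) (omega : site -> {RV P >-> bool})
    (hp : 0 < p < 1) (hs : 0 < s) (ht : 0 < t)
    (homega : iid_bernoulli p omega) :
  let g := g_pp p s t in
  let I := I_rate omega p s t in
  let G := G_floor omega s t in
  (forall F : set R, closed_in `[0, s] F ->
    (limn_esup (fun N : nat =>
       log_prob P N [set x | F (N%:R^-1 * (G N x)%:R)%R])
     <= - ereal_inf [set I r | r in F])%E) /\
  (forall H : set R, open_in `[0, s] H ->
    (- ereal_inf [set I r | r in H]
     <= limn_einf (fun N : nat =>
       log_prob P N [set x | H (N%:R^-1 * (G N x)%:R)%R]))%E) /\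
  (forall r : R, g <= r <= s -> I r \is a fin_num) /\
  (forall r1 r2 : R, g <= r1 <= s -> g <= r2 <= s -> r1 < r2 ->
    (I r1 < I r2)%E) /\
  {within `[g, s], continuous I} /\
  convex_function (`[g, s]%classic : set R^o) (fun r : R^o => fine (I r)) /\
  (forall r : R, I r = 0%E <-> r = g).
Proof.
have IE := I_rateE hp hs ht homega.
split; first by move=> F; exact: ldp_upper.
split; first by move=> H; exact: ldp_lower.
split; first by move=> r grs; rewrite IE grs.
split.
  move=> r1 r2 grs1 grs2 r12; rewrite !IE grs1 grs2 lte_fin.
  have /andP[gr1 _] := grs1; have /andP[_ r2s] := grs2.
  exact: (Jbar_strict (qtail_tails hp hs ht homega) gr1 r12 r2s).
split; first exact: I_rate_continuous.
split; first exact: I_rate_convex.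
by move=> r; exact: I_rate_eq0.
Qed.
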